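(* The following algorithm computes the unique decomposition $f=\ell_1^3+\ell_2^3+\ell_3^3+\ell_4^3+\ell_5^3$ of a general cubic $f\in\mathbb{R}[x_1,x_2,x_3,x_4]_3$. Input: a general quaternary cubic $f$. Output: the decomposition $f=\ell_1^3+\ell_2^3+\ell_3^3+\ell_4^3+\ell_5^3$. \begin{enumerate} \item Compute the apolar ideal $f^\perp$. It is generated by six quadrics $g_1,g_2,g_3,g_4,g_5,g_6$. \item Compute the syzygies of $f^\perp$. Find the five linear syzygies $l_{ij}$, $i=1,\dots,5$, $j=1,\dots,6$, on the quadrics, satisfying $\sum_{j=1}^6 l_{ij}g_j=0$ for all $i=1,\dots,5$. \item Compute a vector $(c_1,c_2,c_3,c_4,c_5,c_6)\in\mathbb{R}^6\setminus\{0\}$ that satisfies $c_1l_{i1}+c_2l_{i2}+c_3l_{i3}+c_4l_{i4}+c_5l_{i5}+c_6l_{i6}=0$ for all $i=1,\dots,5$. \item Let $J$ be the ideal generated by the quadrics $c_6g_1-c_1g_6,\ c_6g_2-c_2g_6,\ \dots,\ c_6g_5-c_5g_6$. Compute the variety $V(J)$ in $\mathbb{P}^3$. It consists precisely of the points dual to $\ell_1,\ell_2,\dots,\ell_5$. \end{enumerate}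
   Context: A quaternary cubic is a homogeneous form of degree $3$ in four variables. ''General'' means: for all $f$ in some nonempty Zariski open subset of the space of such cubics. By Sylvester's Pentahedral Theorem (proved by Clebsch), a general quaternary cubic $f\in\mathbb{R}[x_1,x_2,x_3,x_4]$ has complex rank $5$, and its decomposition $f=\ell_1^3+\dots+\ell_5^3$ as a sum of five cubes of complex linear forms is unique (up to order and multiplying the $\ell_i$ by cube roots of unity). The apolar ideal $f^\perp$ is the ideal, in the polynomial ring of differential operators with constant coefficients $\mathbb{R}[\partial/\partial x_1,\dots,\partial/\partial x_4]$, of operators annihilating $f$. A linear syzygy on $g_1,\dots,g_6$ is a tuple of linear forms $(l_1,\dots,l_6)$ in this ring with $\sum_j l_jg_j=0$; ''the five linear syzygies'' are five linearly independent ones. The ring is viewed as the homogeneous coordinate ring of the $\mathbb{P}^3$ of linear forms up to scalar: the point dual to the linear form $\ell=\sum a_ix_i$ is $[a_1:a_2:a_3:a_4]$. The variety $V(J)$ is taken over $\mathbb{C}$.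
   Formalization: Step 4 is stated for any index k with c_k nonzero, using the quadrics c_k g_j − c_j g_k; as printed (k = 6) it fails when c_6 = 0, which happens when g_6 vanishes at all five points, since then J is generated by g_6 alone. *)

(* Defs.v *)
From HB Require Import structures.
From mathcomp Require Import all_boot all_order all_fingroup all_algebra.
From mathcomp Require Import reals complex mpoly.

Set Implicit Arguments.
Unset Strict Implicit.
Unset Printing Implicit Defensive.

Import Order.TTheory GRing.Theory Num.Theory.
Local Open Scope ring_scope.

(* The coordinates on the 20-dimensional space of quaternary cubics are the
   coefficients at the monomials of degree 3 in four variables. *)
Definition cubic_monomials : {set 'X_{1..4 < 4}} :=
  [set m : 'X_{1..4 < 4} | mdeg m == 3].

Definition cubic_coef (R : nzRingType) (f : {mpoly R[4]})
    (i : 'I_#|cubic_monomials|) : R :=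
  f@_(enum_val i : 'X_{1..4 < 4}).

(* The complement, in the space of cubics, of the common zero locus of the
   polynomials in S. *)
Definition zariski_open_of (R : comNzRingType)
    (S : {mpoly R[#|cubic_monomials|]} -> Prop) (f : {mpoly R[4]}) : Prop :=
  f \is 3.-homog /\ exists P, S P /\ P.@[cubic_coef f] <> 0.

Definition for_general_cubic (R : comNzRingType)
    (Q : {mpoly R[4]} -> Prop) : Prop :=
  exists S : {mpoly R[#|cubic_monomials|]} -> Prop,
    (exists f, zariski_open_of S f) /\
    (forall f, zariski_open_of S f -> Q f).

(* The variable 'X_i of D stands for the operator d/dx_i. *)
Definition diffop (R : nzRingType) (n : nat) (D f : {mpoly R[n]}) : {mpoly R[n]} :=
  \sum_(m <- msupp D) D@_m *: mderivm m f.

Definition apolar_ideal (R : nzRingType) (n : nat) (f D : {mpoly R[n]}) : Prop :=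
  diffop D f = 0.

Definition ideal_gen (R : nzRingType) (n k : nat)
    (g : 'I_k -> {mpoly R[n]}) (p : {mpoly R[n]}) : Prop :=
  exists h : 'I_k -> {mpoly R[n]}, p = \sum_(j < k) h j * g j.

Definition quadric_generators (R : nzRingType) (n k : nat)
    (I : {mpoly R[n]} -> Prop) (g : 'I_k -> {mpoly R[n]}) : Prop :=
  (forall j, g j \is 2.-homog) /\ (forall p, I p <-> ideal_gen g p).

Definition linear_syzygy (R : nzRingType) (n k : nat)
    (g s : 'I_k -> {mpoly R[n]}) : Prop :=
  (forall j, s j \is 1.-homog) /\ \sum_(j < k) s j * g j = 0.

Definition syz_independent (R : nzRingType) (n k r : nat)
    (l : 'I_r -> 'I_k -> {mpoly R[n]}) : Prop :=
  forall a : 'I_r -> R,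
    (forall j, \sum_(i < r) a i *: l i j = 0) -> forall i, a i = 0.

Definition independent_linear_syzygies (R : nzRingType) (n k r : nat)
    (g : 'I_k -> {mpoly R[n]}) (l : 'I_r -> 'I_k -> {mpoly R[n]}) : Prop :=
  (forall i, linear_syzygy g (l i)) /\ syz_independent l.

Definition syz_span (R : nzRingType) (n k r : nat)
    (l : 'I_r -> 'I_k -> {mpoly R[n]}) (s : 'I_k -> {mpoly R[n]}) : Prop :=
  exists a : 'I_r -> R, forall j, s j = \sum_(i < r) a i *: l i j.

Definition syz_relation (R : nzRingType) (n k r : nat)
    (l : 'I_r -> 'I_k -> {mpoly R[n]}) (c : 'rV[R]_k) : Prop :=
  forall i, \sum_(j < k) c 0 j *: l i j = 0.

(* The quadrics c_k g_j - c_j g_k for j != k, the index j being [lift k j'].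
   With k = ord_max these are c_6 g_1 - c_1 g_6, ..., c_6 g_5 - c_5 g_6. *)
Definition pivot_quadrics (R : nzRingType) (n : nat)
    (g : 'I_6 -> {mpoly R[n]}) (c : 'rV[R]_6) (k : 'I_6) (j' : 'I_5) :
    {mpoly R[n]} :=
  c 0 k *: g (lift k j') - c 0 (lift k j') *: g k.

Definition complexify (R : rcfType) (n : nat) (p : {mpoly R[n]}) :
    {mpoly R[i][n]} :=
  map_mpoly (real_complex R) p.

Definition linear_form (R : nzRingType) (n : nat) (a : 'rV[R]_n) : {mpoly R[n]} :=
  \sum_(i < n) a 0 i *: 'X_i.

(* f is the sum of the cubes of the linear forms whose coefficient vectors
   are the ell i. *)
Definition is_cubes_decomposition (R : rcfType) (n r : nat)
    (f : {mpoly R[n]}) (ell : 'I_r -> 'rV[R[i]]_n) : Prop :=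
  complexify f = \sum_(i < r) linear_form (ell i) ^+ 3.

Definition is_unique_cubes_decomposition (R : rcfType) (n r : nat)
    (f : {mpoly R[n]}) (ell : 'I_r -> 'rV[R[i]]_n) : Prop :=
  is_cubes_decomposition f ell /\
  forall ell' : 'I_r -> 'rV[R[i]]_n, is_cubes_decomposition f ell' ->
    exists s : 'S_r, forall i, exists w : R[i],
      w ^+ 3 = 1 /\ ell' i = w *: ell (s i).

(* The scalar t is automatically nonzero. *)
Definition same_point (K : nzRingType) (n : nat) (z a : 'rV[K]_n) : Prop :=
  [/\ z != 0, a != 0 & exists t : K, z = t *: a].

(* Points of P^(n-1) over R[i] are represented by nonzero vectors. *)
Definition proj_variety (R : rcfType) (n : nat)
    (J : {mpoly R[n]} -> Prop) (z : 'rV[R[i]]_n) : Prop :=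
  z != 0 /\ forall p, J p -> (complexify p).@[fun i => z 0 i] = 0.

(* Main.v *)
Require Import Defs.
From HB Require Import structures.
From mathcomp Require Import all_boot all_order all_fingroup all_algebra.
From mathcomp Require Import separable reals complex mpoly.
From mathcomp Require Import ring zify lra bigenough ssrcomplements.
Import BigEnough.

(* If f is the sum of the cubes of five linear forms with coefficient vectors
   a_0, ..., a_4 in general position, choose coordinates Y in which the first
   four points are the coordinate points and the last one is the unit point.
   The apolar quadrics are then spanned by the five quadrics Y_i Y_j - Y_0 Y_1,
   which cut out exactly the five points, and one quadric q which vanishes at
   none of them.  Since contracting f with an apolar quadric g gives
   \sum_i g(a_i) a_i = 0, the vector of values (g(a_i))_i is a multiple of the
   unique linear relation between the a_i.  So for generators g_j of the apolar
   ideal the vectors (g_j(a_i))_j are proportional to one vector c, evaluation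
   at a_i shows that c annihilates all linear syzygies, and it is the only such
   vector up to scaling because the linear syzygies of the Y_i Y_j - Y_0 Y_1
   involve all five of them.  The quadrics c_k g_j - c_j g_k therefore span the
   quadrics through the five points.  Uniqueness of the decomposition follows
   because the apolar ideal, and with it these points, depends only on f.
   There are exactly five linear syzygies because the degree 3 part of the
   apolar ideal is a hyperplane: 24 - 19 = 5.

   For existence, let A_0, ..., A_3 be the slices of the symmetric tensor of
   third derivatives of f, with A_0 invertible.  The commutators
   A_j A_0^-1 A_k - A_k A_0^-1 A_j are skew of rank at most 2, hence generically
   of the form u_k u_j^T - u_j u_k^T.  Bordering A_k A_0^-1 with u_k gives three
   5 x 5 matrices which commute because of the Jacobi identity.  When their
   spectrum is simple, their joint eigenvectors give the five linear forms. *)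

Set Implicit Arguments.
Unset Strict Implicit.
Unset Printing Implicit Defensive.
Import Order.TTheory GRing.Theory Num.Theory.
Local Open Scope ring_scope.

(** Why one border suffices: if [f] is a sum of five cubes, then A_k = P D_k P^T with P of size 4 x
    5 and D_k diagonal, and the A_k A_0^-1 fail to commute only because P is not square. Completing
    P to an invertible 5 x 5 matrix Q with Q D_0 Q^T block diagonal makes them corners of the
    commuting matrices Q D_k D_0^-1 Q^-1; the construction recovers these without knowing P. Two
    constraints shape the rest. Genericity is witnessed by an explicit polynomial in the 20
    coefficients rather than by a dimension count: the matrices are cleared of denominators, and the
    polynomial is computed at one cubic to see that it is nonzero. Moreover [f], the generators, the
    syzygies and [c] are real whereas the five points are complex. Statements are proved over the
    large field and brought down by taking real parts coefficientwise, of an identity and of its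
    multiple by [w]. For the same reason explicit generators of the apolar ideal are built from the
    third derivatives of [f], not from the points. *)

Local Notation "p @! z" := (meval (fun i => z 0 i) p) (at level 40).

(** * Differential operators and forms *)

Lemma mnm_gt0 n (m : 'X_{1..n}) : m != 0%MM -> exists k, (0 < m k)%N.
Proof.
case: (pickP (fun k => 0 < m k)%N) => [k hk _|h0 /eqP[]]; first by exists k.
by apply/mnmP=> i; rewrite mnm0E; have := h0 i; case: (m i).
Qed.

Lemma dhomog_mdeg (R : nzRingType) n d (p : {mpoly R[n]}) m :
  p \is d.-homog -> m \in msupp p -> mdeg m = d.
Proof. by move=> /dhomog_mf; apply. Qed.

(** Every monomial of degree [d.+1] has a variable to split off, and that variable is rewritten in
    the [Y i]. Iterated, this reduces claims on quadrics and cubics to products of the adapted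
    coordinates of a pentad. *)
Lemma homogS_ind (R : comNzRingType) (n r d : nat)
    (Y : 'I_r -> {mpoly R[n]}) (Q : {mpoly R[n]} -> Prop) :
  (forall k, exists b : 'I_r -> R, 'X_k = \sum_i b i *: Y i) ->
  Q 0 -> (forall p q, Q p -> Q q -> Q (p + q)) ->
  (forall i p, p \is d.-homog -> Q (p * Y i)) ->
  forall p, p \is d.+1.-homog -> Q p.
Proof.
move=> XY Q0 QD QM p /dhomog_mdeg hp.
rewrite [p]mpolyE big_seq; elim/big_ind: _ => // m /hp hm.
have [k hk] : exists k, (0 < m k)%N.
  by apply: mnm_gt0; apply/eqP => m0; rewrite m0 mdeg0 in hm.
have dm : (mdeg (m - U_(k))%MM = d).
  have := mdegD (m - U_(k))%MM U_(k); rewrite mdeg1 submK ?lep1mP -?lt0n //.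
  by rewrite hm addn1 => -[].
have [b hb] := XY k.
have -> : 'X_[m] = 'X_[m - U_(k)] * 'X_k :> {mpoly R[n]}.
  by rewrite -mpolyXD submK // lep1mP -lt0n.
rewrite hb mulr_sumr scaler_sumr; elim/big_ind: _ => // i _.
rewrite -scalerAr scalerA scalerAl.
by apply: QM; apply: dhomogZ; rewrite dhomogX; apply/eqP.
Qed.

Section Diffop.
Variables (R : comNzRingType) (n : nat).
Implicit Types D E f g : {mpoly R[n]}.

Lemma diffopwE D f k : (msize D <= k)%N ->
  diffop D f = \sum_(m : 'X_{1..n < k}) D@_m *: mderivm m f.
Proof.
move=> le_Dk; pose I : subFinType _ := 'X_{1..n < k}.
rewrite /diffop (big_mksub I) //=; first last.
- by move=> x /msize_mdeg_lt /leq_trans /(_ le_Dk) ->.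
- by rewrite msupp_uniq.
rewrite big_rmcond //= => m /memN_msupp_eq0 ->.
by rewrite scale0r.
Qed.

Lemma diffopDl D E f : diffop (D + E) f = diffop D f + diffop E f.
Proof.
pose_big_enough k.
  rewrite !(@diffopwE _ _ k) // -big_split; apply: eq_bigr => m _ /=.
  by rewrite mcoeffD scalerDl.
by close.
Qed.

Lemma diffopZl c D f : diffop (c *: D) f = c *: diffop D f.
Proof.
pose_big_enough k.
  rewrite !(@diffopwE _ _ k) // scaler_sumr; apply: eq_bigr => m _ /=.
  by rewrite mcoeffZ scalerA.
by close.
Qed.

Lemma diffop0l f : diffop 0 f = 0.
Proof. by rewrite /diffop msupp0 big_nil. Qed.

Lemma diffop_suml (I : Type) (r : seq I) (P : pred I) F f :
  diffop (\sum_(i <- r | P i) F i) f = \sum_(i <- r | P i) diffop (F i) f.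
Proof.
exact: (big_morph (fun D => diffop D f) (fun D E => diffopDl D E f) (diffop0l f)).
Qed.

Lemma diffopX m f : diffop 'X_[m] f = mderivm m f.
Proof. by rewrite /diffop msuppX big_seq1 mcoeffX eqxx scale1r. Qed.

Lemma diffopDr D f g : diffop D (f + g) = diffop D f + diffop D g.
Proof.
by rewrite /diffop -big_split; apply: eq_bigr => m _; rewrite mderivmD scalerDr.
Qed.

Lemma diffopZr D c f : diffop D (c *: f) = c *: diffop D f.
Proof.
rewrite /diffop scaler_sumr; apply: eq_bigr => m _.
by rewrite mderivmZ !scalerA mulrC.
Qed.

Lemma diffop0r D : diffop D 0 = 0.
Proof. by rewrite -[X in diffop D X](scale0r 0) diffopZr scale0r. Qed.

Lemma diffop_sumr (I : Type) (r : seq I) (P : pred I) D F :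
  diffop D (\sum_(i <- r | P i) F i) = \sum_(i <- r | P i) diffop D (F i).
Proof. exact: (big_morph (diffop D) (diffopDr D) (diffop0r D)). Qed.

Lemma diffopM D E f : diffop (D * E) f = diffop D (diffop E f).
Proof.
rewrite [in LHS](mpolyE D) mulr_suml diffop_suml; apply: eq_bigr => m _.
rewrite -scalerAl diffopZl; congr (_ *: _).
rewrite [in LHS](mpolyE E) mulr_sumr diffop_suml -[in RHS]diffopX diffop_sumr.
apply: eq_bigr => m' _.
by rewrite -scalerAr diffopZl diffopZr -mpolyXD !diffopX addmC mderivmDm.
Qed.

(** As [0.-1 = 0], the first part says too little about constants; the second supplies the
    vanishing. The same pairing recurs below for the truncated [e - d]. *)
Lemma mderiv_homog e i f :
  f \is e.-homog -> (mderiv i f \is e.-1.-homog) /\ (e = 0%N -> mderiv i f = 0).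
Proof.
move=> hf; split=> [|e0].
  apply/dhomogP => m; rewrite mcoeff_msupp mcoeff_deriv => hm.
  have : f@_(m + U_(i)) != 0 by apply: contraNneq hm => ->; rewrite mul0rn.
  by rewrite -mcoeff_msupp => /(dhomog_mdeg hf); rewrite mdegD mdeg1 addn1 => <-.
apply/mpolyP => m; rewrite mcoeff_deriv mcoeff0.
have ne : mdeg (m + U_(i)) != e by rewrite e0 mdegD mdeg1 addn1.
by rewrite (dhomog_nemf_coeff hf ne) mul0rn.
Qed.

Lemma mnm_ind (P : 'X_{1..n} -> Prop) :
  P 0%MM -> (forall m i, P m -> P (m + U_(i))%MM) -> forall m, P m.
Proof.
move=> P0 PS m; have [d] := ubnP (mdeg m); elim: d m => // d IH m lt_md.
have [->//|/eqP m0] := m =P 0%MM.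
have [k hk] := mnm_gt0 m0.
have e : m = ((m - U_(k)) + U_(k))%MM by rewrite submK ?lep1mP -?lt0n.
rewrite e; apply: PS; apply: IH.
by move: lt_md; rewrite {1}e mdegD mdeg1 addn1.
Qed.

Lemma mderivm_homog e m f : f \is e.-homog ->
  (mderivm m f \is (e - mdeg m).-homog) /\
  ((e < mdeg m)%N -> mderivm m f = 0).
Proof.
move=> hf; elim/mnm_ind: m => [|m i [IH1 IH2]].
  by rewrite mderivm0m mdeg0 subn0.
rewrite mderivmDm mderivmU1m mdegD mdeg1 addn1.
have [h1 h2] := mderiv_homog i IH1; rewrite subnS; split=> //.
rewrite ltnS leq_eqVlt => /orP[/eqP e_m|/IH2->]; last by rewrite mderiv0.
by apply: h2; rewrite e_m subnn.
Qed.

Lemma diffop_homog d e D f : D \is d.-homog -> f \is e.-homog ->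
  (diffop D f \is (e - d).-homog) /\ ((e < d)%N -> diffop D f = 0).
Proof.
move=> hD hf; rewrite /diffop big_seq; split=> [|lt_ed].
  apply: rpred_sum => m /(dhomog_mdeg hD) <-; apply: dhomogZ.
  by have [] := mderivm_homog m hf.
apply: big1 => m /(dhomog_mdeg hD) hm; have [_ ->] := mderivm_homog m hf.
  by rewrite scaler0.
by rewrite hm.
Qed.

(** Components of [D] of distinct degrees at most [e] send [f] to distinct degrees, so they vanish
    separately. Those of degree above [e] kill [f] anyway; they are set apart because [e - d']
    truncates to 0 for all of them. *)
Lemma apolar_ideal_pihomog e d f D : f \is e.-homog ->
  apolar_ideal f D -> apolar_ideal f (pihomog mdeg d D).
Proof.
rewrite /apolar_ideal => hf D0.
have hd := pihomogP mdeg d D.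
have [h1 h2] := diffop_homog hd hf.
have [/h2//|le_de] := ltnP e d.
have lt_D : (msize D <= (msize D + d).+1)%N by rewrite leqW ?leq_addr.
have DE : diffop D f =
    \sum_(d' < (msize D + d).+1) diffop (pihomog mdeg d' D) f.
  by rewrite {1}(pihomog_partitionE lt_D) diffop_suml.
have lt_d : (d < (msize D + d).+1)%N by rewrite ltnS leq_addl.
rewrite -(pihomog_dE h1); move/(congr1 (pihomog mdeg (e - d))): DE.
rewrite D0 raddf0 raddf_sum (bigD1 (Ordinal lt_d)) //= big1 ?addr0 => [<- //|].
move=> d' ne_d'.
have [h1' h2'] := diffop_homog (pihomogP mdeg d' D) hf.
have [/h2' -> |le_d'e] := ltnP e d'; first by rewrite raddf0.
apply: pihomog_ne0 h1'; apply: contra_neq ne_d' => e_eq.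
by apply: val_inj => /=; rewrite -(subKn le_d'e) e_eq subKn.
Qed.

Lemma mderiv_linear_form (a : 'rV[R]_n) i :
  mderiv i (linear_form a) = (a 0 i)%:MP.
Proof.
rewrite /linear_form raddf_sum (bigD1 i) //= big1 ?addr0 => [|j ne_ji].
  rewrite mderivZ mderivX mnm1E eqxx scale1r.
  by rewrite (_ : (_ - _ = 0)%MM) ?mpolyX0 ?alg_mpolyC //; apply/mnmP=> k; rewrite mnmBE mnm0E subnn.
by rewrite mderivZ mderivX mnm1E (negPf ne_ji) scale0r scaler0.
Qed.

Lemma mderiv_exp i f k : mderiv i (f ^+ k) = k%:R *: (f ^+ k.-1 * mderiv i f).
Proof.
elim: k => [|k IH]; first by rewrite expr0 scale0r -mpolyC1 mderivC.
rewrite exprS mderivM IH /=; case: k {IH} => [|k].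
  by rewrite scale0r mulr0 addr0 mulrC scale1r.
rewrite -scalerAr mulrA -exprS [_ * f ^+ _]mulrC -[k.+2]addn1 natrD scalerDl.
by rewrite scale1r addrC.
Qed.

Lemma mderivm_linear_form_exp (a : 'rV[R]_n) k m :
  mderivm m (linear_form a ^+ k) =
  ((k ^_ (mdeg m))%:R * \prod_i a 0 i ^+ m i) *: linear_form a ^+ (k - mdeg m).
Proof.
elim/mnm_ind: m => [|m i IH].
  rewrite mderivm0m mdeg0 ffactn0 subn0 mul1r big1 ?scale1r // => i _.
  by rewrite mnm0E expr0.
rewrite mderivmDm mderivmU1m IH mderivZ mderiv_exp mderiv_linear_form.
rewrite mdegD mdeg1 addn1 [_ ^+ _ * _%:MP]mulrC mul_mpolyC !scalerA subnS ffactnSr natrM.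
congr (_ *: _); rewrite -!mulrA; congr (_ * _).
rewrite [RHS]mulrC (bigD1 i) //= [in RHS](bigD1 i) //=.
rewrite mnmDE mnm1E eqxx addn1 exprSr.
under [in RHS]eq_bigr => j ne do rewrite mnmDE mnm1E eq_sym (negPf ne) addn0.
set u := \prod_(_ | _) _; set w := (k - mdeg m)%:R; set v := a 0 i; ring.
Qed.

(** Here operators become evaluations at the point dual to the linear form. The falling factorial is
    0 when [k < d], in agreement with the vanishing of the derivative. *)
Lemma diffop_linear_form_exp (a : 'rV[R]_n) k d D : D \is d.-homog ->
  diffop D (linear_form a ^+ k) =
  ((k ^_ d)%:R * D.@[fun i => a 0 i]) *: linear_form a ^+ (k - d).
Proof.
move=> /dhomog_mdeg hD; rewrite /diffop mevalE mulr_sumr scaler_suml.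
rewrite !big_seq; apply: eq_bigr => m /hD hm.
rewrite mderivm_linear_form_exp hm scalerA; congr (_ *: _).
by rewrite mulrCA.
Qed.

End Diffop.

Section LinearForms.
Variables (R : comNzRingType) (n : nat).
Implicit Types (a b : 'rV[R]_n) (p : {mpoly R[n]}).

Lemma linear_form_homog a : linear_form a \is 1.-homog.
Proof. by apply: rpred_sum => i _; apply: dhomogZ; rewrite dhomogX /= mdeg1. Qed.

Lemma linear_form_coef a i : (linear_form a)@_U_(i) = a 0 i.
Proof.
rewrite /linear_form raddf_sum (bigD1 i) //= big1 ?addr0 => [|j ne_ji].
  by rewrite mcoeffZ mcoeffX eqxx mulr1.
rewrite mcoeffZ mcoeffX; case: eqP => [/mnmP/(_ i)|]; last by rewrite mulr0.
by rewrite !mnm1E eqxx (negPf ne_ji).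
Qed.

Lemma linear_form_eq0 a : linear_form a = 0 -> a = 0.
Proof.
by move=> a0; apply/rowP => i; rewrite -linear_form_coef a0 mcoeff0 mxE.
Qed.

Lemma linear_formD a b : linear_form (a + b) = linear_form a + linear_form b.
Proof.
by rewrite -big_split; apply: eq_bigr => i _ /=; rewrite mxE scalerDl.
Qed.

Lemma linear_formZ c a : linear_form (c *: a) = c *: linear_form a.
Proof.
by rewrite scaler_sumr; apply: eq_bigr => i _ /=; rewrite mxE scalerA.
Qed.

Lemma linear_form0 : linear_form (0 : 'rV[R]_n) = 0.
Proof. by apply: big1 => i _; rewrite mxE scale0r. Qed.

Lemma linear_form_sum (I : Type) (r : seq I) (P : pred I) (F : I -> 'rV[R]_n) :
  linear_form (\sum_(i <- r | P i) F i) = \sum_(i <- r | P i) linear_form (F i).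
Proof. exact: (big_morph (@linear_form R n) linear_formD linear_form0). Qed.

Lemma meval_linear_form a b : linear_form a @! b = \sum_i a 0 i * b 0 i.
Proof.
rewrite /linear_form raddf_sum /=; apply: eq_bigr => i _.
by rewrite mevalZ mevalXU.
Qed.

Lemma dhomog0_const p : p \is 0.-homog -> p = (p@_0%MM)%:MP.
Proof.
move=> hp; apply/mpolyP=> m; rewrite mcoeffC.
have [->|ne_m0] := eqVneq; first by rewrite mulr1.
have ne : mdeg m != 0%N by rewrite mdeg_eq0.
by rewrite mulr0 (dhomog_nemf_coeff hp ne).
Qed.

Lemma mnm_eq_mnm1 (m : 'X_{1..n}) : mdeg m = 1%N -> exists i, m = U_(i)%MM.
Proof.
move=> m1; have [|i hi] := @mnm_gt0 n m.
  by apply/eqP => m0; rewrite m0 mdeg0 in m1.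
exists i; have le : (U_(i) <= m)%MM by rewrite lep1mP -lt0n.
have := mdegD (m - U_(i))%MM U_(i); rewrite submK // m1 mdeg1 addn1 => -[/esym/eqP].
by rewrite mdeg_eq0 => /eqP e; rewrite -(submK le) e add0m.
Qed.

Lemma dhomog1_linear_form p : p \is 1.-homog -> p = linear_form (\row_i p@_U_(i)).
Proof.
move=> hp; apply/mpolyP=> m.
have [m1|ne] := eqVneq (mdeg m) 1%N; last first.
  rewrite (dhomog_nemf_coeff hp ne).
  by rewrite (dhomog_nemf_coeff (linear_form_homog _) ne).
by have [i ->] := mnm_eq_mnm1 m1; rewrite linear_form_coef mxE.
Qed.

Lemma meval_homogZ d p c a : p \is d.-homog -> p @! (c *: a) = c ^+ d * (p @! a).
Proof.
move=> /dhomog_mdeg hp; rewrite !mevalE mulr_sumr !big_seq.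
apply: eq_bigr => m /hp <-; rewrite mulrCA; congr (_ * _).
rewrite mdegE -prodrXr -big_split; apply: eq_bigr => i _ /=.
by rewrite mxE exprMn.
Qed.

Lemma meval_linearD p a b : p \is 1.-homog -> p @! (a + b) = p @! a + p @! b.
Proof.
move=> /dhomog1_linear_form ->; rewrite !meval_linear_form -big_split.
by apply: eq_bigr => i _ /=; rewrite [(a + b) 0 i]mxE mulrDr.
Qed.

Lemma meval_linear_sum p (I : Type) (r : seq I) (P : pred I) (F : I -> 'rV[R]_n) :
  p \is 1.-homog ->
  p @! (\sum_(i <- r | P i) F i) = \sum_(i <- r | P i) (p @! F i).
Proof.
move=> hp; elim/big_rec2: _ => [|i y z _ <-]; last exact: meval_linearD.
by rewrite -(scale0r 0) (meval_homogZ _ _ hp) mul0r.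
Qed.

End LinearForms.

(** * Finitely generated ideals and their homogeneous elements *)

Section IdealGen.
Variables (R : comNzRingType) (n k : nat) (g : 'I_k -> {mpoly R[n]}).
Implicit Types p q h : {mpoly R[n]}.

Lemma ideal_gen0 : ideal_gen g 0.
Proof. by exists (fun=> 0); rewrite big1 // => j _; rewrite mul0r. Qed.

Lemma ideal_genD p q : ideal_gen g p -> ideal_gen g q -> ideal_gen g (p + q).
Proof.
move=> [h ->] [h' ->]; exists (fun j => h j + h' j).
by rewrite -big_split; apply: eq_bigr => j _; rewrite mulrDl.
Qed.

Lemma ideal_genM h p : ideal_gen g p -> ideal_gen g (h * p).
Proof.
move=> [h' ->]; exists (fun j => h * h' j).
by rewrite mulr_sumr; apply: eq_bigr => j _; rewrite mulrA.
Qed.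

Lemma ideal_genZ c p : ideal_gen g p -> ideal_gen g (c *: p).
Proof. by rewrite -mul_mpolyC; apply: ideal_genM. Qed.

Lemma ideal_genN p : ideal_gen g p -> ideal_gen g (- p).
Proof. by rewrite -scaleN1r; apply: ideal_genZ. Qed.

Lemma ideal_genB p q : ideal_gen g p -> ideal_gen g q -> ideal_gen g (p - q).
Proof. by move=> hp /ideal_genN; apply: ideal_genD. Qed.

Lemma ideal_gen_sum (I : Type) (r : seq I) (P : pred I) F :
  (forall i, P i -> ideal_gen g (F i)) -> ideal_gen g (\sum_(i <- r | P i) F i).
Proof.
move=> hF; elim/big_ind: _ => //; [exact: ideal_gen0 | exact: ideal_genD].
Qed.

Lemma ideal_gen_mem j : ideal_gen g (g j).
Proof.
exists (fun i => (i == j)%:R); rewrite (bigD1 j) //= eqxx mul1r big1 ?addr0 //.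
by move=> i /negPf ->; rewrite mul0r.
Qed.

Lemma ideal_gen_homog d e p : (forall j, g j \is e.-homog) ->
  p \is (d + e).-homog -> ideal_gen g p ->
  exists2 h : 'I_k -> {mpoly R[n]},
    forall j, h j \is d.-homog & p = \sum_(j < k) h j * g j.
Proof.
move=> hg hp [h ep]; exists (fun j => pihomog mdeg d (h j)).
  by move=> j; apply: pihomogP.
rewrite -(pihomog_dE hp) ep raddf_sum; apply: eq_bigr => j _ /=.
have [N ltN] : exists N, (msize (h j) <= N)%N by exists (msize (h j)).
have leN : (msize (h j) <= (N + d).+1)%N.
  by rewrite (leq_trans ltN) // leqW ?leq_addr.
rewrite {1}(pihomog_partitionE leN) mulr_suml raddf_sum.
have lt_d : (d < (N + d).+1)%N by rewrite ltnS leq_addl.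
rewrite (bigD1 (Ordinal lt_d)) //= big1 ?addr0.
  by rewrite pihomog_dE // dhomogM // pihomogP.
move=> d' ne_d'; apply: (@pihomog_ne0 _ _ _ (d' + e)%N); last first.
  by rewrite dhomogM // pihomogP.
by rewrite eqn_add2r; apply: contra_neq ne_d' => ?; apply: val_inj.
Qed.

End IdealGen.

Lemma ideal_gen_trans (R : comNzRingType) n k l (g : 'I_k -> {mpoly R[n]})
    (g' : 'I_l -> {mpoly R[n]}) p :
  (forall j, ideal_gen g' (g j)) -> ideal_gen g p -> ideal_gen g' p.
Proof.
by move=> hg [h ->]; apply: ideal_gen_sum => j _; apply: ideal_genM.
Qed.

(** * Five points in general position *)

Local Notation o0 := (@Ordinal 4 0 isT).
Local Notation o1 := (@Ordinal 4 1 isT).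
Local Notation o2 := (@Ordinal 4 2 isT).
Local Notation o3 := (@Ordinal 4 3 isT).

Lemma ord4P (P : 'I_4 -> Prop) : P o0 -> P o1 -> P o2 -> P o3 -> forall i, P i.
Proof.
move=> h0 h1 h2 h3 [[|[|[|[|//]]]] h].
- by rewrite (_ : Ordinal h = o0) //; apply: val_inj.
- by rewrite (_ : Ordinal h = o1) //; apply: val_inj.
- by rewrite (_ : Ordinal h = o2) //; apply: val_inj.
- by rewrite (_ : Ordinal h = o3) //; apply: val_inj.
Qed.

Lemma sum_ord4 (V : zmodType) (F : 'I_4 -> V) :
  \sum_i F i = F o0 + F o1 + F o2 + F o3.
Proof.
by rewrite !big_ord_recr big_ord0 /= add0r; congr (F _ + F _ + F _ + F _);
  apply: val_inj.
Qed.

Local Notation e0 := (@Ordinal 6 0 isT).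
Local Notation e1 := (@Ordinal 6 1 isT).
Local Notation e2 := (@Ordinal 6 2 isT).
Local Notation e3 := (@Ordinal 6 3 isT).
Local Notation e4 := (@Ordinal 6 4 isT).
Local Notation e5 := (@Ordinal 6 5 isT).

Lemma ord6P (P : 'I_6 -> Prop) :
  P e0 -> P e1 -> P e2 -> P e3 -> P e4 -> P e5 -> forall i, P i.
Proof.
move=> h0 h1 h2 h3 h4 h5 [[|[|[|[|[|[|//]]]]]] h].
- by rewrite (_ : Ordinal h = e0) //; apply: val_inj.
- by rewrite (_ : Ordinal h = e1) //; apply: val_inj.
- by rewrite (_ : Ordinal h = e2) //; apply: val_inj.
- by rewrite (_ : Ordinal h = e3) //; apply: val_inj.
- by rewrite (_ : Ordinal h = e4) //; apply: val_inj.
- by rewrite (_ : Ordinal h = e5) //; apply: val_inj.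
Qed.

Lemma sum_ord6 (V : zmodType) (F : 'I_6 -> V) :
  \sum_i F i = F e0 + F e1 + F e2 + F e3 + F e4 + F e5.
Proof.
rewrite !big_ord_recr big_ord0 /= add0r.
by congr (F _ + F _ + F _ + F _ + F _ + F _); apply: val_inj.
Qed.

Local Notation wd := (widen_ord (leqnSn 4)).

Lemma lift_ord_max (j : 'I_4) : lift ord_max j = wd j.
Proof. by apply: val_inj => /=; rewrite /bump leqNgt ltn_ord. Qed.

(* Four base points with the fifth at the unit point: Y is the coordinate
   system in which the points a (wd i) are multiples of the coordinate points
   and a ord_max is (1 : 1 : 1 : 1). *)
Record pentad (K : fieldType) (a : 'I_5 -> 'rV[K]_4)
    (Y : 'I_4 -> {mpoly K[4]}) (tau : 'I_4 -> K) : Prop := Pentad {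
  pentad_homog : forall i, Y i \is 1.-homog;
  pentad_span : forall k, exists b : 'I_4 -> K, 'X_k = \sum_i b i *: Y i;
  pentad_tau : forall i, tau i != 0;
  pentad_base : forall i j, Y i @! a (wd j) = tau i *+ (i == j);
  pentad_unit : forall i, Y i @! a ord_max = 1 }.

Section Pentad.
Variables (K : fieldType) (a : 'I_5 -> 'rV[K]_4).
Variables (Y : 'I_4 -> {mpoly K[4]}) (tau : 'I_4 -> K).
Hypothesis Ya : pentad a Y tau.

Let Yh := pentad_homog Ya.
Let XY := pentad_span Ya.
Let tau0 := pentad_tau Ya.
Let Yb := pentad_base Ya.
Let Yu := pentad_unit Ya.

Let s : {mpoly K[4]} := Y o0 * Y o1.
(** [eta] and [kappa] are forced by the vanishing of the polar sum of [q]: normalised to 1 at the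
    unit point, [q] must take the value [- (tau i)^-1] at [a (wd i)], where only [Y i ^+ 2]
    survives, with value [tau i ^+ 2]; [kappa] then adjusts the value at the unit point. *)
Let eta i : K := (tau i)^-3.
Let kappa : K := 1 + \sum_i eta i.
Let q : {mpoly K[4]} := kappa *: s - \sum_i eta i *: Y i ^+ 2.

Definition pentad_quadrics (m : 'I_6) : {mpoly K[4]} :=
  [:: q; Y o0 * Y o2 - s; Y o0 * Y o3 - s; Y o1 * Y o2 - s;
      Y o1 * Y o3 - s; Y o2 * Y o3 - s]`_m.

Local Notation E := pentad_quadrics.

Lemma pentad_YM_homog i j : Y i * Y j \is 2.-homog.
Proof. by rewrite -[2%N]/(1 + 1)%N dhomogM. Qed.

Lemma pentad_quadrics_homog m : E m \is 2.-homog.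
Proof.
elim/ord6P: m; rewrite /E /=; try by rewrite rpredB // pentad_YM_homog.
rewrite rpredB ?rpredZ ?pentad_YM_homog //; apply: rpred_sum => i _.
by rewrite rpredZ // expr2 pentad_YM_homog.
Qed.

Lemma meval_Y_inj (z z' : 'rV[K]_4) : (forall i, Y i @! z = Y i @! z') -> z = z'.
Proof.
move=> h; apply/rowP => k; rewrite -(mevalXU (fun i => z 0 i)).
rewrite -(mevalXU (fun i => z' 0 i)); have [b ->] := XY k.
by rewrite !raddf_sum; apply: eq_bigr => i _ /=; rewrite !mevalZ h.
Qed.

(* The span of the quadrics vanishing at all five points. *)
Let J2 (p : {mpoly K[4]}) := exists c : 'I_6 -> K, c e0 = 0 /\ p = \sum_m c m *: E m.

Let J2_0 : J2 0.
Proof. by exists (fun=> 0); split=> //; rewrite big1 // => m _; rewrite scale0r. Qed.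

Let J2_D p p' : J2 p -> J2 p' -> J2 (p + p').
Proof.
move=> [c [c0 ->]] [c' [c0' ->]]; exists (fun m => c m + c' m).
rewrite c0 c0' addr0 -big_split; split=> //.
by apply: eq_bigr => m _ /=; rewrite scalerDl.
Qed.

Let J2_Z x p : J2 p -> J2 (x *: p).
Proof.
move=> [c [c0 ->]]; exists (fun m => x * c m); rewrite c0 mulr0; split=> //.
by rewrite scaler_sumr; apply: eq_bigr => m _; rewrite scalerA.
Qed.

Let J2_E m : m != e0 -> J2 (E m).
Proof.
move=> m0; exists (fun i => (i == m)%:R); rewrite eq_sym (negPf m0); split=> //.
rewrite (bigD1 m) //= eqxx scale1r big1 ?addr0 // => i /negPf ->.
by rewrite scale0r.
Qed.

Let J2_pair i j : i != j -> J2 (Y i * Y j - s).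
Proof.
elim/ord4P: i; elim/ord4P: j => //= _;
  rewrite /s ?subrr // ?[Y o1 * Y o0]mulrC ?subrr //;
  try by [exact: (@J2_E e1) | exact: (@J2_E e2) | exact: (@J2_E e3)
         | exact: (@J2_E e4) | exact: (@J2_E e5)].
- by rewrite [Y o2 * _]mulrC; exact: (@J2_E e1).
- by rewrite [Y o2 * _]mulrC; exact: (@J2_E e3).
- by rewrite [Y o3 * _]mulrC; exact: (@J2_E e2).
- by rewrite [Y o3 * _]mulrC; exact: (@J2_E e4).
- by rewrite [Y o3 * _]mulrC; exact: (@J2_E e5).
Qed.

(** Modulo the five quadrics all products [Y i * Y j] with [i != j] agree with [s]. This leaves [s]
    and the four squares, whose coefficients can be read off from the values at the five points. *)
Lemma homog2_normal_form D : D \is 2.-homog ->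
  exists (al : K) (d : 'I_4 -> K), J2 (D - al *: s - \sum_i d i *: Y i ^+ 2).
Proof.
pose Q D := exists (al : K) (d : 'I_4 -> K), J2 (D - al *: s - \sum_i d i *: Y i ^+ 2).
have Q0 : Q 0.
  exists 0, (fun=> 0); rewrite scale0r subr0 big1 ?subr0 // => i _.
  by rewrite scale0r.
have QD p p' : Q p -> Q p' -> Q (p + p').
  move=> [al [d h]] [al' [d' h']]; exists (al + al'), (fun i => d i + d' i).
  have := J2_D h h'; congr J2.
  under [in RHS]eq_bigr => i _ do rewrite scalerDl.
  by rewrite big_split /= scalerDl; ring.
move: D; apply: (homogS_ind XY Q0 QD) => i p hp.
move: p hp; apply: (homogS_ind XY) => [|p p' h h'|j p /dhomog0_const ->].
- by rewrite mul0r.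
- by rewrite mulrDl; apply: QD.
rewrite mul_mpolyC -scalerAl; set c := p@_ _.
have [->|ne_ij] := eqVneq j i.
  exists 0, (fun k => c *+ (k == i)); rewrite scale0r subr0 (bigD1 i) //= eqxx.
  rewrite mulr1n -expr2 big1 ?addr0 ?subrr // => k /negPf ->.
  by rewrite scale0r.
exists c, (fun=> 0); rewrite [\sum_i _]big1 => [|k _]; last by rewrite scale0r.
by rewrite subr0 -scalerBr; apply/J2_Z/J2_pair.
Qed.

Let E_base m j : m != e0 -> E m @! a (wd j) = 0.
Proof.
elim/ord6P: m => // _; rewrite /E /= mevalB !mevalM !Yb;
 by elim/ord4P: j; rewrite /= ?mulr0n ?mul0r ?mulr0 ?subrr.
Qed.

Let E_unit m : m != e0 -> E m @! a ord_max = 0.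
Proof. by elim/ord6P: m => // _; rewrite /E /= mevalB !mevalM !Yu subrr. Qed.

Let s_base j : s @! a (wd j) = 0.
Proof. by rewrite /s mevalM !Yb; elim/ord4P: j; rewrite /= ?mulr0n ?mul0r ?mulr0. Qed.

Let sum_sq_base (d : 'I_4 -> K) j :
  (\sum_i d i *: Y i ^+ 2) @! a (wd j) = d j * tau j ^+ 2.
Proof.
rewrite raddf_sum (bigD1 j) //= mevalZ expr2 mevalM !Yb eqxx mulr1n -expr2.
rewrite big1 ?addr0 // => i ne_ij.
by rewrite mevalZ expr2 mevalM !Yb (negPf ne_ij) mulr0n !mulr0.
Qed.

Let s_unit : s @! a ord_max = 1. Proof. by rewrite /s mevalM !Yu mulr1. Qed.

Let sum_sq_unit (d : 'I_4 -> K) :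
  (\sum_i d i *: Y i ^+ 2) @! a ord_max = \sum_i d i.
Proof.
rewrite raddf_sum; apply: eq_bigr => i _ /=.
by rewrite mevalZ expr2 mevalM Yu !mulr1.
Qed.

Let E0_unit : E e0 @! a ord_max = 1.
Proof.
by rewrite /E /= /q mevalB mevalZ s_unit sum_sq_unit mulr1 /kappa addrK.
Qed.

Let E0_base j : E e0 @! a (wd j) = - (tau j)^-1.
Proof.
rewrite /E /= /q mevalB mevalZ s_base mulr0 sub0r sum_sq_base /eta; congr (- _).
by field.
Qed.

(* Contracting f = sum of the cubes of the five linear forms with D gives
   6 times this sum. *)
Definition polar_sum D : 'rV[K]_4 := \sum_k (D @! a k) *: a k.

Lemma polar_sum_eq0P D : D \is 2.-homog ->
  polar_sum D = 0 <-> forall i, (D @! a (wd i)) * tau i + D @! a ord_max = 0.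
Proof.
move=> hD.
have Yp i : Y i @! polar_sum D = (D @! a (wd i)) * tau i + D @! a ord_max.
  rewrite meval_linear_sum // big_ord_recr /= (meval_homogZ _ _ (Yh i)) Yu expr1 mulr1.
  congr (_ + _); rewrite (bigD1 i) //= (meval_homogZ _ _ (Yh i)) Yb eqxx expr1.
  rewrite big1 ?addr0 // => j ne_ji.
  by rewrite (meval_homogZ _ _ (Yh i)) Yb eq_sym (negPf ne_ji) mulr0.
split=> [p0 i|h].
  by rewrite -Yp p0 -(scale0r 0) (meval_homogZ _ _ (Yh i)) expr1 mul0r.
apply: meval_Y_inj => i; rewrite Yp h.
by rewrite -(scale0r 0) (meval_homogZ _ _ (Yh i)) expr1 mul0r.
Qed.

Lemma polar_sum_pentad_quadrics m : polar_sum (E m) = 0.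
Proof.
apply/polar_sum_eq0P => [|i]; first exact: pentad_quadrics_homog.
have [->|m0] := eqVneq m e0; last by rewrite E_base ?E_unit // mul0r addr0.
by rewrite E0_unit E0_base mulNr mulVf // addNr.
Qed.

(** The value [x] at the unit point and the vanishing polar sum dictate the values at the base
    points, hence the normal form: its coefficients are [x] times those of [q]. *)
Lemma pentad_quadrics_span D : D \is 2.-homog -> polar_sum D = 0 ->
  exists2 c : 'I_6 -> K, c e0 = D @! a ord_max & D = \sum_m c m *: E m.
Proof.
move=> hD /polar_sum_eq0P-/(_ hD) D0.
have [al [d [c [c0 eD]]]] := homog2_normal_form hD.
have {eD}eD : D = \sum_m c m *: E m + al *: s + \sum_i d i *: Y i ^+ 2.
  by rewrite -eD; ring.
set x := D @! a ord_max in D0 *.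
have J0 k : (\sum_m c m *: E m) @! a k = 0.
  rewrite raddf_sum big1 // => m _ /=; rewrite mevalZ.
  have [->|m0] := eqVneq m e0; first by rewrite c0 mul0r.
  have [j ->|->] := unliftP ord_max k; last by rewrite E_unit ?mulr0.
  rewrite lift_ord_max ?E_base ?mulr0 //.
have dE i : d i = - x * eta i.
  have := D0 i; rewrite {1}eD !mevalD J0 mevalZ s_base mulr0 !add0r sum_sq_base.
  move/eqP; rewrite addr_eq0 -mulrA -exprSr => /eqP <-.
  by rewrite /eta mulfK // expf_neq0.
have alE : al = x * kappa.
  have : D @! a ord_max = x by [].
  rewrite {1}eD !mevalD J0 mevalZ s_unit mulr1 add0r sum_sq_unit.
  under eq_bigr => i _ do rewrite dE.
  by rewrite -mulr_sumr mulNr => /eqP; rewrite subr_eq => /eqP->; rewrite /kappa mulrDr mulr1.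
exists (fun m => if m == e0 then x else c m) => //.
rewrite (bigD1 e0) //= {1}eD alE [in LHS](bigD1 e0) //= c0 scale0r add0r.
under [in RHS]eq_bigr => m /negPf m0 do rewrite m0.
rewrite {1}/E /= /q scalerBr scalerA scaler_sumr.
under [X in _ + _ + X]eq_bigr => i _ do rewrite dE mulNr scaleNr -scalerA.
by rewrite sumrN [RHS]addrC addrA.
Qed.

Lemma pentad_quadrics_free (c : 'I_6 -> K) :
  \sum_m c m *: E m = 0 -> forall m, c m = 0.
Proof.
move=> h.
have c0 : c e0 = 0.
  have := congr1 (fun p => p @! a ord_max) h; rewrite /= meval0 raddf_sum.
  rewrite (bigD1 e0) //= mevalZ E0_unit mulr1 big1 ?addr0 // => m m0.
  by rewrite mevalZ E_unit ?mulr0.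
(* In the coordinates [Y] this is the sum of the i-th and j-th unit vectors. As [c e0 = 0], and [s]
   vanishes there unless {i, j} = {0, 1}, only the quadric of [Y i * Y j] survives. *)
pose z i j := (tau i)^-1 *: a (wd i) + (tau j)^-1 *: a (wd j).
have Yz k i j : Y k @! z i j = (k == i)%:R + (k == j)%:R.
  rewrite meval_linearD // !(meval_homogZ _ _ (Yh k)) !Yb !expr1 !mulrnAr.
  by do 2!case: eqVneq => [->|_]; rewrite ?mulVf ?mulr0n ?mulr1n.
have hz i j : (\sum_m c m *: E m) @! z i j = 0 by rewrite h meval0.
have ez i j m : E m @! z i j = E m @! z i j by [].
elim/ord6P => //.
- have := hz o0 o2; rewrite sum_ord6 c0 scale0r !mevalD !mevalZ meval0 /E /=.
  by rewrite !mevalB /s !mevalM !Yz /= => H; rewrite -{}H; ring.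
- have := hz o0 o3; rewrite sum_ord6 c0 scale0r !mevalD !mevalZ meval0 /E /=.
  by rewrite !mevalB /s !mevalM !Yz /= => H; rewrite -{}H; ring.
- have := hz o1 o2; rewrite sum_ord6 c0 scale0r !mevalD !mevalZ meval0 /E /=.
  by rewrite !mevalB /s !mevalM !Yz /= => H; rewrite -{}H; ring.
- have := hz o1 o3; rewrite sum_ord6 c0 scale0r !mevalD !mevalZ meval0 /E /=.
  by rewrite !mevalB /s !mevalM !Yz /= => H; rewrite -{}H; ring.
- have := hz o2 o3; rewrite sum_ord6 c0 scale0r !mevalD !mevalZ meval0 /E /=.
  by rewrite !mevalB /s !mevalM !Yz /= => H; rewrite -{}H; ring.
Qed.

Let I := ideal_gen E.
Let sigma : {mpoly K[4]} := Y o0 * Y o1 * Y o2.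

Let I_trans p p' p'' : I (p - p') -> I (p' - p'') -> I (p - p'').
Proof. by move=> h1 h2; rewrite -(subrKA p'); apply: ideal_genD. Qed.

Let I_pair p i j : i != j -> I (p * (Y i * Y j) - p * s).
Proof.
move=> ne_ij; rewrite -mulrBr; apply: ideal_genM.
have [c [_ ->]] := J2_pair ne_ij; apply: ideal_gen_sum => m _.
by apply: ideal_genZ; apply: ideal_gen_mem.
Qed.

(** Cubic monomials sharing a factor [p] are congruent as soon as both remaining pairs are mixed,
    since each pair is congruent to [s]. *)
Let I_Ys i : I (Y i * s - sigma).
Proof.
have h p j k j' k' : j != k -> j' != k' -> I (p * (Y j * Y k) - p * (Y j' * Y k')).
  by move=> h1 h2; apply: I_trans (I_pair p h1) _; rewrite -opprB;
    apply: ideal_genN; apply: I_pair.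
elim/ord4P: i; rewrite /sigma /s.
- by have := h (Y o0) o0 o1 o1 o2 isT isT; congr I; ring.
- by have := h (Y o1) o0 o1 o0 o2 isT isT; congr I; ring.
- by have := h (Y o2) o0 o1 o0 o1 isT isT; congr I; ring.
- by have := h (Y o0) o1 o3 o1 o2 isT isT; congr I; ring.
Qed.

Let I_mixed i j k : ~~ ((i == j) && (j == k)) -> I (Y i * Y j * Y k - sigma).
Proof.
have [<-|ne_jk _] := eqVneq j k; last first.
  by rewrite -mulrA; apply: I_trans (I_pair _ ne_jk) (I_Ys i).
rewrite andbT => ne_ij.
rewrite (_ : Y i * Y j * Y j = Y j * (Y i * Y j)); last by ring.
exact: I_trans (I_pair _ ne_ij) (I_Ys j).
Qed.

(** Only [q] contains squares: [Y i * q] reduces to [(1 + eta i) *: sigma - eta i *: Y i ^+ 3] by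
    the mixed case, and multiplying by [tau i ^+ 3] gives the constant. *)
Let I_cube i : I (Y i ^+ 3 - (1 + tau i ^+ 3) *: sigma).
Proof.
have h1 : I (Y i * E e0) by apply/ideal_genM/ideal_gen_mem.
have h2 : I (\sum_(j | j != i) eta j *: (Y i * Y j * Y j - sigma)).
  apply: ideal_gen_sum => j ne_ji; apply: ideal_genZ; apply: I_mixed.
  by rewrite eq_sym (negPf ne_ji).
have h3 : I (kappa *: (Y i * s - sigma)) by apply: ideal_genZ; apply: I_Ys.
have : I (tau i ^+ 3 *: (kappa *: (Y i * s - sigma) -
    \sum_(j | j != i) eta j *: (Y i * Y j * Y j - sigma) - Y i * E e0)).
  by apply: ideal_genZ; apply: ideal_genB => //; apply: ideal_genB.
congr I.
have -> : Y i * E e0 = kappa *: (Y i * s) - eta i *: Y i ^+ 3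
    - \sum_(j | j != i) eta j *: (Y i * Y j * Y j).
  rewrite /E /= /q mulrBr -scalerAr mulr_sumr (bigD1 i) //= opprD addrA.
  congr (_ - _ - _); first by rewrite -scalerAr exprS.
  by apply: eq_bigr => j _; rewrite -scalerAr expr2 mulrA.
under eq_bigr => j _ do rewrite scalerBr.
have -> : kappa = 1 + eta i + \sum_(j | j != i) eta j.
  by rewrite /kappa (bigD1 i) //= addrA.
rewrite sumrB -scaler_suml.
set S := \sum_(j | _) eta j *: _; set u := \sum_(j | _) _.
have h : (tau i ^+ 3)%:MP * (eta i)%:MP = 1 :> {mpoly K[4]}.
  by rewrite -mpolyCM mulfV ?expf_neq0.
rewrite -!mul_mpolyC !mpolyCD.
set x := (tau i ^+ 3)%:MP in h *; set y := (eta i)%:MP in h *.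
rewrite mpolyC1; transitivity (x * y * Y i ^+ 3 - (x + x * y) * sigma); last first.
  by rewrite h mul1r [x + 1]addrC.
ring.
Qed.

(** For a cubic operator this is, up to the factor 6, its contraction with the sum of the cubes. *)
Definition eval_sum p : K := \sum_k p @! a k.

Lemma eval_sumD p p' : eval_sum (p + p') = eval_sum p + eval_sum p'.
Proof. by rewrite -big_split; apply: eq_bigr => k _; rewrite mevalD. Qed.

Lemma eval_sumZ c p : eval_sum (c *: p) = c * eval_sum p.
Proof. by rewrite mulr_sumr; apply: eq_bigr => k _; rewrite mevalZ. Qed.

Let eval_sum_cubic i j k : eval_sum (Y i * Y j * Y k) =
  if (i == j) && (j == k) then 1 + tau i ^+ 3 else 1.
Proof.
rewrite /eval_sum big_ord_recr /= !mevalM !Yu !mulr1.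
have [<-|ne_ij] /= := eqVneq i j; last first.
  rewrite big1 ?add0r // => l _; rewrite !mevalM !Yb.
  by have [<-|_] := eqVneq i l; rewrite ?mulr0n ?mul0r // [j == i]eq_sym (negPf ne_ij) mulr0 mul0r.
have [<-|ne_ik] := eqVneq i k.
  rewrite (bigD1 i) //= !mevalM !Yb eqxx mulr1n big1 => [|l ne_li]; first by ring.
  by rewrite !mevalM !Yb eq_sym (negPf ne_li) mulr0.
rewrite big1 ?add0r // => l _; rewrite !mevalM !Yb.
by have [<-|_] := eqVneq i l; rewrite ?mul0r // eq_sym (negPf ne_ik) mulr0.
Qed.

Lemma eval_sum_sigma : eval_sum sigma = 1.
Proof. by rewrite eval_sum_cubic. Qed.

(** On monomials in the [Y i], [eval_sum] takes exactly the multiples of [sigma] found above, so it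
    is the coordinate of a cubic modulo the ideal. *)
Let I_cubic D : D \is 3.-homog -> I (D - eval_sum D *: sigma).
Proof.
pose Q D := I (D - eval_sum D *: sigma).
have Q0 : Q 0.
  rewrite /Q -{2}(scale0r 0) eval_sumZ mul0r scale0r subr0; exact: ideal_gen0.
have QD p p' : Q p -> Q p' -> Q (p + p').
  rewrite /Q eval_sumD scalerDl => h h'; have := ideal_genD h h'.
  by congr I; rewrite opprD addrACA.
move: D; apply: (homogS_ind XY Q0 QD) => i p hp.
move: p hp; apply: (homogS_ind XY) => [|p p' h h'|j p hp].
- by rewrite mul0r.
- by rewrite mulrDl; apply: QD.
move: p hp; apply: (homogS_ind XY) => [|p p' h h'|k p /dhomog0_const ->].
- by rewrite !mul0r.
- by rewrite !mulrDl; apply: QD.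
rewrite mul_mpolyC -!scalerAl /Q eval_sumZ -scalerA -scalerBr.
apply: ideal_genZ; rewrite eval_sum_cubic.
case: ifP => [/andP[/eqP-> /eqP->]|/negbT h]; last by rewrite scale1r; apply: I_mixed.
by have := I_cube i; congr I; congr (_ - _); rewrite exprS expr2 mulrA.
Qed.

Lemma pentad_cubic D : D \is 3.-homog -> eval_sum D = 0 -> ideal_gen E D.
Proof. by move=> /I_cubic h D0; move: h; rewrite D0 scale0r subr0. Qed.

Let I_sigmaY i : I (Y i * sigma).
Proof.
have tri p i1 j1 k1 i2 j2 k2 :
    ~~ ((i1 == j1) && (j1 == k1)) -> ~~ ((i2 == j2) && (j2 == k2)) ->
    I (p * (Y i1 * Y j1 * Y k1) - p * (Y i2 * Y j2 * Y k2)).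
  move=> h1 h2; rewrite -mulrBr; apply: ideal_genM.
  by apply: I_trans (I_mixed h1) _; rewrite -opprB; apply/ideal_genN/I_mixed.
(* The quartic [Y j * Y j * Y k * Y l] can be written as [Y j] or as [Y k] times a mixed cubic. *)
have Yij j k : I (Y j * sigma - Y k * sigma).
  have [->|ne_jk] := eqVneq j k; first by rewrite subrr; apply: ideal_gen0.
  have [l hl] : exists l, l != j by move: (j); elim/ord4P; [exists o1|exists o0..].
  have h1 : ~~ ((k == j) && (j == l)) by rewrite eq_sym (negPf ne_jk).
  have h2 : ~~ ((j == j) && (j == l)) by rewrite eqxx eq_sym hl.
  have h3 : I (Y j * sigma - Y j * (Y k * Y j * Y l)).
    by rewrite -mulrBr -opprB mulrN; apply/ideal_genN/ideal_genM/I_mixed.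
  have h4 : I (Y k * (Y j * Y j * Y l) - Y k * sigma).
    by rewrite -mulrBr; apply/ideal_genM/I_mixed.
  apply: I_trans h3 _; move: h4; congr I; congr (_ - _); ring.
(* Two reductions of [Y o0 ^+ 3 * Y o1] give [(1 + tau o0 ^+ 3) *: (Y o1 * sigma)] and
   [Y o0 * sigma]; the latter is congruent to [Y o1 * sigma], so the difference is a nonzero
   multiple of it. *)
have h : I (tau o0 ^+ 3 *: (Y o1 * sigma)).
  have h1 : I (Y o1 * Y o0 ^+ 3 - (1 + tau o0 ^+ 3) *: (Y o1 * sigma)).
    by rewrite scalerAr -mulrBr; apply/ideal_genM/I_cube.
  have h2 : I (Y o0 * (Y o0 * Y o0 * Y o1) - Y o0 * sigma).
    by rewrite -mulrBr; apply/ideal_genM/I_mixed.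
  have := ideal_genB (I_trans h2 (Yij o0 o1)) h1; congr I.
  rewrite scalerDl scale1r; ring.
have h1 : I (Y o1 * sigma).
  have := ideal_genZ (tau o0 ^- 3) h; rewrite scalerA mulVf ?scale1r //.
  by rewrite expf_neq0.
by have := ideal_genD (Yij i o1) h1; rewrite subrK.
Qed.

Lemma pentad_higher d D : D \is (d + 4).-homog -> ideal_gen E D.
Proof.
elim: d D => [|d IH]; apply: (homogS_ind XY);
  do ?[exact: ideal_gen0 | exact: ideal_genD].
  move=> i p /I_cubic hp; rewrite mulrC -(subrK (eval_sum p *: sigma) p) mulrDr.
  apply: ideal_genD; first exact: ideal_genM.
  by rewrite -scalerAr; apply: ideal_genZ; apply: I_sigmaY.
by move=> i p /IH hp; rewrite mulrC; apply: ideal_genM.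
Qed.

(* The linear syzygies among the E m for m != 0 involve all five of them, and
   none involves E 0. *)
Lemma pentad_syzygy_relation (gam : 'I_6 -> K) :
  (forall n : 'I_6 -> {mpoly K[4]}, (forall m, n m \is 1.-homog) ->
     \sum_m n m * E m = 0 -> \sum_m gam m *: n m = 0) ->
  forall m, m != e0 -> gam m = 0.
Proof.
move=> h.
have rel (w : 6.-tuple {mpoly K[4]}) : all [pred p | p \is 1.-homog] w ->
    \sum_(m < 6) w`_m * E m = 0 -> \sum_(m < 6) gam m *: w`_m = 0.
  move=> hw hs; apply: (h (fun m : 'I_6 => w`_m)) => // m.
  by apply: (allP hw); rewrite mem_nth ?size_tuple.
have hN i : - Y i \is 1.-homog by rewrite rpredN Yh.
have hom0 : (0 : {mpoly K[4]}) \is 1.-homog by rewrite rpred0.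
(* Comparing coefficients in these four syzygies kills [gam e1], ..., [gam e4]; the first also
   equates [gam e4] and [gam e5]. *)
have r1 := rel [tuple 0; Y o3; 0; 0; Y o0; - Y o0].
have r2 := rel [tuple 0; 0; Y o2; Y o0; 0; - Y o0].
have r3 := rel [tuple 0; 0; Y o1; Y o3; 0; - Y o1].
have r4 := rel [tuple 0; Y o1; 0; 0; Y o2; - Y o1].
have {}r1 : gam e1 *: Y o3 + (gam e4 - gam e5) *: Y o0 = 0.
  rewrite -[RHS]r1; first by rewrite sum_ord6 /= !scaler0 scalerN scalerBl; ring.
    by rewrite /= hom0 !Yh !hN.
  by rewrite sum_ord6 /E /= /s; ring.
have {}r2 : gam e2 *: Y o2 + (gam e3 - gam e5) *: Y o0 = 0.
  rewrite -[RHS]r2; first by rewrite sum_ord6 /= !scaler0 scalerN scalerBl; ring.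
    by rewrite /= hom0 !Yh !hN.
  by rewrite sum_ord6 /E /= /s; ring.
have {}r3 : gam e3 *: Y o3 + (gam e2 - gam e5) *: Y o1 = 0.
  rewrite -[RHS]r3; first by rewrite sum_ord6 /= !scaler0 scalerN scalerBl; ring.
    by rewrite /= hom0 !Yh !hN.
  by rewrite sum_ord6 /E /= /s; ring.
have {}r4 : gam e4 *: Y o2 + (gam e1 - gam e5) *: Y o1 = 0.
  rewrite -[RHS]r4; first by rewrite sum_ord6 /= !scaler0 scalerN scalerBl; ring.
    by rewrite /= hom0 !Yh !hN.
  by rewrite sum_ord6 /E /= /s; ring.
have Y_free x y i j : i != j -> x *: Y i + y *: Y j = 0 -> x = 0 /\ y = 0.
  move=> ne_ij e0; split.
    have := congr1 (fun p => p @! a (wd i)) e0; rewrite mevalD !mevalZ !Yb meval0.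
    rewrite eqxx [j == i]eq_sym (negPf ne_ij) mulr0 addr0 => /eqP.
    by rewrite mulf_eq0 mulr1n (negPf (tau0 i)) orbF => /eqP.
  have := congr1 (fun p => p @! a (wd j)) e0; rewrite mevalD !mevalZ !Yb meval0.
  rewrite eqxx (negPf ne_ij) mulr0 add0r => /eqP.
  by rewrite mulf_eq0 mulr1n (negPf (tau0 j)) orbF => /eqP.
have [g1 /eqP] := Y_free _ _ o3 o0 isT r1; rewrite subr_eq0 => /eqP g45.
have [g2 _] := Y_free _ _ o2 o0 isT r2.
have [g3 _] := Y_free _ _ o3 o1 isT r3.
have [g4 _] := Y_free _ _ o2 o1 isT r4.
by elim/ord6P => // _; rewrite -g45.
Qed.

(** In coordinates, all products of two distinct coordinates of [z] agree. If two coordinates are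
    nonzero, so is this product, and cancelling makes all coordinates equal; otherwise [z] is a
    multiple of a base point. *)
Lemma pentad_variety (z : 'rV[K]_4) : (forall m, m != e0 -> E m @! z = 0) ->
  z != 0 -> exists i t, z = t *: a i.
Proof.
move=> h z0; pose v i := Y i @! z.
have vv i j : i != j -> v i * v j = v o0 * v o1.
  move=> ne_ij; have [c [c0 e]] := J2_pair ne_ij.
  have := congr1 (fun p => p @! z) e; rewrite mevalB !mevalM.
  rewrite raddf_sum big1 => [/eqP|m _]; first by rewrite subr_eq0 => /eqP.
  rewrite /= mevalZ; have [->|/h->] := eqVneq m e0; last by rewrite mulr0.
  by rewrite c0 mul0r.
have [/existsP[i hi]|/existsPn v0] := boolP [exists i, v i != 0]; last first.
  case/eqP: z0; apply: meval_Y_inj => i; rewrite -[LHS]/(v i) (eqP (negPn (v0 i))).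
  by rewrite -(scale0r 0) (meval_homogZ _ _ (Yh i)) expr1 mul0r.
have [/existsP[j /andP[ne_ji hj]]|/existsPn vj] :=
    boolP [exists j, (j != i) && (v j != 0)].
  have v01 : v o0 * v o1 != 0 by rewrite -(vv j i) // mulf_neq0.
  have := v01; rewrite mulf_eq0 negb_or => /andP[n0 n1].
  have e02 : v o2 = v o1 by apply: (mulfI n0); exact: vv.
  have e03 : v o3 = v o1 by apply: (mulfI n0); exact: vv.
  have e20 : v o0 = v o1.
    by apply: (mulfI n1); rewrite mulrC -(vv o1 o2) // e02.
  exists ord_max, (v o1); apply: meval_Y_inj => k.
  rewrite (meval_homogZ _ _ (Yh k)) Yu expr1 mulr1.
  by elim/ord4P: k.
exists (wd i), (v i / tau i); apply: meval_Y_inj => k.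
rewrite (meval_homogZ _ _ (Yh k)) expr1 Yb.
have [->|ne_ki] := eqVneq k i; first by rewrite mulr1n divfK.
by have := vj k; rewrite ne_ki /= negbK mulr0 => /eqP.
Qed.

Lemma pentad_quadrics_vanish m i : m != e0 -> E m @! a i = 0.
Proof.
move=> m0; have [j ->|->] := unliftP ord_max i; last by rewrite E_unit.
rewrite lift_ord_max ?E_base //.
Qed.

Lemma pentad_quadric0_neq0 i : E e0 @! a i != 0.
Proof.
have [j ->|->] := unliftP ord_max i; last by rewrite E0_unit oner_eq0.
rewrite lift_ord_max ?E0_base ?oppr_eq0 ?invr_eq0 //.
Qed.

(** [Y k ^+ 2 * (Y k - Y l)] isolates a base point and a product of three distinct coordinates
    isolates the unit point. In the uniqueness proof such cubics isolate the scalars over one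
    point. *)
Lemma pentad_separating i : exists2 D, D \is 3.-homog &
  forall j, (D @! a j != 0) = (j == i).
Proof.
have h3 l m n : Y l * Y m * Y n \is 3.-homog.
  by rewrite -[3%N]/(2 + 1)%N dhomogM // pentad_YM_homog.
have [k ->|->] := unliftP ord_max i.
  have [l hl] : exists l : 'I_4, l != k by move: (k); elim/ord4P; [exists o1|exists o0..].
  exists (Y k * Y k * Y k - Y k * Y k * Y l); first by rewrite rpredB ?h3.
  move=> j; have [m ->|->] := unliftP ord_max j; rewrite mevalB !mevalM.
    rewrite (inj_eq (@lift_inj _ _)) !lift_ord_max !Yb [m == k]eq_sym.
    have [<-|ne] := eqVneq k m; last by rewrite !mul0r subrr eqxx.
    by rewrite (negPf hl) !mulr0 subr0 mulr1n !mulf_neq0 ?tau0.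
  by rewrite !Yu subrr eqxx (negPf (neq_lift _ _)).
exists (Y o0 * Y o1 * Y o2) => // j.
have [m ->|->] := unliftP ord_max j; rewrite !mevalM.
  rewrite [RHS]eq_sym (negPf (neq_lift _ _)) !lift_ord_max !Yb; apply/negbTE; rewrite negbK.
  by elim/ord4P: m; rewrite /= ?mulr0n ?mulr0 ?mul0r eqxx.
by rewrite !Yu !mulr1 oner_eq0 eqxx.
Qed.

End Pentad.

(** * Sums of five cubes *)

Section Cubes.
Variables (K : numFieldType) (a : 'I_5 -> 'rV[K]_4).
Implicit Types D : {mpoly K[4]}.

Definition cubes : {mpoly K[4]} := \sum_i linear_form (a i) ^+ 3.

Lemma diffop_cubes d D : D \is d.-homog ->
  diffop D cubes =
  (3 ^_ d)%:R *: \sum_i (D @! a i) *: linear_form (a i) ^+ (3 - d).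
Proof.
move=> hD; rewrite diffop_sumr scaler_sumr; apply: eq_bigr => i _.
by rewrite (diffop_linear_form_exp _ _ hD) scalerA.
Qed.

Lemma apolar_cubes_quadric D : D \is 2.-homog ->
  apolar_ideal cubes D <-> polar_sum a D = 0.
Proof.
move=> hD; rewrite /apolar_ideal (diffop_cubes hD).
have -> : \sum_i (D @! a i) *: linear_form (a i) ^+ (3 - 2)
    = linear_form (polar_sum a D).
  by rewrite linear_form_sum; apply: eq_bigr => i _; rewrite linear_formZ.
split=> [/eqP|->]; last by rewrite linear_form0 scaler0.
by rewrite scaler_eq0 pnatr_eq0 => /eqP/linear_form_eq0.
Qed.

Lemma diffop_cubes_cubic D : D \is 3.-homog ->
  diffop D cubes = (6%:R * eval_sum a D)%:MP.
Proof.
move=> hD; rewrite (diffop_cubes hD) mpolyCM mul_mpolyC; congr (_ *: _).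
rewrite raddf_sum; apply: eq_bigr => i _.
by rewrite expr0 /= -alg_mpolyC.
Qed.

Lemma apolar_cubes_cubic D : D \is 3.-homog ->
  apolar_ideal cubes D <-> eval_sum a D = 0.
Proof.
move=> hD; rewrite /apolar_ideal (diffop_cubes_cubic hD).
split=> [/eqP|->]; last by rewrite mulr0.
by rewrite mpolyC_eq0 mulf_eq0 pnatr_eq0 => /eqP.
Qed.

Lemma apolar_cubes_mul d e D D' : (d + e = 3)%N ->
  D \is d.-homog -> D' \is e.-homog -> apolar_ideal cubes D' ->
  eval_sum a (D * D') = 0.
Proof.
move=> de hD hD' h; apply/apolar_cubes_cubic.
  by have := dhomogM hD hD'; rewrite de.
by rewrite /apolar_ideal diffopM h diffop0r.
Qed.

End Cubes.

(** * Apolarity to the five cubes and uniqueness of the decomposition *)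

Section PentadCubes.
Variables (K : numFieldType) (a : 'I_5 -> 'rV[K]_4).
Variables (Y : 'I_4 -> {mpoly K[4]}) (tau : 'I_4 -> K).
Hypothesis Ya : pentad a Y tau.
Implicit Types D : {mpoly K[4]}.

Local Notation E := (pentad_quadrics Y tau).

Lemma pentad_linear_eq0 D : D \is 1.-homog ->
  (forall i : 'I_4, D @! a (wd i) = 0) -> D = 0.
Proof.
move=> hD D0.
have [c e] : exists c : 'I_4 -> K, D = \sum_i c i *: Y i.
  move: D hD {D0}; apply: (homogS_ind (pentad_span Ya)).
  - by exists (fun=> 0); rewrite big1 // => i _; rewrite scale0r.
  - move=> p q [c ->] [c' ->]; exists (fun i => c i + c' i).
    by rewrite -big_split; apply: eq_bigr => i _ /=; rewrite scalerDl.
  move=> i p /dhomog0_const ->; exists (fun j => p@_0%MM *+ (j == i)).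
  rewrite (bigD1 i) //= eqxx mulr1n mul_mpolyC big1 ?addr0 // => j /negPf ->.
  by rewrite mulr0n scale0r.
rewrite e big1 // => i _; suff -> : c i = 0 by rewrite scale0r.
have := D0 i; rewrite e raddf_sum (bigD1 i) //= mevalZ (pentad_base Ya) eqxx.
rewrite big1 => [|j /negPf ne]; last by rewrite mevalZ (pentad_base Ya) ne mulr0.
by rewrite addr0 => /eqP; rewrite mulf_eq0 (negPf (pentad_tau Ya i)) orbF => /eqP.
Qed.

(** Multiplying [D] by a quadric that is nonzero at [a (wd i)] only gives an apolar cubic whose
    [eval_sum] is a nonzero multiple of [D @! a (wd i)]. *)
Lemma apolar_pentad_linear D : D \is 1.-homog ->
  apolar_ideal (cubes a) D -> D = 0.
Proof.
move=> hD h; apply: pentad_linear_eq0 => // i.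
have [Q hQ eQ] : exists2 Q, Q \is 2.-homog &
    forall j, (Q @! a j != 0) = (j == wd i).
  have [j ne_ji] : exists j : 'I_4, j != i.
    by move: (i); elim/ord4P; [exists o1|exists o0..].
  exists (Y i * Y i - Y i * Y j).
    by rewrite rpredB ?(pentad_YM_homog Ya).
  move=> k; rewrite mevalB !mevalM.
  have [l ->|->] := unliftP ord_max k.
    rewrite -lift_ord_max (inj_eq (@lift_inj _ _)) !lift_ord_max !(pentad_base Ya) [l == i]eq_sym.
    have [<-|ne] := eqVneq i l; last by rewrite !mul0r subrr eqxx.
    by rewrite (negPf ne_ji) !mulr0 subr0 mulr1n !mulf_neq0 ?(pentad_tau Ya).
  by rewrite !(pentad_unit Ya) subrr eqxx -lift_ord_max (negPf (neq_lift _ _)).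
have := apolar_cubes_mul (erefl : (2 + 1 = 3)%N) hQ hD h.
rewrite /eval_sum (bigD1 (wd i)) //= mevalM big1 => [|j ne].
  have Qi : Q @! a (wd i) != 0 by rewrite eQ.
  by rewrite addr0 => /eqP; rewrite mulf_eq0 (negPf Qi) => /eqP.
by rewrite mevalM; move: (eQ j); rewrite (negPf ne) => /negbFE/eqP->; rewrite mul0r.
Qed.

Lemma eval_sum1_exists : exists2 S, S \is 3.-homog & eval_sum a S = 1.
Proof.
exists (Y o0 * Y o1 * Y o2).
  by rewrite -[3%N]/(2 + 1)%N dhomogM ?(pentad_YM_homog Ya) ?(pentad_homog Ya).
exact: (eval_sum_sigma Ya).
Qed.

Lemma apolar_pentad_const D : D \is 0.-homog ->
  apolar_ideal (cubes a) D -> D = 0.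
Proof.
move=> hD h; have [S hS S1] := eval_sum1_exists.
have := apolar_cubes_mul (erefl : (3 + 0 = 3)%N) hS hD h.
rewrite (dhomog0_const hD) mulrC mul_mpolyC eval_sumZ S1 mulr1.
by move=> ->; rewrite mpolyC0.
Qed.

Lemma pentad_quadrics_no_zero (z : 'rV[K]_4) : (forall m, E m @! z = 0) -> z = 0.
Proof.
move=> h; apply/eqP; apply: contraT => z0.
have [i [t e]] := pentad_variety Ya (fun m _ => h m) z0.
have := h e0; rewrite e.
rewrite (meval_homogZ _ _ (pentad_quadrics_homog Ya _)) => /eqP.
rewrite mulf_eq0 (negPf (pentad_quadric0_neq0 Ya i)) orbF expf_eq0 => /= /eqP t0.
by rewrite e t0 scale0r eqxx in z0.
Qed.

(** Nothing is assumed on the position of the [b k]. General position is itself derived, from the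
    fact that both families have the same apolar operators. *)
Lemma pentad_unique (b : 'I_5 -> 'rV[K]_4) : cubes b = cubes a ->
  exists s : 'S_5, forall i, exists w : K, w ^+ 3 = 1 /\ b i = w *: a (s i).
Proof.
move=> eba.
have Eb m : polar_sum b (E m) = 0.
  apply/apolar_cubes_quadric; first exact: (pentad_quadrics_homog Ya).
  rewrite eba; apply/apolar_cubes_quadric; first exact: (pentad_quadrics_homog Ya).
  exact: polar_sum_pentad_quadrics.
have b_span D : D \is 1.-homog -> (forall k, D @! b k = 0) -> D = 0.
  move=> hD D0; apply: apolar_pentad_linear => //.
  rewrite -eba /apolar_ideal (diffop_cubes _ hD) big1 ?scaler0 // => i _.
  by rewrite D0 scale0r.
pose B := \matrix_(k < 5) b k.
have rB : \rank B = 4.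
  rewrite -mxrank_tr; apply/eqP; rewrite -[_ == _]/(row_free _) -kermx_eq0.
  apply/rowV0P => v /sub_kermxP vB; apply: linear_form_eq0.
  apply: b_span => [|k]; first exact: linear_form_homog.
  rewrite meval_linear_form; have := congr1 (fun M : 'rV_5 => M 0 k) vB.
  by rewrite !mxE => e; rewrite -[RHS]e; apply: eq_bigr => i _; rewrite !mxE.
pose r := nz_row (kermx B).
have rk : \rank (kermx B) = 1%N by rewrite mxrank_ker rB.
have r0 : r != 0 by rewrite nz_row_eq0 -mxrank_eq0 rk.
have kr : (kermx B <= r)%MS.
  have := mxrank_leqif_sup (nz_row_sub (kermx B)); rewrite rank_rV r0 rk.
  by case=> _ <-.
have ker_r (x : 'rV_5) : x *m B = 0 -> exists c, x = c *: r.
  move=> xB; apply/sub_rVP; apply: submx_trans kr.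
  by apply/sub_kermxP.
(* A vanishing polar sum says that the values of [E m] at the [b k] form a linear relation, hence a
   multiple of [r]. A zero entry of [r] would thus make [b k] a common zero of all six quadrics. *)
have /fin_all_exists[eps heps] : forall m, exists c, forall k, E m @! b k = c * r 0 k.
  move=> m; have [|c hc] := ker_r (\row_k (E m @! b k)).
    rewrite -[RHS](Eb m); apply/rowP => j; rewrite !mxE summxE.
    by apply: eq_bigr => k _; rewrite !mxE.
  by exists c => k; have := congr1 (fun M : 'rV_5 => M 0 k) hc; rewrite !mxE.
have r_or k : r 0 k = 0 -> b k = 0.
  by move=> rk0; apply: pentad_quadrics_no_zero => m; rewrite heps rk0 mulr0.
(* If [b k] were zero, the k-th unit vector would be proportional to [r]; the other entries of [r],
   and with them all other points, would vanish. *)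
have b0 k : b k != 0.
  apply/eqP => bk; have [|c hc] := ker_r (delta_mx 0 k).
    by rewrite -rowE; apply/rowP => j; rewrite !mxE bk mxE.
  have c0 : c != 0.
    apply/eqP => c0; have := congr1 (fun M : 'rV_5 => M 0 k) hc.
    by rewrite c0 !mxE !eqxx mul0r => /eqP; rewrite oner_eq0.
  have bj j : b j = 0.
    have [->//|ne] := eqVneq j k; apply: r_or; apply: (mulfI c0).
    have := congr1 (fun M : 'rV_5 => M 0 j) hc.
    by rewrite !mxE (negPf ne) andbF mulr0 => <-.
  have B0 : B = 0 by apply/matrixP => i j; rewrite !mxE bj mxE.
  by move: rB; rewrite B0 mxrank0.
have rk0 k : r 0 k != 0 by apply/eqP => /r_or/eqP; apply/negP.
(* Evaluating a linear syzygy [n] of the [E m] at [b k] and cancelling [r 0 k] shows that the linear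
   form [\sum_m eps m *: n m] vanishes at all [b k], hence is zero. *)
have eps0 : forall m, m != e0 -> eps m = 0.
  apply: (pentad_syzygy_relation Ya) => n hn syz.
  apply: b_span => [|k]; first by apply: rpred_sum => m _; rewrite rpredZ ?hn.
  apply: (mulIf (rk0 k)); rewrite mul0r.
  have := congr1 (fun p => p @! b k) syz; rewrite meval0 => e; rewrite -[RHS]e.
  rewrite !raddf_sum mulr_suml; apply: eq_bigr => m _ /=.
  by rewrite mevalZ mevalM heps mulrAC mulrA [_ * eps m]mulrC mulrAC.
have bE k : exists i t, b k = t *: a i.
  by apply: (pentad_variety Ya) => // m m0; rewrite heps eps0 // mul0r.
have /fin_all_exists[s hs] := bE; have /fin_all_exists[t hst] := hs.
(* The cubic separating [a i] sees only the [b k] lying over [a i], with weights [t k ^+ 3]. So no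
   fibre of [s] is empty, [s] is a permutation, and each weight is 1. *)
have sumt i : \sum_(k | s k == i) t k ^+ 3 = 1.
  have [D hD eD] := pentad_separating Ya i.
  have e : eval_sum b D = eval_sum a D.
    have := diffop_cubes_cubic b hD; rewrite eba (diffop_cubes_cubic a hD).
    move=> /(congr1 (mcoeff 0%MM)); rewrite !mpolyCK => h.
    by apply/esym; apply: mulfI h; rewrite pnatr_eq0.
  have Di : D @! a i != 0 by rewrite eD.
  apply: (mulIf Di); rewrite mul1r.
  move: e; rewrite /eval_sum [RHS](bigD1 i) //= [in RHS]big1 => [|j ne]; last first.
    by move: (eD j); rewrite (negPf ne) => /negbFE/eqP.
  rewrite addr0 => e; rewrite -[RHS]e mulr_suml big_mkcond; apply: eq_bigr => k _.
  rewrite hst (meval_homogZ _ _ hD); have [->|ne] := eqVneq (s k) i; first by [].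
  by move: (eD (s k)); rewrite (negPf ne) => /negbFE/eqP->; rewrite mulr0.
have s_surj i : exists k, s k = i.
  have [/existsP[k /eqP <-]|/existsPn h] := boolP [exists k, s k == i]; first by exists k.
  have := sumt i; rewrite big_pred0 => [/esym/eqP|k]; first by rewrite oner_eq0.
  exact/negbTE.
have s_inj : injective s.
  have /fin_all_exists[g gK] := s_surj; have gI := can_inj gK.
  move=> x y; rewrite -(f_invF gI x) -(f_invF gI y) !gK => -> //.
exists (perm s_inj) => i; exists (t i); rewrite permE; split=> //.
rewrite -(sumt (s i)) (bigD1 i) //= big1 ?addr0 // => j /andP[/eqP/s_inj->].
by rewrite eqxx.
Qed.

End PentadCubes.

(** The relation writes the last point as the sum of the [t i *: a (wd i)], so the first four points
    already span. The [Y i] are the coordinates in this basis, whence [tau i = (t i)^-1]. *)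
Lemma pentad_exists (K : fieldType) (a : 'I_5 -> 'rV[K]_4) (r : 'I_5 -> K) :
  (forall i, r i != 0) -> \sum_i r i *: a i = 0 ->
  (forall v : 'rV_4, (forall i, \sum_j v 0 j * a i 0 j = 0) -> v = 0) ->
  exists Y tau, pentad a Y tau.
Proof.
move=> r0 rel full.
pose t (i : 'I_4) := - (r (wd i) / r ord_max).
have t0 i : t i != 0 by rewrite oppr_eq0 mulf_neq0 ?invr_eq0.
have a4 : a ord_max = \sum_i t i *: a (wd i).
  move: rel; rewrite big_ord_recr /= => /eqP; rewrite addrC addr_eq0 => /eqP e.
  apply: (scalerI (r0 ord_max)); rewrite e scaler_sumr -sumrN.
  by apply: eq_bigr => i _; rewrite scalerA mulrN mulrCA mulfV // mulr1 scaleNr.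
pose T := \matrix_(i < 4) (t i *: a (wd i)).
have Tu : T \in unitmx.
  rewrite -unitmx_tr -row_free_unit -kermx_eq0; apply/rowV0P => v /sub_kermxP vT.
  have va (i : 'I_4) : \sum_j v 0 j * a (wd i) 0 j = 0.
    apply: (mulfI (t0 i)); have := congr1 (fun M : 'rV_4 => M 0 i) vT.
    rewrite !mxE mulr0 mulr_sumr => e; rewrite -[RHS]e; apply: eq_bigr => j _.
    by rewrite !mxE mulrCA.
  apply: full => i; have [j ->|->] := unliftP ord_max i.
    by rewrite -[RHS](va j); apply: eq_bigr => k _; rewrite lift_ord_max.
  rewrite a4; under eq_bigr => j _ do rewrite summxE mulr_sumr.
  rewrite exchange_big big1 //= => j _.
  under eq_bigr => k _ do rewrite mxE mulrCA.
  by rewrite -mulr_sumr va mulr0.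
pose Y i := linear_form (\row_k invmx T k i).
have YT i (z : 'rV_4) : Y i @! z = (z *m invmx T) 0 i.
  rewrite meval_linear_form mxE; apply: eq_bigr => j _.
  by rewrite mxE mulrC.
exists Y, (fun i => (t i)^-1); split.
- by move=> i; apply: linear_form_homog.
- move=> k; exists (fun i => T i k).
  transitivity (linear_form (\row_l (invmx T *m T) l k)).
    rewrite mulVmx // /linear_form (bigD1 k) //= !mxE eqxx scale1r big1 ?addr0 //.
    by move=> i ne; rewrite !mxE (negPf ne) scale0r.
  transitivity (\sum_i linear_form (T i k *: \row_l invmx T l i)); last first.
    by apply: eq_bigr => i _; rewrite linear_formZ.
  rewrite -linear_form_sum; congr linear_form; apply/rowP => l.
  rewrite summxE !mxE; apply: eq_bigr => i _.
  by rewrite !mxE mulrC.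
- by move=> i; rewrite invr_eq0.
- move=> i j; rewrite YT.
  have -> : a (wd j) = (t j)^-1 *: (delta_mx 0 j *m T).
    by rewrite -rowE rowK scalerA mulVf // scale1r.
  by rewrite -scalemxAl mulmxK // !mxE eqxx /= eq_sym; case: eqVneq => [->|_];
    rewrite ?mulr1 ?mulr0.
- move=> i; rewrite YT a4.
  have -> : \sum_j t j *: a (wd j) = const_mx 1 *m T.
    apply/rowP => k; rewrite summxE !mxE; apply: eq_bigr => j _.
    by rewrite !mxE mul1r.
  by rewrite mulmxK // mxE.
Qed.

(** * Descent to the real numbers and linear syzygies *)

(* For K = R[i], [re] is the real part, v = i and w = -i. *)
Record quadratic_extension (R : fieldType) (K : numFieldType)
    (iota : {rmorphism R -> K}) (re : {additive K -> R}) (v w : K) : Prop :=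
  QuadraticExtension {
    re_iota : forall y, re (iota y) = y;
    re_mul_iota : forall x y, re (x * iota y) = re x * y;
    re_split : forall x, x = iota (re x) + v * iota (re (w * x)) }.

Section Extension.
Variables (R : fieldType) (K : numFieldType) (iota : {rmorphism R -> K}).
Variables (re : {additive K -> R}) (v w : K) (n : nat).
Hypothesis ext : quadratic_extension iota re v w.
Implicit Types (p q : {mpoly R[n]}) (u : {mpoly K[n]}).

Local Notation emb := (map_mpoly iota).
Local Notation poly_re := (map_mpoly re).

Lemma map_mpoly_fun_inj : injective (emb : {mpoly R[n]} -> {mpoly K[n]}).
Proof.
move=> p q e; apply/mpolyP => m; apply: (fmorph_inj iota).
by rewrite -!mcoeff_map_mpoly e.
Qed.

Lemma map_mpolyK p : poly_re (emb p) = p.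
Proof. by apply/mpolyP => m; rewrite !mcoeff_map_mpoly (re_iota ext). Qed.

Lemma map_mpoly_reM u p : poly_re (u * emb p) = poly_re u * p.
Proof.
apply/mpolyP => m; rewrite mcoeff_map_mpoly !mcoeffM raddf_sum.
by apply: eq_bigr => k _ /=; rewrite !mcoeff_map_mpoly (re_mul_iota ext).
Qed.

Lemma map_mpoly_reZ c p : poly_re (c *: emb p) = re c *: p.
Proof.
apply/mpolyP => m; rewrite mcoeff_map_mpoly !mcoeffZ mcoeff_map_mpoly.
exact: (re_mul_iota ext).
Qed.

Lemma map_mpoly_re_split u : u = emb (poly_re u) + v *: emb (poly_re (w *: u)).
Proof.
apply/mpolyP => m; rewrite mcoeffD mcoeffZ !mcoeff_map_mpoly mcoeffZ.
exact: (re_split ext).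
Qed.

Lemma map_mpoly_homog (S T : nzRingType) (h : {additive S -> T}) d (p : {mpoly S[n]}) :
  p \is d.-homog -> map_mpoly h p \is d.-homog.
Proof.
move=> /dhomog_mdeg hp; apply/dhomogP => m; rewrite mcoeff_msupp.
rewrite mcoeff_map_mpoly => h0; apply: hp; rewrite mcoeff_msupp.
by apply: contraNneq h0 => ->; rewrite raddf0.
Qed.

Lemma map_mpoly_mderivm m p : emb (mderivm m p) = mderivm m (emb p).
Proof.
apply/mpolyP => k; rewrite mcoeff_map_mpoly !mcoeff_mderivm mcoeff_map_mpoly.
exact: raddfMn.
Qed.

Lemma map_mpoly_re_diffop u p : poly_re (diffop u (emb p)) = diffop (poly_re u) p.
Proof.
have [k hk] : exists k, (msize u <= k)%N by exists (msize u).
have [l hl] : exists l, (msize (poly_re u) <= l)%N by exists (msize (poly_re u)).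
have hu : (msize u <= k + l)%N by rewrite (leq_trans hk) ?leq_addr.
have hv : (msize (poly_re u) <= k + l)%N by rewrite (leq_trans hl) ?leq_addl.
rewrite (diffopwE _ hu) (diffopwE _ hv) raddf_sum; apply: eq_bigr => m _ /=.
by rewrite -map_mpoly_mderivm map_mpoly_reZ mcoeff_map_mpoly.
Qed.

Lemma map_mpoly_diffop p q : emb (diffop p q) = diffop (emb p) (emb q).
Proof.
have [k hk] : exists k, (msize p <= k)%N by exists (msize p).
have [l hl] : exists l, (msize (emb p) <= l)%N by exists (msize (emb p)).
have hu : (msize p <= k + l)%N by rewrite (leq_trans hk) ?leq_addr.
have hv : (msize (emb p) <= k + l)%N by rewrite (leq_trans hl) ?leq_addl.
rewrite (diffopwE _ hu) (diffopwE _ hv) raddf_sum; apply: eq_bigr => m _ /=.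
by rewrite map_mpolyZ map_mpoly_mderivm mcoeff_map_mpoly.
Qed.

Lemma apolar_map_mpoly p q : apolar_ideal p q <-> apolar_ideal (emb p) (emb q).
Proof.
rewrite /apolar_ideal -map_mpoly_diffop; split=> [->|]; first exact: raddf0.
by move=> e; apply: map_mpoly_fun_inj; rewrite e raddf0.
Qed.

Lemma apolar_re p u : apolar_ideal (emb p) u -> apolar_ideal p (poly_re u).
Proof. by rewrite /apolar_ideal -map_mpoly_re_diffop => ->; apply: raddf0. Qed.

Lemma apolarZ (S : comNzRingType) (f D : {mpoly S[n]}) c :
  apolar_ideal f D -> apolar_ideal f (c *: D).
Proof. by rewrite /apolar_ideal diffopZl => ->; rewrite scaler0. Qed.

(** Going down, the real parts of the coefficients serve, since [re] is linear over the small
    field. *)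
Lemma ideal_gen_map_mpoly k (g : 'I_k -> {mpoly R[n]}) p :
  ideal_gen g p <-> ideal_gen (fun j => emb (g j)) (emb p).
Proof.
split=> [[h ->]|[h e]].
  exists (fun j => emb (h j)); rewrite raddf_sum.
  by apply: eq_bigr => j _; rewrite /= rmorphM.
exists (fun j => poly_re (h j)); rewrite -[LHS]map_mpolyK e raddf_sum.
by apply: eq_bigr => j _; rewrite /= map_mpoly_reM.
Qed.

End Extension.

(* The space of linear syzygies, as the kernel of
   (6 linear forms) -> (cubics), (s j) |-> sum_j s j * g j. *)
Section LinearSyzygies.
Variables (R : fieldType) (f : {mpoly R[4]}) (g : 'I_6 -> {mpoly R[4]}).
Hypothesis f_cubic : f \is 3.-homog.
Hypothesis g_gen : quadric_generators (apolar_ideal f) g.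
Hypothesis f_nz : exists2 D, D \is 3.-homog & diffop D f <> 0.

Definition syz_forms (v : 'M[R]_(6, 4)) (j : 'I_6) : {mpoly R[4]} :=
  linear_form (row j v).

Lemma syz_forms_linear : forall j, linear (syz_forms^~ j).
Proof. by move=> j c u v; rewrite /syz_forms linearP linear_formD linear_formZ. Qed.

Lemma syz_map_homog v : \sum_j syz_forms v j * g j \is 3.-homog.
Proof.
apply: rpred_sum => j _; rewrite -[3%N]/(1 + 2)%N dhomogM ?linear_form_homog //.
by have [] := g_gen.
Qed.

Definition syz_map v : dhomog 4 R 3 := DHomog (syz_map_homog v).

Lemma syz_map_is_linear : linear syz_map.
Proof.
move=> c u v; apply: val_inj => /=; rewrite scaler_sumr -big_split.
by apply: eq_bigr => j _ /=; rewrite syz_forms_linear mulrDl scalerAl.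
Qed.
HB.instance Definition _ := GRing.isLinear.Build R _ _ _ syz_map syz_map_is_linear.

Definition apolar_value (D : dhomog 4 R 3) : R^o := (diffop (val D) f)@_0%MM.

Lemma apolar_value_is_linear : linear apolar_value.
Proof.
by move=> c u v; rewrite /apolar_value /= diffopDl diffopZl mcoeffD mcoeffZ.
Qed.
HB.instance Definition _ := GRing.isLinear.Build R _ _ _ apolar_value apolar_value_is_linear.

Lemma apolar_value_eq0 D : apolar_value D = 0 <-> apolar_ideal f (val D).
Proof.
rewrite /apolar_ideal /apolar_value; split=> [|->]; last by rewrite mcoeff0.
have [h _] := diffop_homog (dhomog_is_dhomog D) f_cubic.
by rewrite [in X in _ -> X](dhomog0_const h) => ->; rewrite mpolyC0.
Qed.

Lemma dim_linear_syzygies : \dim (lker (linfun syz_map)) = 5.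
Proof.
have dim_cubics : \dim {: dhomog 4 R 3} = 20 by rewrite dimvf.
(* A cubic in the ideal is a combination of the quadrics with linear coefficients, so the image is
   the whole cubic part of the apolar ideal, the kernel of a single functional. *)
have im : (limg (linfun syz_map) = lker (linfun apolar_value))%VS.
  apply/vspaceP => D; rewrite memv_ker lfunE /=; apply/memv_imgP/eqP.
    move=> [v _ ->]; rewrite lfunE; apply/apolar_value_eq0 => /=.
    by apply/(proj2 g_gen); exists (syz_forms v).
  move=> /apolar_value_eq0/(proj2 g_gen) hD.
  have [h hh e] := ideal_gen_homog (d := 1) (proj1 g_gen) (dhomog_is_dhomog D) hD.
  exists (\matrix_(j, i) (h j)@_U_(i)); first exact: memvf.
  rewrite lfunE; apply: val_inj; rewrite /= e; apply: eq_bigr => j _.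
  rewrite {1}(dhomog1_linear_form (hh j)); congr (linear_form _ * _).
  by apply/rowP => i; rewrite !mxE.
have d1 := limg_ker_dim (linfun syz_map) fullv.
have d2 := limg_ker_dim (linfun apolar_value) fullv.
rewrite !capfv in d1 d2; rewrite im in d1.
have d3 : \dim (limg (linfun apolar_value)) = 1%N.
  apply/eqP; rewrite eqn_leq; apply/andP; split.
    by rewrite (leq_trans (dimvS (subvf _))) // dimvf.
  rewrite lt0n dimv_eq0; apply/eqP => h0.
  have [D hD] := f_nz; apply.
  suff : apolar_value (DHomog hD) = 0 by move/apolar_value_eq0.
  by apply/eqP; rewrite -memv0 -h0 -[apolar_value _]lfunE memv_img ?memvf.
move: d1 d2; rewrite d3 dim_cubics dimvf /dim /=; lia.
Qed.

Lemma linear_syzygy_lker v : v \in lker (linfun syz_map) <-> linear_syzygy g (syz_forms v).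
Proof.
rewrite memv_ker lfunE; split=> [/eqP/(congr1 val) /= h|[_ h]].
  by split=> // j; apply: linear_form_homog.
by apply/eqP/val_inj.
Qed.

Lemma syz_forms_surj s : linear_syzygy g s -> exists v, forall j, s j = syz_forms v j.
Proof.
move=> [hs _]; exists (\matrix_(j, i) (s j)@_U_(i)) => j.
rewrite {1}(dhomog1_linear_form (hs j)); congr linear_form.
by apply/rowP => i; rewrite !mxE.
Qed.

Lemma syz_forms_sum r (c : 'I_r -> R) (v : 'I_r -> 'M_(6, 4)) j :
  syz_forms (\sum_i c i *: v i) j = \sum_i c i *: syz_forms (v i) j.
Proof.
rewrite /syz_forms; have -> : row j (\sum_i c i *: v i) = \sum_i c i *: row j (v i).
  by apply/rowP => k; rewrite !(mxE, summxE); apply: eq_bigr => i _; rewrite !mxE.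
by rewrite linear_form_sum; apply: eq_bigr => i _; rewrite linear_formZ.
Qed.

Lemma syz_forms_inj u v : (forall j, syz_forms u j = syz_forms v j) -> u = v.
Proof.
move=> h; apply/matrixP => j i; have := congr1 (mcoeff U_(i)) (h j).
by rewrite !linear_form_coef !mxE.
Qed.

Lemma independent_linear_syzygies_exist :
  exists l : 'I_5 -> 'I_6 -> {mpoly R[4]}, independent_linear_syzygies g l.
Proof.
pose U := lker (linfun syz_map); pose b := vbasis U.
have sz : size b = 5%N by rewrite size_tuple dim_linear_syzygies.
exists (fun i => syz_forms b`_i); split.
  move=> i; apply/linear_syzygy_lker; apply: vbasis_mem.
  by rewrite mem_nth // sz.
move=> c hc; have /freeP fr : free (tcast dim_linear_syzygies b).
  by rewrite val_tcast (basis_free (vbasisP U)).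
apply: fr; rewrite val_tcast; apply: syz_forms_inj => j.
rewrite syz_forms_sum hc /syz_forms (_ : row j 0 = 0) ?linear_form0 //.
by apply/rowP => i; rewrite !mxE.
Qed.

Lemma independent_linear_syzygies_span (l : 'I_5 -> 'I_6 -> {mpoly R[4]}) :
  independent_linear_syzygies g l -> forall s, linear_syzygy g s -> syz_span l s.
Proof.
move=> [ls li] s hs; pose U := lker (linfun syz_map).
have /fin_all_exists[v hv] i := syz_forms_surj (ls i).
pose X := [tuple v i | i < 5].
have Xi (i : 'I_5) : X`_i = v i by rewrite (nth_map i) ?size_enum_ord // nth_ord_enum.
have fX : free X.
  apply/freeP => c hc; apply: li => j.
  have := congr1 (fun w => syz_forms w j) hc.
  under eq_bigr => i _ do rewrite Xi.
  rewrite syz_forms_sum /syz_forms (_ : row j 0 = 0) ?linear_form0.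
    by move=> e; rewrite -[RHS]e; apply: eq_bigr => i _; rewrite hv.
  by apply/rowP => i; rewrite !mxE.
have bX : basis_of U X.
  rewrite basisEfree fX size_tuple dim_linear_syzygies leqnn andbT.
  apply/span_subvP => w /mapP[i _ ->]; apply/linear_syzygy_lker.
  split=> [j|]; first exact: linear_form_homog.
  by rewrite -[RHS](proj2 (ls i)); apply: eq_bigr => j _; rewrite hv.
have [w hw] := syz_forms_surj hs.
have wU : w \in U.
  apply/linear_syzygy_lker; split=> [j|]; first exact: linear_form_homog.
  by rewrite -[RHS](proj2 hs); apply: eq_bigr => j _; rewrite hw.
exists (fun i => coord X i w) => j; rewrite hw {1}(coord_basis bX wU) syz_forms_sum.
by apply: eq_bigr => i _; rewrite Xi hv.
Qed.

End LinearSyzygies.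

(** * The algorithm for a real sum of five cubes *)

Section RealCubic.
Variables (R : fieldType) (C : numFieldType) (iota : {rmorphism R -> C}).
Variables (re : {additive C -> R}) (v w : C) (f : {mpoly R[4]}).
Hypothesis ext : quadratic_extension iota re v w.
Local Notation emb := (map_mpoly iota).
Local Notation poly_re := (map_mpoly re).
Variables (a : 'I_5 -> 'rV[C]_4) (Y : 'I_4 -> {mpoly C[4]}) (tau : 'I_4 -> C).
Hypothesis f_cubic : f \is 3.-homog.
Hypothesis fa : emb f = cubes a.
Hypothesis Ya : pentad a Y tau.

Local Notation E := (pentad_quadrics Y tau).

(** A complex cubic [S] with [eval_sum a S = 1] does not kill [f], so its two real components cannot
    both do so. *)
Lemma pentad_cubic_neq0 : exists2 D, D \is 3.-homog & diffop D f <> 0.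
Proof.
have [S hS S1] := eval_sum1_exists Ya.
have [e1|/eqP n1] := eqVneq (diffop (poly_re S) f) 0; last first.
  by exists (poly_re S) => //; apply: map_mpoly_homog.
exists (poly_re (w *: S)); first by apply: map_mpoly_homog; rewrite rpredZ.
move=> e2; have : diffop S (emb f) = 0.
  transitivity (emb (diffop (poly_re S) f) +
      v *: emb (diffop (poly_re (w *: S)) f)).
    by rewrite {1}(map_mpoly_re_split ext S) diffopDl diffopZl map_mpoly_diffop map_mpoly_diffop.
  by rewrite e1 e2 raddf0 scaler0 addr0.
rewrite fa; move/(apolar_cubes_cubic a hS)/eqP.
by rewrite S1 oner_eq0.
Qed.

Lemma apolar_pentad_quadric m : apolar_ideal (emb f) (E m).
Proof.
rewrite fa; apply/apolar_cubes_quadric; first exact: (pentad_quadrics_homog Ya).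
exact: polar_sum_pentad_quadrics.
Qed.

(** Both real components of [E m] are again apolar to [f]. The hypothesis concerns degree 2 only,
    because the lemma also serves to prove that explicit quadrics generate the ideal. *)
Lemma pentad_quadrics_real_span (g : 'I_6 -> {mpoly R[4]}) :
  (forall D, D \is 2.-homog -> apolar_ideal f D ->
     exists c : 'I_6 -> R, D = \sum_j c j *: g j) ->
  forall m, exists b : 'I_6 -> C, E m = \sum_j b j *: emb (g j).
Proof.
move=> span m; have hE := pentad_quadrics_homog Ya m.
have aE := apolar_pentad_quadric m.
have [c ec] := span _ (map_mpoly_homog re hE) (apolar_re ext aE).
have hiE : w *: E m \is 2.-homog by rewrite rpredZ.
have [d ed] := span _ (map_mpoly_homog re hiE) (apolar_re ext (apolarZ _ aE)).
exists (fun j => iota (c j) + v * iota (d j)).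
rewrite [LHS](map_mpoly_re_split ext) ec ed !(raddf_sum emb) scaler_sumr -big_split.
by apply: eq_bigr => j _; rewrite /= !map_mpolyZ scalerDl scalerA.
Qed.

Section Generators.
Variable g : 'I_6 -> {mpoly R[4]}.
Hypothesis g_gen : quadric_generators (apolar_ideal f) g.
Local Notation G j := (map_mpoly iota (g j)).

Lemma quadric_generators_span D : D \is 2.-homog -> apolar_ideal f D ->
  exists c : 'I_6 -> R, D = \sum_j c j *: g j.
Proof.
move=> hD /(proj2 g_gen) h.
have [c hc ->] := ideal_gen_homog (d := 0) (proj1 g_gen) hD h.
exists (fun j => (c j)@_0%MM); apply: eq_bigr => j _.
by rewrite {1}(dhomog0_const (hc j)) mul_mpolyC.
Qed.

Lemma generator_apolar j : apolar_ideal f (g j).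
Proof. by apply/(proj2 g_gen)/ideal_gen_mem. Qed.

Lemma complex_generator_homog j : G j \is 2.-homog.
Proof. exact/map_mpoly_homog/(proj1 g_gen). Qed.

Lemma polar_sum_generator j : polar_sum a (G j) = 0.
Proof.
apply/apolar_cubes_quadric; first exact: complex_generator_homog.
by rewrite -fa; apply/(apolar_map_mpoly iota)/generator_apolar.
Qed.

(* The vector c of the algorithm, up to a complex scalar. *)
Definition unit_value j : C := G j @! a ord_max.

Lemma generator_base j i : (G j @! a (wd i)) * tau i = - unit_value j.
Proof.
have := polar_sum_generator j; move/(polar_sum_eq0P Ya (complex_generator_homog j)).
by move=> /(_ i)/eqP; rewrite addr_eq0 => /eqP.
Qed.

Lemma generator_point k : exists r : C, r != 0 /\ forall j', G j' @! a k = r * unit_value j'.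
Proof.
have [i ->|->] := unliftP ord_max k; last first.
  by exists 1; split=> [|j']; rewrite ?oner_eq0 ?mul1r.
exists (- (tau i)^-1); rewrite oppr_eq0 invr_eq0 (pentad_tau Ya); split=> // j'.
rewrite lift_ord_max; apply: (mulIf (pentad_tau Ya i)).
by rewrite generator_base !mulNr mulrAC mulVf ?mul1r // (pentad_tau Ya).
Qed.

Lemma generators_of_pentad : exists B : 'M[C]_6,
  forall m, E m = \sum_j B m j *: G j.
Proof.
have /fin_all_exists[b hb] := pentad_quadrics_real_span quadric_generators_span.
by exists (\matrix_(m, j) b m j) => m; rewrite hb; apply: eq_bigr => j _; rewrite mxE.
Qed.

Lemma pentad_of_generators : exists D : 'M[C]_6,
  (forall j, D j e0 = unit_value j) /\ forall j, G j = \sum_m D j m *: E m.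
Proof.
have h j : exists c : 'I_6 -> C,
    c e0 = unit_value j /\ G j = \sum_m c m *: E m.
  have [c c0 ec] := pentad_quadrics_span Ya (complex_generator_homog j)
    (polar_sum_generator j).
  by exists c.
have /fin_all_exists[d hd] := h.
exists (\matrix_(j, m) d j m); split=> j; first by rewrite mxE (proj1 (hd j)).
by rewrite {1}(proj2 (hd j)); apply: eq_bigr => m _; rewrite mxE.
Qed.

Lemma unit_value_neq0 : exists j, unit_value j != 0.
Proof.
have [B hB] := generators_of_pentad.
have [/existsP//|/existsPn h] := boolP [exists j, unit_value j != 0].
have := pentad_quadric0_neq0 Ya ord_max; rewrite hB raddf_sum big1 ?eqxx // => j _.
by rewrite /= mevalZ; move/negPn/eqP: (h j); rewrite /unit_value => ->; rewrite mulr0.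
Qed.

(** Transported by [B] to the basis [E], the vector [c] is supported on [e0] by
    [pentad_syzygy_relation]; going back by the inverse matrix [D] picks out its column [e0], which
    consists of the unit values. *)
Lemma syzygy_relation_unique (c : 'I_6 -> C) :
  (forall n : 'I_6 -> {mpoly C[4]}, (forall j, n j \is 1.-homog) ->
     \sum_j n j * G j = 0 -> \sum_j c j *: n j = 0) ->
  exists lam, forall j, c j = lam * unit_value j.
Proof.
move=> hc; have [B hB] := generators_of_pentad.
have [D [D0 hD]] := pentad_of_generators.
have BD : B *m D = 1%:M.
  apply/matrixP => m m'; rewrite !mxE; apply/eqP; rewrite -subr_eq0; apply/eqP.
  pose x k := \sum_j B m j * D j k - (m == k)%:R.
  rewrite -/(x m'); apply: (pentad_quadrics_free Ya).
  transitivity (\sum_k (\sum_j B m j * D j k) *: E k - \sum_k (m == k)%:R *: E k).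
    by rewrite -sumrB; apply: eq_bigr => k _; rewrite scalerBl.
  apply/eqP; rewrite subr_eq0; apply/eqP; rewrite [RHS](bigD1 m) //= eqxx scale1r.
  rewrite [X in _ + X]big1 ?addr0 => [|k ne]; last first.
    by rewrite eq_sym (negPf ne) scale0r.
  rewrite [RHS]hB; under [RHS]eq_bigr => j _ do rewrite hD scaler_sumr.
  rewrite exchange_big; apply: eq_bigr => k _ /=.
  by rewrite scaler_suml; apply: eq_bigr => j _; rewrite scalerA.
have DB := mulmx1C BD.
pose gam m := \sum_j B m j * c j.
have gam0 : forall m, m != e0 -> gam m = 0.
  apply: (pentad_syzygy_relation Ya) => n hn syz.
  have := hc (fun j => \sum_m B m j *: n m).
  have -> : \sum_j c j *: (\sum_m B m j *: n m) = \sum_m gam m *: n m.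
    under eq_bigr => j _ do rewrite scaler_sumr.
    rewrite exchange_big; apply: eq_bigr => m _ /=; rewrite /gam scaler_suml.
    by apply: eq_bigr => j _; rewrite scalerA mulrC.
  apply=> [j|]; first by apply: rpred_sum => m _; rewrite rpredZ ?hn.
  rewrite -[RHS]syz; under eq_bigr => j _ do rewrite mulr_suml.
  rewrite exchange_big; apply: eq_bigr => m _ /=; rewrite hB mulr_sumr.
  by apply: eq_bigr => j _; rewrite -scalerAl scalerAr.
exists (gam e0) => j; rewrite -D0 mulrC.
transitivity (\sum_m D j m * gam m); last first.
  by rewrite (bigD1 e0) //= big1 ?addr0 // => m /gam0->; rewrite mulr0.
rewrite /gam; under eq_bigr => m _ do rewrite mulr_sumr.
rewrite exchange_big /= (bigD1 j) //= [X in _ + X]big1 ?addr0 => [|k ne].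
  under eq_bigr => m _ do rewrite mulrA.
  rewrite -mulr_suml; have := congr1 (fun M : 'M_6 => M j j) DB.
  by rewrite !mxE eqxx => ->; rewrite mul1r.
under eq_bigr => m _ do rewrite mulrA.
rewrite -mulr_suml; have := congr1 (fun M : 'M_6 => M j k) DB.
by rewrite !mxE eq_sym (negPf ne) => ->; rewrite mul0r.
Qed.

Lemma unit_value_relation (n : 'I_6 -> {mpoly C[4]}) :
  (forall j, n j \is 1.-homog) -> \sum_j n j * G j = 0 ->
  \sum_j unit_value j *: n j = 0.
Proof.
move=> hn syz; apply: (pentad_linear_eq0 Ya) => [|i].
  by apply: rpred_sum => j _; rewrite rpredZ ?hn.
have [r [r0 hr]] := generator_point (wd i).
apply: (mulfI r0); rewrite mulr0.
have := congr1 (fun p => p @! a (wd i)) syz; rewrite meval0 => e; rewrite -[RHS]e.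
rewrite !raddf_sum mulr_sumr; apply: eq_bigr => j _ /=.
by rewrite mevalZ mevalM hr; ring.
Qed.

Variable l : 'I_5 -> 'I_6 -> {mpoly R[4]}.
Hypothesis l_syz : independent_linear_syzygies g l.

(** The complex relation [unit_value] has two real components, each a relation, and they cannot both
    be zero. *)
Lemma real_relation_exists : exists c : 'rV[R]_6, c != 0 /\ syz_relation l c.
Proof.
have rel i : \sum_j unit_value j *: emb (l i j) = 0.
  have [hl sl] := proj1 l_syz i.
  apply: unit_value_relation => [j|]; first exact: map_mpoly_homog.
  rewrite -[RHS](raddf0 emb) -sl raddf_sum.
  by apply: eq_bigr => j _ /=; rewrite rmorphM.
have relR (x : C) : syz_relation l (\row_j re (x * unit_value j)).
  move=> i; rewrite -[RHS](raddf0 poly_re) -(scaler0 _ x) -(rel i).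
  rewrite scaler_sumr raddf_sum; apply: eq_bigr => j _ /=.
  by rewrite mxE scalerA (map_mpoly_reZ ext).
have [j hj] := unit_value_neq0.
have [e|n1] := eqVneq (\row_j re (1 * unit_value j)) 0; last first.
  by exists (\row_j re (1 * unit_value j)); split.
exists (\row_j re (w * unit_value j)); split=> //.
apply: contraNneq hj => e'.
have := congr1 (fun M : 'rV_6 => M 0 j) e; have := congr1 (fun M : 'rV_6 => M 0 j) e'.
rewrite !mxE mul1r => h1 h2; rewrite (re_split ext (unit_value j)) h1 h2.
by rewrite raddf0 mulr0 addr0.
Qed.

(** The five syzygies span all real ones and a complex syzygy splits into two real ones, so [c]
    annihilates every complex linear syzygy. *)
Lemma real_relation_unique (c : 'rV[R]_6) : syz_relation l c ->
  exists lam, forall j, iota (c 0 j) = lam * unit_value j.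
Proof.
move=> hc; apply: syzygy_relation_unique => n hn syz.
have hl := independent_linear_syzygies_span f_cubic g_gen pentad_cubic_neq0 l_syz.
have rel s : linear_syzygy g s -> \sum_j c 0 j *: s j = 0.
  move=> /hl[x hx]; under eq_bigr => j _ do rewrite hx scaler_sumr.
  rewrite exchange_big big1 // => i _ /=.
  transitivity (x i *: \sum_j c 0 j *: l i j); last by rewrite hc scaler0.
  by rewrite scaler_sumr; apply: eq_bigr => j _; rewrite !scalerA mulrC.
have syzR x : linear_syzygy g (fun j => poly_re (x *: n j)).
  split=> [j|]; first by apply: map_mpoly_homog; rewrite rpredZ ?hn.
  rewrite -[RHS](raddf0 poly_re) -(scaler0 _ x) -syz scaler_sumr raddf_sum.
  by apply: eq_bigr => j _ /=; rewrite scalerAl (map_mpoly_reM ext).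
have h1 := rel _ (syzR 1); have h2 := rel _ (syzR w).
transitivity (emb (\sum_j c 0 j *: poly_re (1 *: n j)) +
   v *: emb (\sum_j c 0 j *: poly_re (w *: n j))); last first.
  by rewrite h1 h2 raddf0 scaler0 addr0.
rewrite !(raddf_sum emb) scaler_sumr -big_split; apply: eq_bigr => j _ /=.
rewrite !map_mpolyZ scale1r {1}(map_mpoly_re_split ext (n j)) scalerDr !scalerA.
by rewrite [_ * v]mulrC.
Qed.

Lemma pivot_variety (c : 'rV[R]_6) (k : 'I_6) (z : 'rV[C]_4) :
  syz_relation l c -> c 0 k != 0 ->
  (z != 0 /\ forall p, ideal_gen (pivot_quadrics g c k) p -> emb p @! z = 0) <->
  exists i, same_point z (a i).
Proof.
move=> hc ck; have [lam hlam] := real_relation_unique hc.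
have ckC : iota (c 0 k) != 0.
  by rewrite fmorph_eq0.
have lam0 : lam != 0 by apply: contraNneq ckC => e; rewrite hlam e mul0r.
have uk : unit_value k != 0 by apply: contraNneq ckC => e; rewrite hlam e mulr0.
have pivE j : emb (pivot_quadrics g c k j) =
    lam *: (unit_value k *: G (lift k j) - unit_value (lift k j) *: G k).
  by rewrite /pivot_quadrics raddfB /= !map_mpolyZ !hlam scalerBr !scalerA.
split=> [[z0 hz]|[i [z0 ai0 [t ez]]]].
  (* The pivot equations make the vector of the [G j @! z] proportional to the vector of values at
     [a ord_max], so a combination [E m] vanishing at [a ord_max] vanishes at [z]. *)
  have Gz j : unit_value k * (G j @! z) = unit_value j * (G k @! z).
    have [j' ->|->//] := unliftP k j.
    have := hz _ (ideal_gen_mem _ j'); rewrite pivE mevalZ mevalB !mevalZ => /eqP.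
    by rewrite mulf_eq0 (negPf lam0) subr_eq0 => /eqP.
  have Ez m : m != e0 -> E m @! z = 0.
    move=> m0; have [B hB] := generators_of_pentad.
    apply: (mulfI uk); rewrite mulr0 hB raddf_sum mulr_sumr.
    transitivity ((\sum_j B m j * unit_value j) * (G k @! z)).
      rewrite mulr_suml; apply: eq_bigr => j _ /=.
      by rewrite mevalZ mulrCA Gz mulrA.
    have := pentad_quadrics_vanish Ya ord_max m0; rewrite hB raddf_sum /= => e.
    suff -> : \sum_j B m j * unit_value j = 0 by rewrite mul0r.
    by rewrite -[RHS]e; apply: eq_bigr => j _; rewrite mevalZ.
  have [i [t ez]] := pentad_variety Ya Ez z0.
  exists i; split=> //; last by exists t.
  by apply: contraNneq z0 => e; rewrite ez e scaler0.
split=> // p [h ->]; rewrite (raddf_sum emb) raddf_sum big1 // => j _ /=.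
rewrite (rmorphM (map_mpoly iota)) mevalM /= pivE ez.
have h2 j' : G j' @! (t *: a i) = t ^+ 2 * (G j' @! a i).
  exact: meval_homogZ (complex_generator_homog _).
have [r [_ hr]] := generator_point i.
rewrite mevalZ mevalB !mevalZ !h2 !hr; ring.
Qed.

End Generators.
End RealCubic.

(** * Generators of the apolar ideal *)

Section Polarization.
Variables (R : fieldType) (f : {mpoly R[4]}).
Hypothesis f_cubic : f \is 3.-homog.

Definition polar_coef (i j k : 'I_4) : R := (mderiv k (mderiv i (mderiv j f)))@_0%MM.

Definition polar_matrix (i : 'I_4) : 'M[R]_4 := \matrix_(j, k) polar_coef i j k.

Lemma polar_coefC i j k : polar_coef i j k = polar_coef j i k.
Proof. by rewrite /polar_coef (mderiv_comm j i). Qed.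

Lemma polar_coefCr i j k : polar_coef i j k = polar_coef i k j.
Proof.
by rewrite /polar_coef (mderiv_comm j i) (mderiv_comm j k) (mderiv_comm i k).
Qed.

Lemma diffop_XX i j : diffop ('X_i * 'X_j) f = linear_form (\row_k polar_coef i j k).
Proof.
rewrite diffopM !diffopX !mderivmU1m.
have h : mderiv i (mderiv j f) \is 1.-homog.
  by have [h _] := mderiv_homog j f_cubic; have [] := mderiv_homog i h.
rewrite {1}(dhomog1_linear_form h); congr linear_form; apply/rowP => k.
by rewrite !mxE /polar_coef mcoeff_deriv add0m mnm0E mulr1n.
Qed.

Lemma diffop_X_linear_form i v :
  diffop ('X_i * linear_form v) f = linear_form (v *m polar_matrix i).
Proof.
rewrite mulr_sumr diffop_suml.
under eq_bigr => j _ do rewrite -scalerAr diffopZl diffop_XX -linear_formZ.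
rewrite -linear_form_sum; congr linear_form; apply/rowP => k.
by rewrite summxE !mxE; apply: eq_bigr => j _; rewrite !mxE.
Qed.

Hypothesis polar_unit : polar_matrix o0 \in unitmx.

(** The linear form is solved for so that both terms have the same contraction with [f]; the
    contraction of ['X_o0 * linear_form u] is given by [u *m polar_matrix o0]. *)
Let gen i j : {mpoly R[4]} := 'X_i * 'X_j
  - 'X_o0 * linear_form (\row_k polar_coef i j k *m invmx (polar_matrix o0)).

Definition apolar_quadric (m : 'I_6) : {mpoly R[4]} :=
  [:: gen o1 o1; gen o1 o2; gen o1 o3; gen o2 o2; gen o2 o3; gen o3 o3]`_m.

Let gen_apolar i j : apolar_ideal f (gen i j).
Proof.
rewrite /apolar_ideal /gen -[- _]scaleN1r diffopDl diffopZl diffop_XX.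
by rewrite diffop_X_linear_form mulmxKV // scaleN1r subrr.
Qed.

Lemma apolar_quadric_apolar m : apolar_ideal f (apolar_quadric m).
Proof. by elim/ord6P: m; rewrite /apolar_quadric /=; apply: gen_apolar. Qed.

Lemma apolar_quadric_homog m : apolar_quadric m \is 2.-homog.
Proof.
have h i j : gen i j \is 2.-homog.
  rewrite /gen rpredB // -[2%N]/(1 + 1)%N dhomogM ?linear_form_homog //;
  by rewrite dhomogX /= mdeg1.
by elim/ord6P: m; apply: h.
Qed.

(** Modulo the six quadrics only ['X_o0] times a linear form [u] remains, and apolarity forces
    [u = 0] by invertibility of the slice. *)
Lemma apolar_quadric_span D : D \is 2.-homog -> apolar_ideal f D ->
  exists c : 'I_6 -> R, D = \sum_m c m *: apolar_quadric m.
Proof.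
move=> hD aD.
pose Q D := exists (c : 'I_6 -> R) u,
  D = \sum_m c m *: apolar_quadric m + 'X_o0 * linear_form u.
have Q0 : Q 0.
  exists (fun=> 0), 0; rewrite linear_form0 mulr0 addr0 big1 // => m _.
  by rewrite scale0r.
have QD p q : Q p -> Q q -> Q (p + q).
  move=> [c [u ->]] [c' [u' ->]]; exists (fun m => c m + c' m), (u + u').
  under [in RHS]eq_bigr => m _ do rewrite scalerDl.
  by rewrite big_split linear_formD mulrDr addrACA.
have QZ x p : Q p -> Q (x *: p).
  move=> [c [u ->]]; exists (fun m => x * c m), (x *: u).
  under [in RHS]eq_bigr => m _ do rewrite -scalerA.
  by rewrite -scaler_sumr linear_formZ -scalerAr scalerDr.
have QX u : Q ('X_o0 * linear_form u).
  exists (fun=> 0), u; rewrite big1 ?add0r // => m _; exact: scale0r.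
have X_lf i : 'X_i = linear_form (delta_mx 0 i) :> {mpoly R[4]}.
  rewrite /linear_form (bigD1 i) //= big1 => [|j /negPf ne].
    by rewrite !mxE !eqxx scale1r addr0.
  by rewrite !mxE ne andbF scale0r.
have QX0 i : Q ('X_o0 * 'X_i) by rewrite [in X in _ * X]X_lf; apply: QX.
have Qgen i j m : apolar_quadric m = gen i j -> Q ('X_i * 'X_j).
  move=> e; have -> : 'X_i * 'X_j = gen i j + 'X_o0 *
    linear_form (\row_k polar_coef i j k *m invmx (polar_matrix o0)).
    by rewrite /gen subrK.
  apply: QD; last exact: QX.
  exists (fun k => (k == m)%:R), 0; rewrite linear_form0 mulr0 addr0 -e.
  rewrite (bigD1 m) //= eqxx scale1r big1 ?addr0 // => k /negPf ->.
  exact: scale0r.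
have QXX i j : Q ('X_i * 'X_j).
  elim/ord4P: i; elim/ord4P: j.
  - exact: QX0.
  - exact: QX0.
  - exact: QX0.
  - exact: QX0.
  - by rewrite mulrC; apply: QX0.
  - exact: (Qgen _ _ e0).
  - exact: (Qgen _ _ e1).
  - exact: (Qgen _ _ e2).
  - by rewrite mulrC; apply: QX0.
  - by rewrite mulrC; apply: (Qgen _ _ e1).
  - exact: (Qgen _ _ e3).
  - exact: (Qgen _ _ e4).
  - by rewrite mulrC; apply: QX0.
  - by rewrite mulrC; apply: (Qgen _ _ e2).
  - by rewrite mulrC; apply: (Qgen _ _ e4).
  - exact: (Qgen _ _ e5).
have XX k : exists b : 'I_4 -> R, 'X_k = \sum_i b i *: 'X_i :> {mpoly R[4]}.
  exists (fun i => (i == k)%:R); rewrite (bigD1 k) //= eqxx scale1r.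
  by rewrite big1 ?addr0 // => i /negPf ->; rewrite scale0r.
have [c [u e]] : Q D.
  move: D hD {aD}; apply: (homogS_ind XX Q0 QD) => i p hp.
  move: p hp; apply: (homogS_ind XX) => [|p q hp hq|j p /dhomog0_const ->].
  - by rewrite mul0r.
  - by rewrite mulrDl; apply: QD.
  by rewrite mul_mpolyC -scalerAl; apply: QZ.
suff u0 : u = 0 by exists c; rewrite e u0 linear_form0 mulr0 addr0.
move: aD; rewrite /apolar_ideal e diffopDl diffop_suml big1 => [|m _]; last first.
  by rewrite diffopZl apolar_quadric_apolar scaler0.
rewrite add0r diffop_X_linear_form => /linear_form_eq0 h.
by rewrite -(mulmxK polar_unit u) h mul0mx.
Qed.

Variables (K : numFieldType) (iota : {rmorphism R -> K}).
Variables (re : {additive K -> R}) (v w : K).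
Hypothesis ext : quadratic_extension iota re v w.
Variables (a : 'I_5 -> 'rV[K]_4) (Y : 'I_4 -> {mpoly K[4]}) (tau : 'I_4 -> K).
Hypothesis fa : map_mpoly iota f = cubes a.
Hypothesis Ya : pentad a Y tau.

Lemma apolar_ideal_generators : quadric_generators (apolar_ideal f) apolar_quadric.
Proof.
split=> [|p]; first exact: apolar_quadric_homog.
split=> [ap|[h ->]]; last first.
  rewrite /apolar_ideal diffop_suml big1 // => m _.
  by rewrite diffopM apolar_quadric_apolar diffop0r.
have gE m : ideal_gen (fun j => map_mpoly iota (apolar_quadric j)) (pentad_quadrics Y tau m).
  have [b ->] := pentad_quadrics_real_span ext fa Ya apolar_quadric_span m.
  by apply: ideal_gen_sum => j _; apply: ideal_genZ; apply: ideal_gen_mem.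
rewrite (pihomog_partitionE (leqnn (msize p))); apply: ideal_gen_sum => d _.
have hd := pihomogP mdeg d p; have := apolar_ideal_pihomog d f_cubic ap.
move: (pihomog mdeg d p) hd => {ap}q hq aq.
have hQ := map_mpoly_homog iota hq.
have aQ : apolar_ideal (cubes a) (map_mpoly iota q).
  by rewrite -fa; apply/(apolar_map_mpoly iota).
have q0 : map_mpoly iota q = 0 -> ideal_gen apolar_quadric q.
  move=> e; have -> : q = 0 by apply: (@map_mpoly_fun_inj _ _ iota); rewrite e raddf0.
  exact: ideal_gen0.
have qI : ideal_gen (pentad_quadrics Y tau) (map_mpoly iota q) ->
    ideal_gen apolar_quadric q.
  by move=> hI; apply/(ideal_gen_map_mpoly ext)/(ideal_gen_trans gE).
(* Degrees 0 and 1 contain no nonzero apolar operator and degree 2 is spanned over the small field.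
   From degree 3 on, membership is known for the pentad quadrics and then descends. *)
case: d hq hQ => [[|[|[|[|d]]]] /= _] hq hQ.
- exact/q0/(apolar_pentad_const Ya).
- exact/q0/(apolar_pentad_linear Ya).
- have [c ->] := apolar_quadric_span hq aq.
  by apply: ideal_gen_sum => j _; apply: ideal_genZ; apply: ideal_gen_mem.
- by apply/qI/(pentad_cubic Ya) => //; apply/apolar_cubes_cubic.
- by apply/qI; apply: (@pentad_higher _ _ _ _ Ya d); rewrite addnC.
Qed.

End Polarization.

(** * The commuting extension of a symmetric tensor *)

Section Generic.
Variables (S : comNzRingType) (F : nat -> nat -> nat -> S).

(** Successor modulo 3. An index [i < 3] stands for the slice [i.+1], and [i], [nx i], [nx (nx i)]
    are the cyclic indices of cross products. *)
Definition nx (i : nat) : nat := match i with 0 => 1 | 1 => 2 | _ => 0 end.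

Definition ord4 (i : nat) : 'I_4 :=
  match i with
  | 0 => o0 | 1 => o1
  | 2 => o2 | _ => o3
  end.

Definition slice k : 'M[S]_4 := \matrix_(i, j) F k i j.
Definition slice_adj : 'M[S]_4 := \adj (slice 0).
Definition slice_det : S := \det (slice 0).

(* The adjugate replaces the inverse of A_0 so that everything below is
   polynomial in the entries of the tensor. *)
Definition slice_comm j k : 'M[S]_4 :=
  slice j *m slice_adj *m slice k - slice k *m slice_adj *m slice j.

(* The commutators are skew with zero row and column 0, i.e. cross product
   matrices of the vectors [comm_vec i], i < 3, which form a symmetric matrix. *)
Definition comm_vec i l : S :=
  slice_comm (nx i).+1 (nx (nx i)).+1 (ord4 (nx (nx l)).+1) (ord4 (nx l).+1).

Definition comm_cof i l : S :=
  comm_vec (nx i) (nx l) * comm_vec (nx (nx i)) (nx (nx l))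
  - comm_vec (nx i) (nx (nx l)) * comm_vec (nx (nx i)) (nx l).

Definition comm_det : S :=
  comm_vec 0 0 * comm_cof 0 0 + comm_vec 0 1 * comm_cof 0 1
  + comm_vec 0 2 * comm_cof 0 2.

(* The rows of the cofactor matrix of [comm_vec]: their cross products are
   [comm_det] times the [comm_vec i]. *)
Definition ext_col i : 'cV[S]_4 :=
  \col_a (match val a with 0 => 0 | l.+1 => comm_cof i l end).

Definition jacobi_col i : 'cV[S]_4 :=
  slice (nx (nx i)).+1 *m slice_adj *m ext_col (nx i)
  - slice (nx i).+1 *m slice_adj *m ext_col (nx (nx i)).

Definition jacobi_coef i l : S :=
  jacobi_col i (ord4 1) 0 * comm_vec l 0 + jacobi_col i (ord4 2) 0 * comm_vec l 1
  + jacobi_col i (ord4 3) 0 * comm_vec l 2.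

(* The coefficients of [jacobi_col] on the [ext_col] form a skew matrix by the
   Jacobi identity; this makes the corner entries consistent. *)
Definition corner_coef i : S := jacobi_coef (nx i) (nx (nx i)).

(** Up to the factor [slice_det ^+ 2 * comm_det], which clears denominators, this has the blocks
    A_{i+1} A_0^-1, u_i, rho u_i^T A_0^-1 and rho w_i, where u_i is [ext_col i], w_i is
    [corner_coef i] and rho is the inverse of [slice_det * comm_det]. *)
Definition ext_slice i : 'M[S]_(4 + 1) :=
  block_mx ((slice_det * comm_det) *: (slice i.+1 *m slice_adj))
           ((slice_det ^+ 2 * comm_det) *: ext_col i)
           ((ext_col i)^T *m slice_adj)
           (slice_det * corner_coef i)%:M.

(** A member of the commuting family: when its spectrum is simple, its eigenvectors diagonalise the
    whole family. *)
Definition ext_sum : 'M[S]_5 := ext_slice 1 + ext_slice 2.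

(* The last factor is, up to sign, the discriminant of the characteristic
   polynomial of [ext_sum]. *)
Definition sylvester_poly : S :=
  slice_det * comm_det * \det (horner_mx ext_sum (char_poly ext_sum)^`()).

End Generic.

(** * Compatibility with ring morphisms: evaluation of the coefficients and extension of scalars *)

Section GenericMorphism.
Variables (S T : comNzRingType) (h : {rmorphism S -> T}).
Variable F : nat -> nat -> nat -> S.
Local Notation hF := (fun i j k => h (F i j k)).

Lemma slice_map k : slice hF k = map_mx h (slice F k).
Proof. by apply/matrixP => i j; rewrite !mxE. Qed.

Lemma slice_adj_map : slice_adj hF = map_mx h (slice_adj F).
Proof. by rewrite /slice_adj slice_map map_mx_adj. Qed.

Lemma slice_det_map : slice_det hF = h (slice_det F).
Proof. by rewrite /slice_det slice_map det_map_mx. Qed.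

Lemma comm_vec_map i l : comm_vec hF i l = h (comm_vec F i l).
Proof.
rewrite /comm_vec /slice_comm !slice_map slice_adj_map -!map_mxM -map_mxB.
by rewrite [LHS]mxE.
Qed.

Lemma comm_cof_map i l : comm_cof hF i l = h (comm_cof F i l).
Proof. by rewrite /comm_cof !comm_vec_map rmorphB !rmorphM. Qed.

Lemma comm_det_map : comm_det hF = h (comm_det F).
Proof.
by rewrite /comm_det !comm_vec_map !comm_cof_map -!rmorphM -!rmorphD.
Qed.

Lemma ext_col_map i : ext_col hF i = map_mx h (ext_col F i).
Proof.
apply/matrixP => a b; rewrite !mxE; case: (val a) => [|l]; first by rewrite rmorph0.
exact: comm_cof_map.
Qed.

Lemma jacobi_col_map i : jacobi_col hF i = map_mx h (jacobi_col F i).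
Proof.
by rewrite /jacobi_col !slice_map slice_adj_map !ext_col_map -!map_mxM -map_mxB.
Qed.

Lemma corner_coef_map i : corner_coef hF i = h (corner_coef F i).
Proof.
rewrite /corner_coef /jacobi_coef jacobi_col_map !comm_vec_map.
by rewrite ![map_mx _ _ _ _]mxE -!rmorphM -!rmorphD.
Qed.

Lemma ext_slice_map i : ext_slice hF i = map_mx h (ext_slice F i).
Proof.
rewrite /ext_slice map_block_mx !map_mxZ map_mxM map_scalar_mx map_mxM -map_trmx.
rewrite slice_map slice_adj_map ext_col_map slice_det_map comm_det_map corner_coef_map.
by rewrite -rmorphXn -!rmorphM.
Qed.

Lemma ext_sum_map : ext_sum hF = map_mx h (ext_sum F).
Proof. by rewrite /ext_sum !ext_slice_map map_mxD. Qed.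

Lemma sylvester_poly_map : sylvester_poly hF = h (sylvester_poly F).
Proof.
rewrite /sylvester_poly ext_sum_map -map_char_poly deriv_map -map_horner_mx.
by rewrite det_map_mx slice_det_map comm_det_map -!rmorphM.
Qed.

End GenericMorphism.

Lemma nat3P (P : nat -> Prop) : P 0%N -> P 1%N -> P 2%N -> forall i, (i < 3)%N -> P i.
Proof. by move=> h0 h1 h2 [|[|[|//]]]. Qed.

Definition cofactor3 (K : comNzRingType) (c : nat -> nat -> K) i l : K :=
  c (nx i) (nx l) * c (nx (nx i)) (nx (nx l)) - c (nx i) (nx (nx l)) * c (nx (nx i)) (nx l).

Section SkewMatrix.
Variable K : comNzRingType.

Lemma outer_product_entry (p q : 'cV[K]_4) a b : (p *m q^T) a b = p a 0 * q b 0.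
Proof. by rewrite !mxE big_ord1 !mxE. Qed.

Lemma rowB m n (B C : 'M[K]_(m, n)) i : row i (B - C) = row i B - row i C.
Proof. by apply/rowP => k; rewrite !mxE. Qed.

(* The right-hand side is the matrix of the cross product of p and q. *)
Lemma skew_outer_product (k : 'M[K]_4) (p q : 'cV[K]_4) :
  (forall a b, k a b = - k b a) -> (forall a, k a a = 0) ->
  (forall b, k o0 b = 0) -> p o0 0 = 0 -> q o0 0 = 0 ->
  k o3 o2 = p o3 0 * q o2 0 - q o3 0 * p o2 0 ->
  k o1 o3 = p o1 0 * q o3 0 - q o1 0 * p o3 0 ->
  k o2 o1 = p o2 0 * q o1 0 - q o2 0 * p o1 0 ->
  k = p *m q^T - q *m p^T.
Proof.
move=> skew diag k0 p0 q0 h1 h2 h3.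
have k0r b : k b o0 = 0 by rewrite skew k0 oppr0.
have e1 := skew o2 o3; have e2 := skew o3 o1; have e3 := skew o1 o2.
rewrite h1 in e1; rewrite h2 in e2; rewrite h3 in e3.
have entry a b : (p *m q^T - q *m p^T) a b = p a 0 * q b 0 - q a 0 * p b 0.
  by rewrite mxE outer_product_entry mxE outer_product_entry.
apply/matrixP => a b; rewrite entry.
elim/ord4P: a; elim/ord4P: b;
  rewrite ?k0 ?k0r ?p0 ?q0 ?diag ?h1 ?h2 ?h3 ?e1 ?e2 ?e3; ring.
Qed.

Lemma commutator_outer (M B : 'M[K]_4) (p q : 'cV[K]_4) : M^T = M -> B^T = B ->
  M *m B *m (p *m q^T - q *m p^T) - (p *m q^T - q *m p^T) *m B *m M =
  (M *m B *m p) *m q^T - (M *m B *m q) *m p^T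
  - (p *m (M *m B *m q)^T - q *m (M *m B *m p)^T).
Proof.
by move=> hM hB; rewrite mulmxBr !mulmxBl !trmx_mul hM hB !mulmxA.
Qed.

Lemma outer_sum_entry (V U : nat -> 'cV[K]_4) :
  V 0%N *m (U 0%N)^T + U 0%N *m (V 0%N)^T + (V 1%N *m (U 1%N)^T + U 1%N *m (V 1%N)^T)
    + (V 2%N *m (U 2%N)^T + U 2%N *m (V 2%N)^T) = 0 ->
  forall a b, V 0%N a 0 * U 0%N b 0 + U 0%N a 0 * V 0%N b 0
    + (V 1%N a 0 * U 1%N b 0 + U 1%N a 0 * V 1%N b 0)
    + (V 2%N a 0 * U 2%N b 0 + U 2%N a 0 * V 2%N b 0) = 0.
Proof.
move=> h a b; have := congr1 (fun M : 'M_4 => M a b) h.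
have DE (M M' : 'M[K]_4) : (M + M') a b = M a b + M' a b by rewrite mxE.
by rewrite !DE !outer_product_entry mxE.
Qed.

(** The border's outer products make up for the commutator in the upper left block. The upper right
    block is the second hypothesis, the lower left one its transpose, and the lower right entries
    agree because a 1 x 1 matrix is symmetric. [x] and [y] stand for [slice_det] and [comm_det]. *)
Lemma bordered_comm (Aj Ak B : 'M[K]_4) (uj uk : 'cV[K]_4) (x y wj wk : K) :
  Aj^T = Aj -> Ak^T = Ak -> B^T = B ->
  y *: (Aj *m B *m Ak - Ak *m B *m Aj) = uk *m uj^T - uj *m uk^T ->
  y *: (Ak *m B *m uj - Aj *m B *m uk) = wk *: uj - wj *: uk ->
  block_mx ((x * y) *: (Aj *m B)) ((x ^+ 2 * y) *: uj) (uj^T *m B) (x * wj)%:M *m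
  block_mx ((x * y) *: (Ak *m B)) ((x ^+ 2 * y) *: uk) (uk^T *m B) (x * wk)%:M =
  block_mx ((x * y) *: (Ak *m B)) ((x ^+ 2 * y) *: uk) (uk^T *m B) (x * wk)%:M *m
  block_mx ((x * y) *: (Aj *m B)) ((x ^+ 2 * y) *: uj) (uj^T *m B) (x * wj)%:M.
Proof.
move=> Ajt Akt Bt H1 H2.
have {}H1 : y *: (Aj *m B *m Ak) + uj *m uk^T = y *: (Ak *m B *m Aj) + uk *m uj^T.
  move/eqP: H1; rewrite scalerBr subr_eq => /eqP ->.
  by rewrite addrAC subrK addrC.
have {}H2 : y *: (Aj *m B *m uk) + wk *: uj = y *: (Ak *m B *m uj) + wj *: uk.
  move/eqP: H2; rewrite scalerBr subr_eq => /eqP ->.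
  by rewrite [RHS]addrAC subrK addrC.
have H3 : y *: (uj^T *m B *m Ak) + wj *: uk^T = y *: (uk^T *m B *m Aj) + wk *: uj^T.
  have := congr1 trmx H2; rewrite !linearD /= !linearZ /= !trmx_mul Ajt Akt Bt !mulmxA.
  by move=> <-.
rewrite !mulmx_block; congr block_mx.
- transitivity ((x ^+ 2 * y) *: ((y *: (Aj *m B *m Ak) + uj *m uk^T) *m B)).
    rewrite mulmxDl scalerDr -!scalemxAl -!scalemxAr !scalerA ?mulmxA; congr (_ *: _ + _).
    ring.
  rewrite H1 mulmxDl scalerDr -!scalemxAl -!scalemxAr !scalerA ?mulmxA.
  by congr (_ *: _ + _); ring.
- transitivity ((x ^+ 3 * y) *: (y *: (Aj *m B *m uk) + wk *: uj)).
    rewrite !mul_mx_scalar scalerDr -!scalemxAl -!scalemxAr !scalerA ?mulmxA.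
    by congr (_ *: _ + _ *: _); ring.
  rewrite H2 !mul_mx_scalar scalerDr -!scalemxAl -!scalemxAr !scalerA ?mulmxA.
  by congr (_ *: _ + _ *: _); ring.
- transitivity (x *: ((y *: (uj^T *m B *m Ak) + wj *: uk^T) *m B)).
    rewrite mul_scalar_mx mulmxDl scalerDr -!scalemxAl -!scalemxAr !scalerA ?mulmxA.
    by congr (_ *: _ + _ *: _); ring.
  rewrite H3 mul_scalar_mx mulmxDl scalerDr -!scalemxAl -!scalemxAr !scalerA ?mulmxA.
  by congr (_ *: _ + _ *: _); ring.
- rewrite -!scalar_mxM [x * wk * _]mulrC -!scalemxAr; congr (_ *: _ + _).
  have t11 (M : 'M[K]_1) : M^T = M by apply/matrixP => a b; rewrite !ord1 mxE.
  by rewrite -[LHS]t11 !trmx_mul trmxK Bt mulmxA.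
Qed.

End SkewMatrix.

(** * The bordered slices commute *)

Section Extension5.
Variables (K : numFieldType) (F : nat -> nat -> nat -> K).
Hypothesis F_sym : forall i j k, F i j k = F j i k.
Hypothesis F_symr : forall i j k, F i j k = F i k j.

Local Notation A := (slice F).
Local Notation N := (slice_adj F).
Local Notation d := (slice_det F).
Local Notation delta := (comm_det F).
Local Notation u := (ext_col F).
Local Notation v := (jacobi_col F).
Local Notation cv := (comm_vec F).
Local Notation Kc i := (slice_comm F (nx i).+1 (nx (nx i)).+1).

Lemma slice_tr k : (A k)^T = A k.
Proof. by apply/matrixP => i j; rewrite !mxE F_symr. Qed.

Lemma slice_adj_tr : N^T = N.
Proof. by rewrite /slice_adj trmx_adj slice_tr. Qed.

Lemma slice_row i j : (i < 4)%N -> (j < 4)%N -> row (ord4 i) (A j) = row (ord4 j) (A i).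
Proof.
have h k : (k < 4)%N -> ord4 k = k :> nat by case: k => [|[|[|[|]]]].
by move=> hi hj; apply/rowP => k; rewrite !mxE !h // F_sym.
Qed.

Lemma slice_comm_tr j k : (slice_comm F j k)^T = - slice_comm F j k.
Proof.
rewrite /slice_comm linearB /= !trmx_mul !slice_tr slice_adj_tr !mulmxA.
by rewrite opprB.
Qed.

(** Row 0 of A_j is row j of A_0, and A_0 times its adjugate is scalar; so both products have the
    same row 0, [slice_det] times row j of A_k. *)
Lemma slice_comm_row0 j k : (j < 4)%N -> (k < 4)%N -> row o0 (slice_comm F j k) = 0.
Proof.
move=> hj hk; rewrite /slice_comm rowB !row_mul.
rewrite -[o0]/(ord4 0) (slice_row _ hj) // (slice_row _ hk) // -!row_mul.
rewrite /slice_adj mul_mx_adj !mul_scalar_mx !linearZ /=.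
by rewrite scalerN (slice_row hk hj) subrr.
Qed.

Lemma slice_comm_skew j k a b : slice_comm F j k a b = - slice_comm F j k b a.
Proof. by have /matrixP/(_ b a) := slice_comm_tr j k; rewrite !mxE. Qed.

Lemma slice_comm_diag j k a : slice_comm F j k a a = 0.
Proof.
have /eqP := slice_comm_skew j k a a.
by rewrite -addr_eq0 -mulr2n mulrn_eq0 => /eqP.
Qed.

Lemma slice_comm_0l j k b : (j < 4)%N -> (k < 4)%N -> slice_comm F j k o0 b = 0.
Proof. by move=> hj hk; have /rowP/(_ b) := slice_comm_row0 hj hk; rewrite !mxE. Qed.

Lemma slice_comm_cyc :
  row (ord4 1) (Kc 0%N) + row (ord4 2) (Kc 1%N) + row (ord4 3) (Kc 2%N) = 0.
Proof.
rewrite /slice_comm !rowB !row_mul.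
rewrite (@slice_row 2 1) // (@slice_row 3 1) // (@slice_row 3 2) //.
by apply/rowP => k; rewrite !mxE; ring.
Qed.

(** In entries 1, 2, 3 of the cyclic identity the diagonal term drops out by skewness, leaving one
    symmetry condition each. *)
Lemma comm_vec_sym i l : (i < 3)%N -> (l < 3)%N -> cv i l = cv l i.
Proof.
have h b : Kc 0%N (ord4 1) b + Kc 1%N (ord4 2) b + Kc 2%N (ord4 3) b = 0.
  by have /rowP/(_ b) := slice_comm_cyc; rewrite !mxE.
have h1 := h (ord4 1); have h2 := h (ord4 2); have h3 := h (ord4 3).
rewrite slice_comm_diag add0r in h1; rewrite slice_comm_diag addr0 in h2.
rewrite slice_comm_diag addr0 in h3.
have e01 : cv 0 1 = cv 1 0.
  rewrite /comm_vec /=; apply/eqP; rewrite -subr_eq0 -slice_comm_skew; apply/eqP.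
  exact: h3.
have e02 : cv 0 2 = cv 2 0.
  rewrite /comm_vec /= [LHS]slice_comm_skew; apply/eqP.
  rewrite eq_sym -addr_eq0 addrC; apply/eqP.
  exact: h2.
have e12 : cv 1 2 = cv 2 1.
  rewrite /comm_vec /=; apply/eqP; rewrite -subr_eq0 -slice_comm_skew; apply/eqP.
  exact: h1.
by move=> hi hl; move: i hi l hl; apply: nat3P; apply: nat3P.
Qed.

Lemma ext_col0 i : u i o0 0 = 0.
Proof. by rewrite mxE. Qed.

Lemma ext_colS i l : (l < 3)%N -> u i (ord4 l.+1) 0 = comm_cof F i l.
Proof. by move: l; apply: nat3P; rewrite mxE. Qed.

Lemma comm_det_slice_comm i : (i < 3)%N ->
  delta *: Kc i = u (nx (nx i)) *m (u (nx i))^T - u (nx i) *m (u (nx (nx i)))^T.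
Proof.
move=> hi; have [h1 h2] : ((nx i).+1 < 4)%N /\ ((nx (nx i)).+1 < 4)%N.
  by move: i hi; apply: nat3P.
have vecE l : (delta *: Kc i) (ord4 (nx (nx l)).+1) (ord4 (nx l).+1) = delta * cv i l.
  by rewrite mxE.
have scE a b : (delta *: Kc i) a b = delta * Kc i a b by rewrite mxE.
apply: skew_outer_product.
- by move=> a b; rewrite !scE [in LHS]slice_comm_skew mulrN.
- by move=> a; rewrite scE slice_comm_diag mulr0.
- by move=> b; rewrite scE slice_comm_0l // mulr0.
- exact: ext_col0.
- exact: ext_col0.
- rewrite (vecE 0%N) !(@ext_colS _ 1) // !(@ext_colS _ 2) // /comm_det /comm_cof.
  by move: i hi {h1 h2 vecE scE} (comm_vec F) => i hi c; move: i hi; apply: nat3P => /=; ring.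
- rewrite (vecE 1%N) !(@ext_colS _ 0) // !(@ext_colS _ 2) // /comm_det /comm_cof.
  by move: i hi {h1 h2 vecE scE} (comm_vec F) => i hi c; move: i hi; apply: nat3P => /=; ring.
- rewrite (vecE 2%N) !(@ext_colS _ 0) // !(@ext_colS _ 1) // /comm_det /comm_cof.
  by move: i hi {h1 h2 vecE scE} (comm_vec F) => i hi c; move: i hi; apply: nat3P => /=; ring.
Qed.

Lemma slice_jacobi :
  A 1 *m N *m Kc 0%N - Kc 0%N *m N *m A 1 + (A 2 *m N *m Kc 1%N - Kc 1%N *m N *m A 2)
  + (A 3 *m N *m Kc 2%N - Kc 2%N *m N *m A 3) = 0.
Proof.
rewrite /slice_comm /= !mulmxBr !mulmxBl !mulmxA.
by apply/matrixP => i j; rewrite !mxE; ring.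
Qed.

(** The Jacobi identity with each commutator replaced by its outer product form; collecting the
    terms around each [u i] leaves the factor [v i]. *)
Lemma jacobi_col_sum :
  v 0%N *m (u 0%N)^T + u 0%N *m (v 0%N)^T + (v 1%N *m (u 1%N)^T + u 1%N *m (v 1%N)^T)
  + (v 2%N *m (u 2%N)^T + u 2%N *m (v 2%N)^T) = 0.
Proof.
pose al i j : 'cV_4 := A i.+1 *m N *m u j.
have step i : (i < 3)%N ->
    delta *: (A i.+1 *m N *m Kc i - Kc i *m N *m A i.+1) =
    al i (nx (nx i)) *m (u (nx i))^T - al i (nx i) *m (u (nx (nx i)))^T
    - (u (nx (nx i)) *m (al i (nx i))^T - u (nx i) *m (al i (nx (nx i)))^T).
  move=> hi; rewrite scalerBr scalemxAr !scalemxAl comm_det_slice_comm //.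
  by apply: commutator_outer; [exact: slice_tr|exact: slice_adj_tr].
have e : delta *: (A 1 *m N *m Kc 0%N - Kc 0%N *m N *m A 1)
  + delta *: (A 2 *m N *m Kc 1%N - Kc 1%N *m N *m A 2)
  + delta *: (A 3 *m N *m Kc 2%N - Kc 2%N *m N *m A 3) = 0.
  by rewrite -!scalerDr slice_jacobi scaler0.
rewrite -[RHS]e (step 0%N) // (step 1%N) // (step 2%N) //.
have v0 : v 0 = al 2 1 - al 1 2 := erefl.
have v1 : v 1 = al 0 2 - al 2 0 := erefl.
have v2 : v 2 = al 1 0 - al 0 1 := erefl.
rewrite {}v0 {}v1 {}v2 /=; clear e step.
move: (al 2 1) (al 1 2) (al 0 2) (al 2 0) (al 1 0) (al 0 1) (u 0) (u 1) (u 2).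
move=> a21 a12 a02 a20 a10 a01 u0 u1 u2; apply/matrixP => a b.
have DE (M M' : 'M[K]_4) : (M + M') a b = M a b + M' a b by rewrite mxE.
have NE (M : 'M[K]_4) : (- M) a b = - M a b by rewrite mxE.
have cE (p q : 'cV[K]_4) i : (p - q) i 0 = p i 0 - q i 0 by rewrite !mxE.
rewrite !(DE, NE, outer_product_entry, cE); ring.
Qed.

Lemma jacobi_col0 i : (i < 3)%N -> v i o0 0 = 0.
Proof.
move=> hi.
have al0 j k : (j < 3)%N -> (k < 3)%N -> (A j.+1 *m N *m u k) o0 0 = d * comm_cof F k j.
  move=> hj hk; transitivity (row o0 (A j.+1 *m N *m u k) 0 0); first by rewrite [RHS]mxE.
  rewrite !row_mul -[o0]/(ord4 0) (@slice_row 0 j.+1) // -!row_mul.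
  have -> : A 0 *m N = d%:M by apply: mul_mx_adj.
  by rewrite mul_scalar_mx [LHS]mxE [LHS]mxE ext_colS.
have cofC j k : (j < 3)%N -> (k < 3)%N -> comm_cof F k j = comm_cof F j k.
  have nx3 l : (l < 3)%N -> (nx l < 3)%N by move: l; apply: nat3P.
  move=> hj hk; have hnj := nx3 _ hj; have hnk := nx3 _ hk.
  rewrite /comm_cof !(@comm_vec_sym (nx k)) ?nx3 // !(@comm_vec_sym (nx (nx k))) ?nx3 //.
  ring.
rewrite /jacobi_col; have [h1 h2] : (nx i < 3)%N /\ (nx (nx i) < 3)%N.
  by move: i hi; apply: nat3P.
rewrite mxE [X in _ + X]mxE !al0 // (cofC _ _ h1 h2); ring.
Qed.

(** The rows of [comm_vec] are dual to the cofactor rows up to [comm_det]. Pairing the symmetric sum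
    [jacobi_col_sum] with rows [l] and [i] gives [comm_det] times the left-hand side. *)
Lemma jacobi_coef_skew i l : (i < 3)%N -> (l < 3)%N -> comm_det F != 0 ->
  jacobi_coef F i l + jacobi_coef F l i = 0.
Proof.
move=> hi hl d0; apply: (mulfI d0); rewrite mulr0.
have := outer_sum_entry jacobi_col_sum; rewrite /jacobi_coef.
move: (v) => V e; pose V' m a := V m (ord4 a.+1) 0; pose cof := comm_cof F.
have {}e a b : (a < 3)%N -> (b < 3)%N ->
    V' 0%N a * cof 0%N b + cof 0%N a * V' 0%N b
    + (V' 1%N a * cof 1%N b + cof 1%N a * V' 1%N b)
    + (V' 2%N a * cof 2%N b + cof 2%N a * V' 2%N b) = 0.
  by move=> ha hb; rewrite /cof -!(ext_colS _ ha) -!(ext_colS _ hb); apply: e.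
rewrite -!/(V' _ 0%N) -!/(V' _ 1%N) -!/(V' _ 2%N).
move: e; rewrite /cof /comm_det /comm_cof; move: (comm_vec F) V' => c {}V {cof} e.
transitivity (\sum_(a < 3) \sum_(b < 3) c l a * c i b * (
    V 0%N a * cofactor3 c 0%N b + cofactor3 c 0%N a * V 0%N b
    + (V 1%N a * cofactor3 c 1%N b + cofactor3 c 1%N a * V 1%N b)
    + (V 2%N a * cofactor3 c 2%N b + cofactor3 c 2%N a * V 2%N b))); last first.
  by rewrite big1 // => a _; rewrite big1 // => b _; rewrite e // mulr0.
rewrite !big_ord_recl !big_ord0 /= /cofactor3 /=.
by move: i hi l hl; do 2!apply: nat3P => /=; ring.
Qed.

(** Expanded in the [u j], [v i] has no [u i] component by skewness. A skew 3 x 3 matrix amounts to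
    a vector, so one corner scalar per slice settles all three relations. *)
Lemma corner_decomposition i : (i < 3)%N -> delta != 0 ->
  delta *: v i = corner_coef F (nx (nx i)) *: u (nx i)
    - corner_coef F (nx i) *: u (nx (nx i)).
Proof.
move=> hi d0; have [h1 h2] : (nx i < 3)%N /\ (nx (nx i) < 3)%N.
  by move: i hi; apply: nat3P.
have e1 : corner_coef F (nx (nx i)) = jacobi_coef F i (nx i).
  by move: i hi {h1 h2}; apply: nat3P.
have e2 : corner_coef F (nx i) = - jacobi_coef F i (nx (nx i)).
  have -> : corner_coef F (nx i) = jacobi_coef F (nx (nx i)) i.
    by move: i hi {h1 h2 e1}; apply: nat3P.
  by apply/eqP; rewrite -addr_eq0 jacobi_coef_skew.
have e0 : jacobi_coef F i i = 0.
  by have /eqP := jacobi_coef_skew hi hi d0; rewrite -mulr2n mulrn_eq0 => /eqP.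
rewrite e1 e2 scaleNr opprK; apply/colP => a.
have -> : (delta *: v i) a 0 = delta * v i a 0 by rewrite mxE.
have -> : (jacobi_coef F i (nx i) *: u (nx i)
  + jacobi_coef F i (nx (nx i)) *: u (nx (nx i))) a 0 = jacobi_coef F i (nx i) * u (nx i) a 0
  + jacobi_coef F i (nx (nx i)) * u (nx (nx i)) a 0 by rewrite !mxE.
have [->|[l [hl ->]]] : a = o0 \/ exists l, (l < 3)%N /\ a = ord4 l.+1.
  by elim/ord4P: a; [left|right; exists 0%N|right; exists 1%N|right; exists 2%N].
  by rewrite jacobi_col0 // !ext_col0 !mulr0 addr0.
rewrite !ext_colS //.
transitivity (jacobi_coef F i i * comm_cof F i l
  + (jacobi_coef F i (nx i) * comm_cof F (nx i) l
  + jacobi_coef F i (nx (nx i)) * comm_cof F (nx (nx i)) l)); last by rewrite e0 mul0r add0r.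
clear e0 e1 e2 h1 h2; rewrite /jacobi_coef /comm_det /comm_cof.
pose V a := v i (ord4 a.+1) 0; rewrite -/(V l) -/(V 0%N) -/(V 1%N) -/(V 2%N).
move: (comm_vec F) V => c V.
by move: i hi l hl; do 2!apply: nat3P => /=; ring.
Qed.

Lemma ext_slice_comm_nx i : (i < 3)%N -> delta != 0 ->
  ext_slice F (nx i) *m ext_slice F (nx (nx i)) =
  ext_slice F (nx (nx i)) *m ext_slice F (nx i).
Proof.
move=> hi d0; apply: bordered_comm; do ?exact: slice_tr; first exact: slice_adj_tr.
  exact: comm_det_slice_comm.
exact: corner_decomposition.
Qed.

Lemma ext_slice_commute i j : (i < 3)%N -> (j < 3)%N -> delta != 0 ->
  ext_slice F i *m ext_slice F j = ext_slice F j *m ext_slice F i.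
Proof.
move=> hi hj d0.
have h0 : ext_slice F 1 *m ext_slice F 2 = ext_slice F 2 *m ext_slice F 1.
  exact: (@ext_slice_comm_nx 0).
have h1 : ext_slice F 2 *m ext_slice F 0 = ext_slice F 0 *m ext_slice F 2.
  exact: (@ext_slice_comm_nx 1).
have h2 : ext_slice F 0 *m ext_slice F 1 = ext_slice F 1 *m ext_slice F 0.
  exact: (@ext_slice_comm_nx 2).
have lt3 k : (k < 3)%N -> [\/ k = 0%N, k = 1%N | k = 2%N].
  by case: k => [|[|[|//]]]; [constructor 1|constructor 2|constructor 3].
case: (lt3 _ hi) => ->; case: (lt3 _ hj) => ->.
- exact: erefl.
- exact: h2.
- exact: esym h1.
- exact: esym h2.
- exact: erefl.
- exact: h0.
- exact: h1.
- exact: esym h0.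
- exact: erefl.
Qed.

End Extension5.

(** * Decomposition of a generic tensor *)

Section SimpleSpectrum.
Variables (K : closedFieldType) (n : nat) (M : 'M[K]_n.+1).

Lemma eigenvector_horner (x : K) (z : 'rV_n.+1) p :
  z *m M = x *: z -> z *m horner_mx M p = p.[x] *: z.
Proof.
move=> zM; elim/poly_ind: p => [|p c IH].
  by rewrite rmorph0 mulmx0 horner0 scale0r.
rewrite rmorphD rmorphM /= horner_mx_X horner_mx_C mulmxDr mulmxA IH.
by rewrite -scalemxAl zM mul_mx_scalar scalerA -scalerDl hornerMXaddC.
Qed.

(** At a common root of the characteristic polynomial and its derivative, an eigenvector would be
    killed by the invertible matrix of the hypothesis. So all roots are simple. *)
Lemma simple_spectrum : \det (horner_mx M (char_poly M)^`()) != 0 ->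
  exists (V : 'M[K]_n.+1) (lam : 'I_n.+1 -> K),
    [/\ V \in unitmx, injective lam & V *m M = diag_mx (\row_i lam i) *m V].
Proof.
move=> hdet; set chi := char_poly M in hdet *.
have no_common x : root chi x -> root chi^`() x = false.
  rewrite -eigenvalue_root_char => /eigenvalueP[z zM z0].
  apply/negbTE; apply: contra z0 => /rootP r0.
  have zh := eigenvector_horner (chi^`()) zM; rewrite r0 scale0r in zh.
  have hu : horner_mx M chi^`() \in unitmx by rewrite unitmxE unitfE.
  by rewrite -(mulmxK hu z) zh mul0mx.
have sep : separable_poly chi.
  rewrite unlock /coprimep -[_ == _]negbK; apply/negP => /closed_rootP[x].
  by rewrite root_gcd => /andP[/no_common->].
have [r] := closed_field_poly_normal chi.
rewrite (monicP (char_poly_monic M)) scale1r => chiE.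
have ur : uniq r by rewrite -separable_prod_XsubC -chiE.
have [V Vu] : diagonalizable M.
  by apply/diagonalizableP; exists r => //; rewrite -chiE mxminpoly_dvd_char.
move=> /diagonalizable_forPex[D /(simmxP Vu) VM].
exists V, (fun i => D 0 i); split=> //; last first.
  by rewrite VM; congr (diag_mx _ *m _); apply/rowP => i; rewrite mxE.
have : char_poly (diag_mx D) = chi.
  have VMX : map_mx polyC V *m char_poly_mx M = char_poly_mx (diag_mx D) *m map_mx polyC V.
    rewrite /char_poly_mx mulmxBr mulmxBl -!map_mxM VM; congr (_ - _).
    by rewrite mul_mx_scalar mul_scalar_mx.
  have e := congr1 determinant VMX; rewrite !det_mulmx mulrC in e.
  by apply: (mulIf _ (esym e)); rewrite det_map_mx polyC_eq0 -unitfE -unitmxE.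
rewrite char_poly_trig ?diag_mx_is_trig // => chiD.
have : uniq [seq D 0 i | i <- enum 'I_n.+1].
  rewrite -separable_prod_XsubC big_map big_enum /= (eq_bigr
    (fun i => 'X - (diag_mx D i i)%:P)) ?chiD // => i _.
  by rewrite mxE eqxx mulr1n.
by move=> /injectiveP.
Qed.

End SimpleSpectrum.

(** * Cubes from the joint eigenvectors of a commuting extension *)

Section CommutingExtension.
Variables (K : numClosedFieldType) (F : nat -> nat -> nat -> K).
Variables (T : nat -> 'M[K]_5) (G : 'M[K]_5) (Del : K) (col : nat -> 'I_4 -> K).
Local Notation up := (@lshift 4 1 : 'I_4 -> 'I_5).
Local Notation last := (@rshift 4 1 ord0 : 'I_5).

Hypothesis Del0 : Del != 0.
Hypothesis T_last : forall k a, T k (up a) last = Del * col k a.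
Hypothesis T_row0 : forall k j, (k < 3)%N ->
  T k (up o0) j = Del * (j == up (ord4 k.+1))%:R.
Hypothesis TG_tr : forall k, (T k *m G)^T = T k *m G.
Hypothesis TG_up : forall k (a b : 'I_4), (T k *m G) (up a) (up b) = Del * F k.+1 a b.
Hypothesis G_tr : G^T = G.
Hypothesis G_up : forall a b : 'I_4, G (up a) (up b) = F 0 a b.
Hypothesis G_unit : G \in unitmx.
Hypothesis col_free : forall x : 'I_4 -> K,
  (forall k, (k < 3)%N -> \sum_a x a * col k a = 0) ->
  forall m, (m < 3)%N -> x (ord4 m.+1) = 0.
Hypothesis T_comm : forall i j, (i < 3)%N -> (j < 3)%N -> T i *m T j = T j *m T i.
Hypothesis T_simple : \det (horner_mx (T 1 + T 2) (char_poly (T 1 + T 2))^`()) != 0.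

Let ordP (s : 'I_5) : (exists a, s = up a) \/ s = last.
Proof.
by case: (@split_ordP 4 1 s) => [a ->|b ->]; [left; exists a|right; rewrite (ord1 b)].
Qed.

Let up_neq_last a : up a != last.
Proof. by rewrite -val_eqE /= addn0 ltn_eqF. Qed.

(** With W inverse to V, each [T k] is W D_k V and [G] is W S W^T with D_k and S diagonal. The upper
    blocks of [G] and [T k *m G] then express the tensor through the columns of W cut to four
    rows. *)
Lemma cubes_of_commuting_extension :
  exists (ell : 'I_5 -> 'rV[K]_4) (r : 'I_5 -> K),
  [/\ forall s, r s != 0, \sum_s r s *: ell s = 0,
      forall z : 'rV_4, (forall s, \sum_j z 0 j * ell s 0 j = 0) -> z = 0
    & forall i j k : 'I_4, F i j k = 6%:R * \sum_s ell s 0 i * ell s 0 j * ell s 0 k].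
Proof.
have [V [lam [Vu lam_inj VX]]] : exists (V : 'M[K]_5) (lam : 'I_5 -> K),
    [/\ V \in unitmx, injective lam & V *m (T 1 + T 2) = diag_mx (\row_i lam i) *m V].
  exact: simple_spectrum.
have [X XE] : exists X, X = T 1 + T 2 by exists (T 1 + T 2).
rewrite -XE in VX.
have TX k : (k < 3)%N -> T k *m X = X *m T k.
  by move=> hk; rewrite XE mulmxDr mulmxDl; congr (_ + _); apply: T_comm.
pose W := invmx V.
have VW : V *m W = 1%:M by rewrite mulmxV.
have WV : W *m V = 1%:M by rewrite mulVmx.
have [D DE] : exists D, forall k, D k = V *m T k *m W by exists (fun k => V *m T k *m W).
have DV k : D k *m V = V *m T k by rewrite DE mulmxKV.
have WD k : W *m D k = T k *m W by rewrite DE !mulmxA WV mul1mx.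
have D_diag k i j : (k < 3)%N -> i != j -> D k i j = 0.
  move=> hk ne_ij.
  have e : D k *m diag_mx (\row_i lam i) = diag_mx (\row_i lam i) *m D k.
    apply: (can_inj (mulmxK Vu)); rewrite -[LHS]mulmxA -VX [LHS]mulmxA DV.
    by rewrite -[LHS]mulmxA TX // [LHS]mulmxA VX -!mulmxA DV.
  have := congr1 (fun M : 'M_5 => M i j) e.
  rewrite mul_mx_diag mul_diag_mx !mxE => /eqP.
  rewrite mulrC -subr_eq0 -mulrBl mulf_eq0 subr_eq0 (inj_eq lam_inj) eq_sym.
  by rewrite (negPf ne_ij) => /eqP.
pose p s k : K := match k with 0 => 1 | k'.+1 => D k' s s / Del end.
(* Row 0 of [T k] is a multiple of a unit vector, so the eigenvector equation fixes the ratio of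
   entries [k.+1] and 0 in column [s] of [W]. *)
have Wp s (a : 'I_4) : W (up a) s = W (up o0) s * p s a.
  have h k : (k < 3)%N -> W (up (ord4 k.+1)) s = W (up o0) s * p s k.+1.
    move=> hk; have := congr1 (fun M : 'M_5 => M (up o0) s) (WD k).
    rewrite /= !mxE (bigD1 s) //= big1 => [|j ne]; last by rewrite D_diag ?mulr0.
    rewrite addr0 (bigD1 (up (ord4 k.+1))) //= big1 => [|j ne]; last first.
      by rewrite T_row0 // (negPf ne) mulr0 mul0r.
    rewrite T_row0 // eqxx mulr1 addr0 /p => e.
    by rewrite mulrA e mulrC mulKf.
  elim/ord4P: a; first by rewrite mulr1.
  - exact: (h 0%N).
  - exact: (h 1%N).
  - exact: (h 2%N).
have [S SE] : exists S, S = V *m G *m V^T by exists (V *m G *m V^T).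
have S_tr : S^T = S by rewrite SE !trmx_mul trmxK G_tr mulmxA.
(* [X *m G] and [G] are symmetric, so [S] commutes with a diagonal matrix with distinct entries. *)
have S_diag i j : i != j -> S i j = 0.
  move=> ne_ij.
  have e : (diag_mx (\row_i lam i) *m S)^T = diag_mx (\row_i lam i) *m S.
    have -> : diag_mx (\row_i lam i) *m S = V *m (X *m G) *m V^T.
      by rewrite SE !mulmxA VX.
    rewrite !trmx_mul trmxK -trmx_mul XE mulmxDl linearD /= !TG_tr mulmxA.
    by rewrite -mulmxDl.
  have := congr1 (fun M : 'M_5 => M i j) e.
  have Sji : S j i = S i j by rewrite -[in LHS]S_tr mxE.
  rewrite mxE !mul_diag_mx !mxE Sji => /eqP.
  rewrite -subr_eq0 -mulrBl mulf_eq0 subr_eq0 (inj_eq lam_inj) eq_sym.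
  by rewrite (negPf ne_ij) => /eqP.
have GW : G = W *m S *m W^T.
  rewrite SE !mulmxA WV mul1mx -mulmxA -trmx_mul WV trmx1 mulmx1 //.
have entry (M : 'M[K]_5) i j : (forall a b, a != b -> M a b = 0) ->
    (W *m M *m W^T) i j = \sum_s W i s * M s s * W j s.
  move=> hM; rewrite mxE; apply: eq_bigr => s _.
  rewrite mxE (bigD1 s) //= big1 ?addr0 => [|b ne]; last by rewrite hM ?mulr0.
  by rewrite [W^T _ _]mxE.
have FE i j k : (i < 4)%N -> F i (j : 'I_4) (k : 'I_4) =
    \sum_s (W (up o0) s ^+ 2 * S s s) * p s i * p s j * p s k.
  case: i => [_|i hi].
    rewrite -G_up {1}GW entry //; apply: eq_bigr => s _.
    by rewrite (Wp s j) (Wp s k) /=; ring.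
  apply: (mulfI Del0); rewrite -TG_up.
  have -> : T i *m G = W *m (D i *m S) *m W^T.
    by rewrite {1}GW !mulmxA -WD.
  rewrite entry => [|a b ne]; last first.
    rewrite mxE (bigD1 a) //= S_diag // mulr0 add0r big1 // => c ne'.
    by rewrite D_diag 1?eq_sym // mul0r.
  rewrite mulr_sumr; apply: eq_bigr => s _.
  rewrite (Wp s j) (Wp s k) mxE (bigD1 s) //=.
  rewrite big1 ?addr0 => [|c ne]; last by rewrite S_diag ?mulr0.
  by field.
(* Otherwise column [s] of [W] is reduced to its last entry, and the eigenvector equations force all
   borders to vanish. *)
have W0 s : W (up o0) s != 0.
  apply/eqP => W0s; have Wa (a : 'I_4) : W (up a) s = 0 by rewrite Wp W0s mul0r.
  have Wl : W last s != 0.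
    apply/eqP => Wl; have := congr1 (fun M : 'M_5 => M s s) VW.
    rewrite /= !mxE eqxx big1 => [/esym/eqP|j _]; first by rewrite oner_eq0.
    by have [[a ->]|->] := ordP j; rewrite ?Wa ?Wl mulr0.
  have c0 k a : (k < 3)%N -> col k a = 0.
    move=> hk; have := congr1 (fun M : 'M_5 => M (up a) s) (WD k).
    rewrite /= !mxE [RHS](bigD1 last) //= [X in _ = _ + X]big1 => [|j ne]; last first.
      by have [[b ->]|e] := ordP j; [rewrite Wa mulr0 | rewrite e eqxx in ne].
    rewrite (bigD1 s) //= Wa mul0r add0r big1 => [|j ne]; last by rewrite D_diag ?mulr0.
    rewrite addr0 T_last => /esym/eqP.
    by rewrite !mulf_eq0 (negPf Del0) (negPf Wl) orbF => /eqP.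
  have e1 : (1 : K) = 0.
    apply: (col_free (x := fun=> 1) _ (m := 0%N)) => // k hk.
    by rewrite big1 // => a _; rewrite c0 // mulr0.
  by move/eqP: e1; rewrite oner_eq0.
(* Otherwise row [s] of [V] annihilates all borders, which leaves only its entry 0; row 0 of [T 0]
   removes that one too. *)
have Vl s : V s last != 0.
  apply/eqP => Vl0.
  have x0 : forall m, (m < 3)%N -> V s (up (ord4 m.+1)) = 0.
    apply: (col_free (x := fun a => V s (up a))) => k hk.
    apply: (mulfI Del0); rewrite mulr0.
    have := congr1 (fun M : 'M_5 => M s last) (DV k).
    rewrite /= !mxE (bigD1 s) //= Vl0 mulr0 add0r big1 => [|j ne]; last first.
      by rewrite D_diag ?mul0r // eq_sym.
    rewrite (@big_split_ord _ _ _ 4 1) /= big_ord1 => e.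
    rewrite [RHS]e Vl0 mul0r addr0 mulr_sumr; apply: eq_bigr => a _.
    by rewrite T_last mulrCA.
  have V0 : V s (up o0) = 0.
    apply: (mulIf Del0); rewrite mul0r.
    have := congr1 (fun M : 'M_5 => M s (up (ord4 1))) (DV 0%N).
    rewrite /= !mxE (bigD1 s) //= (x0 0%N) // mulr0 add0r big1 => [|j ne]; last first.
      by rewrite D_diag ?mul0r // eq_sym.
    rewrite (bigD1 (up o0)) //= T_row0 // eqxx mulr1 big1 ?addr0 => [<- //|j ne].
    have [[a ea]|->] := ordP j; last by rewrite Vl0 mul0r.
    move: ea ne => ->; elim/ord4P: a => [/eqP//|_|_|_];
      by rewrite ?(x0 0%N) ?(x0 1%N) ?(x0 2%N) ?mul0r.
  have := congr1 (fun M : 'M_5 => M s s) VW.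
  rewrite /= !mxE eqxx big1 => [/esym/eqP|j _]; first by rewrite oner_eq0.
  have [[a ->]|->] := ordP j; last by rewrite Vl0 mul0r.
  by elim/ord4P: a; rewrite ?V0 ?(x0 0%N) ?(x0 1%N) ?(x0 2%N) ?mul0r.
have S0 s : S s s != 0.
  apply/eqP => Ss0; have Su : S \in unitmx by rewrite SE !unitmx_mul Vu G_unit unitmx_tr Vu.
  have := congr1 (fun M : 'M_5 => M s s) (mulmxV Su).
  rewrite /= !mxE eqxx big1 => [/esym/eqP|j _]; first by rewrite oner_eq0.
  by have [<-|ne] := eqVneq s j; rewrite ?Ss0 ?S_diag ?mul0r.
(* The weights are absorbed into the vectors by cube roots; 6 is the constant in the third
   derivatives of a cube. *)
pose mu s := W (up o0) s ^+ 2 * S s s / 6%:R.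
have mu0 s : mu s != 0.
  by rewrite !mulf_neq0 ?expf_neq0 ?invr_eq0 ?pnatr_eq0.
pose th s := 3.-root (mu s).
have th3 s : th s ^+ 3 = mu s by rewrite rootCK.
have th0 s : th s != 0.
  by apply: contraNneq (mu0 s) => e; rewrite -th3 e expr0n.
exists (fun s => \row_k (th s * p s k)), (fun s => W (up o0) s * V s last / th s).
split.
- by move=> s; rewrite !mulf_neq0 ?invr_eq0.
(* The relation is the upper part of the last column of [W *m V = 1%:M]. *)
- apply/rowP => k; rewrite summxE mxE.
  have := congr1 (fun M : 'M_5 => M (up k) last) WV.
  rewrite /= !mxE (negPf (up_neq_last k)) => e; rewrite -[RHS]e.
  apply: eq_bigr => s _; rewrite !mxE Wp; field; exact: th0.
- move=> z hz.
  have h (x y t c : K) : t != 0 -> y * (x * c) = x / t * (y * (t * c)).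
    by move=> t0; field.
  pose z' : 'rV[K]_5 := row_mx z (0 : 'rV_1).
  have zW : z' *m W = 0.
    apply/rowP => s; rewrite !mxE (@big_split_ord _ _ _ 4 1) /= big_ord1.
    rewrite (@row_mxEr K 1 4 1) mxE mul0r addr0.
    transitivity (W (up o0) s / th s * \sum_j z 0 j * (th s * p s j)).
      rewrite mulr_sumr; apply: eq_bigr => j _; rewrite (@row_mxEl K 1 4 1) (Wp s j).
      by apply: h; apply: th0.
    have := hz s; under eq_bigr => j _ do rewrite mxE.
    by move=> ->; rewrite mulr0.
  have z'0 : z' = 0 by rewrite -(mulmxK (_ : W \in unitmx) z') ?unitmx_inv // zW mul0mx.
  apply/rowP => j; have := congr1 (fun M : 'rV_5 => M 0 (up j)) z'0.
  by rewrite (@row_mxEl K 1 4 1) !mxE.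
move=> i j k; rewrite FE // mulr_sumr; apply: eq_bigr => s _; rewrite !mxE.
have -> : W (up o0) s ^+ 2 * S s s = 6%:R * th s ^+ 3.
  by rewrite th3 /mu [RHS]mulrC divfK // pnatr_eq0.
ring.
Qed.

End CommutingExtension.

Section CubesOfTensor.
Variables (K : numClosedFieldType) (F : nat -> nat -> nat -> K).
Hypothesis F_sym : forall i j k, F i j k = F j i k.
Hypothesis F_symr : forall i j k, F i j k = F i k j.
Hypothesis F_generic : sylvester_poly F != 0.

Local Notation A := (slice F).
Local Notation d := (slice_det F).
Local Notation delta := (comm_det F).
Local Notation up := (@lshift 4 1 : 'I_4 -> 'I_5).
Local Notation last := (@rshift 4 1 ord0 : 'I_5).

Let T (k : nat) : 'M[K]_5 := ext_slice F k.
Let Del := d ^+ 2 * delta.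
Let rho := (d * delta)^-1.
(** Extends the symmetric form A_0 to the border, with [rho] chosen to make [T k *m G] symmetric. *)
Let G : 'M[K]_5 := block_mx (A 0) 0 0 rho%:M.

Let d0 : d != 0.
Proof. by apply: contraNneq F_generic => e; rewrite /sylvester_poly e !mul0r. Qed.

Let delta0 : delta != 0.
Proof. by apply: contraNneq F_generic => e; rewrite /sylvester_poly e mulr0 mul0r. Qed.

Let Del0 : Del != 0.
Proof. by rewrite mulf_neq0 ?expf_neq0. Qed.

Let ordP (s : 'I_5) : (exists a, s = up a) \/ s = last.
Proof.
by case: (@split_ordP 4 1 s) => [a ->|b ->]; [left; exists a|right; rewrite (ord1 b)].
Qed.

Let up_neq_last a : up a != last.
Proof. by rewrite -val_eqE /= addn0 ltn_eqF. Qed.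

Let up_eq a b : (up a == up b) = (a == b).
Proof. by rewrite -!val_eqE. Qed.

Let T_last k a : T k (up a) last = Del * ext_col F k a 0.
Proof. by rewrite /T /ext_slice (@block_mxEur K 4 1 4 1) mxE. Qed.

Let T_row0 k j : (k < 3)%N -> T k (up o0) j = Del * (j == up (ord4 k.+1))%:R.
Proof.
move=> hk; have [[a ->]|->] := ordP j; last first.
  by rewrite T_last ext_col0 eq_sym (negPf (up_neq_last _)).
rewrite /T /ext_slice (@block_mxEul K 4 1 4 1) mxE up_eq.
transitivity (d * delta * row o0 (A k.+1 *m slice_adj F) 0 a); first by rewrite [row _ _ _ _]mxE.
rewrite row_mul -[o0]/(ord4 0) (slice_row F_sym) // -row_mul.
have -> : A 0 *m slice_adj F = d%:M by apply: mul_mx_adj.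
by rewrite /Del !mxE [a == _]eq_sym; case: (_ == a); rewrite ?mulr0n ?mulr1n; ring.
Qed.

Let TG k : T k *m G = block_mx (Del *: A k.+1) (d *: ext_col F k) (d *: (ext_col F k)^T)
   (d * corner_coef F k * rho)%:M :> 'M_(4 + 1).
Proof.
rewrite /T /ext_slice /G (@mulmx_block K 4 1 4 1 4 1) !mulmx0 !addr0 !add0r; congr block_mx.
- rewrite -scalemxAl -mulmxA mul_adj_mx mul_mx_scalar scalerA; congr (_ *: _).
  by rewrite /Del -/d; ring.
- rewrite mul_mx_scalar scalerA; congr (_ *: _); rewrite /rho; field.
  by rewrite d0 delta0.
- by rewrite -mulmxA mul_adj_mx mul_mx_scalar.
- by rewrite -scalar_mxM.
Qed.

Let TG_tr k : (T k *m G)^T = T k *m G.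
Proof.
rewrite TG (@tr_block_mx K 4 1 4 1) tr_scalar_mx !linearZ /= trmxK.
by rewrite (slice_tr F_symr).
Qed.

Let TG_up k (a b : 'I_4) : (T k *m G) (up a) (up b) = Del * F k.+1 a b.
Proof. by rewrite TG (@block_mxEul K 4 1 4 1) !mxE. Qed.

Let G_tr : G^T = G.
Proof. by rewrite /G (@tr_block_mx K 4 1 4 1) tr_scalar_mx !trmx0 (slice_tr F_symr). Qed.

Let G_up (a b : 'I_4) : G (up a) (up b) = F 0 a b.
Proof. by rewrite /G (@block_mxEul K 4 1 4 1) !mxE. Qed.

Let G_unit : G \in unitmx.
Proof.
rewrite unitmxE (@det_ublock K 4 1) det_scalar1 unitfE mulf_neq0 //.
by rewrite invr_eq0 mulf_neq0.
Qed.

Let comm_cof_dual l m : (l < 3)%N -> (m < 3)%N ->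
  comm_vec F 0 l * comm_cof F 0 m + comm_vec F 1 l * comm_cof F 1 m
  + comm_vec F 2 l * comm_cof F 2 m = delta * (l == m)%:R.
Proof.
rewrite /comm_det /comm_cof; move: (comm_vec F) => c.
by move=> hl hm; move: l hl m hm; do 2!apply: nat3P => /=; ring.
Qed.

Let ext_col_zero (x : 'I_4 -> K) :
  (forall k, (k < 3)%N -> \sum_a x a * ext_col F k a 0 = 0) ->
  forall m, (m < 3)%N -> x (ord4 m.+1) = 0.
Proof.
move=> h m hm; apply: (mulfI delta0); rewrite mulr0.
have e k : (k < 3)%N -> x (ord4 1) * comm_cof F k 0 + x (ord4 2) * comm_cof F k 1
    + x (ord4 3) * comm_cof F k 2 = 0.
  move=> hk; rewrite -[RHS](h k hk) sum_ord4 ext_col0 mulr0 add0r.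
  by rewrite -(@ext_colS _ F k 0) // -(@ext_colS _ F k 1) // -(@ext_colS _ F k 2).
transitivity (comm_vec F 0 m * (x (ord4 1) * comm_cof F 0 0 + x (ord4 2) * comm_cof F 0 1
    + x (ord4 3) * comm_cof F 0 2)
  + comm_vec F 1 m * (x (ord4 1) * comm_cof F 1 0 + x (ord4 2) * comm_cof F 1 1
    + x (ord4 3) * comm_cof F 1 2)
  + comm_vec F 2 m * (x (ord4 1) * comm_cof F 2 0 + x (ord4 2) * comm_cof F 2 1
    + x (ord4 3) * comm_cof F 2 2)); last by rewrite !e // !mulr0 !addr0.
have h0 := comm_cof_dual hm (isT : (0 < 3)%N).
have h1 := comm_cof_dual hm (isT : (1 < 3)%N).
have h2 := comm_cof_dual hm (isT : (2 < 3)%N).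
transitivity (x (ord4 1) * (delta * (m == 0)%:R) + x (ord4 2) * (delta * (m == 1)%:R)
   + x (ord4 3) * (delta * (m == 2)%:R)).
  by move: m hm {h0 h1 h2}; apply: nat3P; rewrite /= !mulr0 ?addr0 ?add0r mulr1 mulrC.
rewrite -h0 -h1 -h2; move: (comm_cof F) (comm_vec F) => c c'.
ring.
Qed.

Theorem cubes_of_tensor : exists (ell : 'I_5 -> 'rV[K]_4) (r : 'I_5 -> K),
  [/\ forall s, r s != 0, \sum_s r s *: ell s = 0,
      forall z : 'rV_4, (forall s, \sum_j z 0 j * ell s 0 j = 0) -> z = 0
    & forall i j k : 'I_4, F i j k = 6%:R * \sum_s ell s 0 i * ell s 0 j * ell s 0 k].
Proof.
have comm i j : (i < 3)%N -> (j < 3)%N -> T i *m T j = T j *m T i.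
  by move=> hi hj; apply: ext_slice_commute.
have simple : \det (horner_mx (T 1 + T 2) (char_poly (T 1 + T 2))^`()) != 0.
  apply: contraNneq F_generic => e.
  by rewrite /sylvester_poly /ext_sum -/(T 1) -/(T 2) e mulr0.
exact: (@cubes_of_commuting_extension K F T G Del (fun k a => ext_col F k a 0)
  Del0 T_last T_row0 TG_tr TG_up G_tr G_up G_unit ext_col_zero comm simple).
Qed.

End CubesOfTensor.

(** * The generic cubic *)

Section PolarCoef.
Variables (R : fieldType).
Implicit Types (f p q : {mpoly R[4]}).

Lemma polar_coefE f i j k : polar_coef f i j k =
  f@_(U_(k) + U_(i) + U_(j)) *+ ((U_(k) + U_(i))%MM j).+1 *+ (U_(k)%MM i).+1.
Proof. by rewrite /polar_coef !mcoeff_deriv add0m mnm0E mulr1n. Qed.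

Lemma polar_coef_diffop f i j k : polar_coef f i j k = (diffop ('X_k * 'X_i * 'X_j) f)@_0%MM.
Proof. by rewrite !diffopM !diffopX !mderivmU1m. Qed.

Lemma mnm_degree3 n (m : 'X_{1..n}) : mdeg m = 3%N ->
  exists i j k, m = (U_(k) + U_(i) + U_(j))%MM.
Proof.
have step d (m' : 'X_{1..n}) : mdeg m' = d.+1 ->
    exists m'' i, mdeg m'' = d /\ m' = (m'' + U_(i))%MM.
  move=> hm; have [|i hi] := @mnm_gt0 n m'.
    by apply/eqP => m0; rewrite m0 mdeg0 in hm.
  have e : m' = ((m' - U_(i)) + U_(i))%MM by rewrite submK // lep1mP -lt0n.
  exists (m' - U_(i))%MM, i; split=> //.
  by have := congr1 mdeg e; rewrite mdegD mdeg1 hm addn1 => -[].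
move=> /step[m2 [j [h2 ->]]]; have [m1 [i [h1 ->]]] := step _ _ h2.
by have [k ->] := mnm_eq_mnm1 h1; exists i, j, k.
Qed.

End PolarCoef.

Lemma cubic_polar_eq (K : numFieldType) (p q : {mpoly K[4]}) :
  p \is 3.-homog -> q \is 3.-homog ->
  (forall i j k, polar_coef p i j k = polar_coef q i j k) -> p = q.
Proof.
move=> hp hq e; apply/mpolyP => m.
have [m3|ne] := eqVneq (mdeg m) 3%N; last first.
  by rewrite (dhomog_nemf_coeff hp ne) (dhomog_nemf_coeff hq ne).
have [i [j [k ->]]] := mnm_degree3 m3.
have := e i j k; rewrite !polar_coefE -!mulrnA => /eqP.
by rewrite eqrMn2r ?muln_eq0 // => /eqP.
Qed.

Lemma polar_coef_cubes (K : numFieldType) (a : 'I_5 -> 'rV[K]_4) i j k :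
  polar_coef (cubes a) i j k = 6%:R * \sum_s a s 0 i * a s 0 j * a s 0 k.
Proof.
rewrite polar_coef_diffop diffop_cubes_cubic.
  rewrite mcoeffC eqxx mulr1; congr (_ * _); apply: eq_bigr => s _.
  by rewrite !mevalM !mevalXU; ring.
have hX l : 'X_l \is [in K[4], 1.-homog] by rewrite dhomogX /= mdeg1.
by rewrite -[3%N]/(1 + 1 + 1)%N !dhomogM.
Qed.

Lemma cubes_homog (K : numFieldType) (a : 'I_5 -> 'rV[K]_4) : cubes a \is 3.-homog.
Proof.
apply: rpred_sum => s _.
by have := dhomogMn 3 (linear_form_homog (a s)); rewrite mul1n.
Qed.

Lemma polar_coef_map (R K : fieldType) (iota : {rmorphism R -> K}) f i j k :
  polar_coef (map_mpoly iota f) i j k = iota (polar_coef f i j k).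
Proof. by rewrite !polar_coefE mcoeff_map_mpoly !rmorphMn. Qed.

Section GenericCubic.
Variable R : fieldType.
Local Notation N := #|cubic_monomials|.

Lemma mdeg3_lt4 (i j k : 'I_4) : (mdeg (U_(k) + U_(i) + U_(j)) < 4)%N.
Proof. by rewrite !mdegD !mdeg1. Qed.

Definition cubic_monomial (i j k : 'I_4) : 'X_{1..4 < 4} := BMultinom (mdeg3_lt4 i j k).

Lemma cubic_monomial_in i j k : cubic_monomial i j k \in cubic_monomials.
Proof. by rewrite inE /= !mdegD !mdeg1. Qed.

Definition monomial_index (i j k : 'I_4) : 'I_N :=
  enum_rank_in (cubic_monomial_in i j k) (cubic_monomial i j k).

(* The third derivatives of the generic cubic, as linear polynomials in its
   coefficients. *)
Definition generic_polar (i j k : nat) : {mpoly R[N]} :=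
  'X_(monomial_index (ord4 i) (ord4 j) (ord4 k))
    *+ ((U_(ord4 k) + U_(ord4 i))%MM (ord4 j)).+1 *+ (U_(ord4 k)%MM (ord4 i)).+1.

Definition cubic_polar (f : {mpoly R[4]}) (i j k : nat) : R :=
  (generic_polar i j k).@[cubic_coef f].

Lemma cubic_polarE f i j k : cubic_polar f i j k = polar_coef f (ord4 i) (ord4 j) (ord4 k).
Proof.
rewrite /cubic_polar /generic_polar !mevalMn mevalXU polar_coefE.
by rewrite /cubic_coef enum_rankK_in // cubic_monomial_in.
Qed.

Lemma sylvester_poly_generic f :
  (sylvester_poly generic_polar).@[cubic_coef f] = sylvester_poly (cubic_polar f).
Proof. by rewrite (sylvester_poly_map (meval (cubic_coef f))). Qed.

End GenericCubic.

(** * A cubic outside the exceptional set *)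

Section Example.
Variable R : realFieldType.

(* The third derivatives of
   x_0^3/6 + x_0(x_1^2 + x_2^2 + x_3^2)/2 + x_1 x_2^2, by index. *)
Definition example_tensor (k i j : nat) : nat :=
  nth 0%N (nth [::] (nth [::]
   [:: [:: [:: 1; 0; 0; 0]; [:: 0; 1; 0; 0]; [:: 0; 0; 1; 0]; [:: 0; 0; 0; 1]];
       [:: [:: 0; 1; 0; 0]; [:: 1; 0; 0; 0]; [:: 0; 0; 2; 0]; [:: 0; 0; 0; 0]];
       [:: [:: 0; 0; 1; 0]; [:: 0; 0; 2; 0]; [:: 1; 2; 0; 0]; [:: 0; 0; 0; 0]];
       [:: [:: 0; 0; 0; 1]; [:: 0; 0; 0; 0]; [:: 0; 0; 0; 0]; [:: 1; 0; 0; 0]]] k) i) j.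

Variable F : nat -> nat -> nat -> R.
Hypothesis FE : forall k i j, (k < 4)%N -> (i < 4)%N -> (j < 4)%N ->
  F k i j = (example_tensor k i j)%:R.

Let sliceE k (i j : 'I_4) : (k < 4)%N -> slice F k i j = (example_tensor k i j)%:R.
Proof. by move=> hk; rewrite mxE FE. Qed.

Let slice0 : slice F 0 = 1%:M.
Proof.
apply/matrixP => i j; rewrite sliceE // mxE.
by elim/ord4P: i; elim/ord4P: j.
Qed.

Let slice_det1 : slice_det F = 1.
Proof. by rewrite /slice_det slice0 det1. Qed.

Let adj1 : slice_adj F = 1%:M.
Proof.
have := mul_mx_adj (slice F 0); rewrite -/(slice_adj F) -/(slice_det F) slice0.
by rewrite mul1mx slice_det1.
Qed.

Let commE j k a b : (j < 4)%N -> (k < 4)%N -> slice_comm F j k a b =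
  \sum_(m < 4) ((example_tensor j a m)%:R * (example_tensor k m b)%:R
    - (example_tensor k a m)%:R * (example_tensor j m b)%:R).
Proof.
move=> hj hk; rewrite /slice_comm adj1 !mulmx1 sumrB.
have PE (M M' : 'M[R]_4) : (M *m M') a b = \sum_m M a m * M' m b by rewrite mxE.
have BE (M M' : 'M[R]_4) : (M - M') a b = M a b - M' a b by rewrite !mxE.
by rewrite BE !PE; congr (_ - _); apply: eq_bigr => m _; rewrite !sliceE.
Qed.

Let vecE i l : (i < 3)%N -> (l < 3)%N ->
  comm_vec F i l = if i == l then if i == 2%N then 3%:R else -1 else 0.
Proof.
move=> hi hl; have h n : (n < 3)%N -> ((nx n).+1 < 4)%N by move: n; apply: nat3P.
have h' n : (n < 3)%N -> ((nx (nx n)).+1 < 4)%N by move: n; apply: nat3P.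
rewrite /comm_vec (commE _ _ (h _ hi) (h' _ hi)) sum_ord4.
by move: i hi l hl {h h'}; do 2!apply: nat3P => /=; rewrite /example_tensor /=; ring.
Qed.

Let cofE i l : (i < 3)%N -> (l < 3)%N ->
  comm_cof F i l = if i == l then if i == 2%N then 1 else - 3%:R else 0.
Proof.
move=> hi hl; have h n : (nx n < 3)%N by case: n => [|[|]].
rewrite /comm_cof !(vecE (h _) (h _)).
by move: i hi l hl {h}; do 2!apply: nat3P => /=; ring.
Qed.

Let detE : comm_det F = 3%:R.
Proof. by rewrite /comm_det !vecE // !cofE //=; ring. Qed.

Let colE i a : (i < 3)%N -> ext_col F i a 0 =
  if val a == i.+1 then if i == 2%N then 1 else - 3%:R else 0.
Proof.
move=> hi; rewrite mxE; elim/ord4P: a => //=; rewrite cofE //=.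
- by move: i hi; apply: nat3P.
- by move: i hi; apply: nat3P.
- by move: i hi; apply: nat3P.
Qed.

Let jacE i a : (i < 3)%N -> jacobi_col F i a 0 = 0.
Proof.
move=> hi; have h n : (nx n < 3)%N by case: n => [|[|]].
rewrite /jacobi_col adj1 !mulmx1.
have PE (M : 'M[R]_4) (z : 'cV_4) : (M *m z) a 0 = \sum_m M a m * z m 0 by rewrite mxE.
have BE (z z' : 'cV[R]_4) : (z - z') a 0 = z a 0 - z' a 0 by rewrite !mxE.
have h' n : ((nx n).+1 < 4)%N by exact: h.
rewrite BE !PE !sum_ord4 !(sliceE _ _ (h' _)) !(colE _ (h _)) {h'}.
by move: i hi {h PE BE}; apply: nat3P; elim/ord4P: a; rewrite /example_tensor /=; ring.
Qed.

Let cornerE i : (i < 3)%N -> corner_coef F i = 0.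
Proof.
move=> hi; have h n : (nx n < 3)%N by case: n => [|[|]].
by rewrite /corner_coef /jacobi_coef !(jacE _ (h _)) !mul0r !addr0.
Qed.

Let Xtab : seq (seq R) :=
  [:: [:: 0; 0; 3%:R; 3%:R; 0]; [:: 0; 0; 6%:R; 0; 0];
      [:: 3%:R; 6%:R; 0; 0; - 9%:R]; [:: 3%:R; 0; 0; 0; 3%:R];
      [:: 0; 0; - 3%:R; 1; 0]].

Let X : 'M[R]_5 := \matrix_(i, j) nth 0 (nth [::] Xtab i) j.

Let ext_sumE : ext_sum F = X.
Proof.
have DE (M M' : 'M[R]_5) i j : (M + M') i j = M i j + M' i j by rewrite mxE.
have h1 : (1 < 3)%N by []. have h2 : (2 < 3)%N by [].
have entry k (i j : 'I_4) : (k < 3)%N -> ext_slice F k (lshift 1 i) (lshift 1 j)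
    = 3%:R * (example_tensor k.+1 i j)%:R.
  move=> hk; rewrite /ext_slice block_mxEul slice_det1 detE adj1 mulmx1 mul1r mxE sliceE //.
have entryr k (i : 'I_4) : (k < 3)%N -> ext_slice F k (lshift 1 i) (rshift 4 ord0)
    = 3%:R * (if val i == k.+1 then if k == 2%N then 1 else - 3%:R else 0).
  by move=> hk; rewrite /ext_slice block_mxEur slice_det1 detE expr1n mul1r mxE colE.
have entryl k (j : 'I_4) : (k < 3)%N -> ext_slice F k (rshift 4 ord0) (lshift 1 j)
    = if val j == k.+1 then if k == 2%N then 1 else - 3%:R else 0.
  by move=> hk; rewrite /ext_slice block_mxEdl adj1 mulmx1 mxE colE.
have entryd k : (k < 3)%N -> ext_slice F k (rshift 4 ord0) (rshift 4 ord0) = 0.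
  by move=> hk; rewrite /ext_slice block_mxEdr cornerE // mulr0 mxE mul0rn.
apply/matrixP => i j; rewrite /ext_sum DE [RHS]mxE.
have [i' ->|i' ->] := @split_ordP 4 1 i; have [j' ->|j' ->] := @split_ordP 4 1 j;
  rewrite ?(ord1 i') ?(ord1 j').
- rewrite !entry //; elim/ord4P: i' {i}; elim/ord4P: j' {j}; rewrite /example_tensor /=; ring.
- rewrite !entryr //; elim/ord4P: i' {i}; rewrite /=; ring.
- rewrite !entryl //; elim/ord4P: j' {j}; rewrite /=; ring.
- by rewrite !entryd //= addr0.
Qed.

Let krylov (s : seq R) : 'rV[R]_5 := \row_j nth 0 s j.

Let krylov_mul s (x0 x1 x2 x3 x4 : R) : s = [:: x0; x1; x2; x3; x4] ->
  krylov s *m X = krylov [:: 3%:R * x2 + 3%:R * x3; 6%:R * x2;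
    3%:R * x0 + 6%:R * x1 - 3%:R * x4; 3%:R * x0 + x4; - 9%:R * x2 + 3%:R * x3].
Proof.
move=> ->; apply/rowP => j; rewrite !mxE !big_ord_recl big_ord0 !mxE /=.
by move: j => [[|[|[|[|[|//]]]]] hj] /=; ring.
Qed.

Let chi_poly : {poly R} := 'X^5 - 84%:R *: 'X^3 + 864%:R *: 'X.

(** Cayley-Hamilton applied to the first unit row vector, with explicit iterates [e1], ..., [e5],
    yields five linear equations for the five unknown coefficients; no determinant is expanded. *)
Lemma example_char_poly : char_poly X = chi_poly.
Proof.
pose c i := (char_poly X)`_i.
have sz : size (char_poly X) = 6%N by rewrite size_char_poly.
have c5 : c 5 = 1 by have := monicP (char_poly_monic X); rewrite /lead_coef sz.
have chiE : char_poly X = \sum_(i < 6) c i *: 'X^i.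
  by rewrite -poly_def -[LHS]coefK sz.
pose e := krylov [:: 1; 0; 0; 0; 0].
pose e1 := krylov [:: 0; 0; 3%:R; 3%:R; 0].
pose e2 := krylov [:: 18%:R; 18%:R; 0; 0; - 18%:R].
pose e3 := krylov [:: 0; 0; 216%:R; 36%:R; 0].
pose e4 := krylov [:: 756%:R; 1296%:R; 0; 0; - 1836%:R].
pose e5 := krylov [:: 0; 0; 36%:R * 432%:R; 432%:R; 0].
have s1 : e *m X = e1.
  by rewrite (krylov_mul (erefl _)); congr (krylov [:: _; _; _; _; _]); ring.
have s2 : e1 *m X = e2.
  by rewrite (krylov_mul (erefl _)); congr (krylov [:: _; _; _; _; _]); ring.
have s3 : e2 *m X = e3.
  by rewrite (krylov_mul (erefl _)); congr (krylov [:: _; _; _; _; _]); ring.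
have s4 : e3 *m X = e4.
  by rewrite (krylov_mul (erefl _)); congr (krylov [:: _; _; _; _; _]); ring.
have s5 : e4 *m X = e5.
  by rewrite (krylov_mul (erefl _)); congr (krylov [:: _; _; _; _; _]); ring.
have CH : e *m horner_mx X (char_poly X) = 0 by rewrite Cayley_Hamilton mulmx0.
have hX i : horner_mx X 'X^i = X ^+ i by rewrite rmorphXn /= horner_mx_X.
have XS (z : 'rV_5) i : z *m X ^+ i.+1 = (z *m X) *m X ^+ i by rewrite exprS mulmxA.
have rel : c 0%N *: e + c 1%N *: e1 + c 2%N *: e2 + c 3%N *: e3 + c 4%N *: e4 + e5 = 0.
  rewrite -[RHS]CH chiE !big_ord_recl big_ord0 /= addr0 !rmorphD /= !linearZ /= !hX.
  rewrite !mulmxDr -!scalemxAr !XS !expr0 !mulmx1 s1 s2 s3 s4 s5 /bump /= c5 scale1r.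
  by rewrite !addrA.
have r (j : 'I_5) : c 0%N * nth 0 [:: 1; 0; 0; 0; 0] j + c 1%N * nth 0 [:: 0; 0; 3%:R; 3%:R; 0] j
   + c 2%N * nth 0 [:: 18%:R; 18%:R; 0; 0; - 18%:R] j + c 3%N * nth 0 [:: 0; 0; 216%:R; 36%:R; 0] j
   + c 4%N * nth 0 [:: 756%:R; 1296%:R; 0; 0; - 1836%:R] j + nth 0 [:: 0; 0; 36%:R * 432%:R; 432%:R; 0] j = 0.
  by have := congr1 (fun M : 'rV_5 => M 0 j) rel; rewrite !mxE.
have r0 := r (@Ordinal 5 0 isT); have r1 := r (@Ordinal 5 1 isT).
have r2 := r (@Ordinal 5 2 isT); have r3 := r (@Ordinal 5 3 isT).
have r4 := r (@Ordinal 5 4 isT); rewrite /= in r0 r1 r2 r3 r4.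
have c0 : c 0%N = 0 by lra.
have c1 : c 1%N = 864%:R by lra.
have c2 : c 2%N = 0 by lra.
have c3 : c 3%N = - 84%:R by lra.
have c4 : c 4%N = 0 by lra.
rewrite chiE !big_ord_recl big_ord0 /= /bump /= c0 c1 c2 c3 c4 c5 !scale0r scale1r scaleNr.
by rewrite /chi_poly expr1 !add0r !addr0; ring.
Qed.

Lemma example_sylvester_poly : sylvester_poly F != 0.
Proof.
rewrite /sylvester_poly slice_det1 detE mul1r mulf_neq0 ?pnatr_eq0 // ext_sumE.
have nz12 : 12%:R != 0 :> R by rewrite pnatr_eq0.
have nz144 : 144%:R != 0 :> R by rewrite pnatr_eq0.
(* The polynomial is 'X ('X^2 - 12) ('X^2 - 72); with [t] equal to 'X^2 / 12 its roots lie over t =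
   0, 1, 6. *)
have [t tV tE] : exists2 t : {poly R}, t = (12%:R^-1)%:P * 'X^2 & 'X^2 = 12%:R * t.
  by exists ((12%:R^-1)%:P * 'X^2) => //; rewrite mulrA -polyC_natr -polyCM divff // mul1r.
have chiE : chi_poly = 144%:R * ('X * (t ^+ 2 - 7%:R * t + 6%:R)).
  rewrite /chi_poly !scaler_nat (_ : 'X^5 = 'X * ('X^2) ^+ 2); last by ring.
  by rewrite (_ : 'X^3 = 'X * 'X^2); [rewrite tE; ring | ring].
have dE : chi_poly^`() = 144%:R * (5%:R * t ^+ 2 - 21%:R * t + 6%:R).
  rewrite /chi_poly !derivE !scaler_nat (_ : 'X^4 = ('X^2) ^+ 2); last by ring.
  by rewrite tE; ring.
(* [u] interpolates 600 / (5 t^2 - 21 t + 6) at t = 0, 1, 6, with values 100, -60, 10, so [u] times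
   the derivative is constant modulo [chi_poly]. *)
pose u : {poly R} := 29%:R * t ^+ 2 - 189%:R * t + 100%:R.
pose q : {poly R} := (145%:R * t - 539%:R) * ((12%:R^-1)%:P * 'X).
have bezout : u * chi_poly^`() = 144%:R * 600%:R + q * chi_poly.
  rewrite dE chiE (_ : q * _ = (145%:R * t - 539%:R) * (144%:R * (t * (t ^+ 2 - 7%:R * t + 6%:R)))).
    by rewrite /u; ring.
  by rewrite /q {5}tV; ring.
have : \det (horner_mx X (u * chi_poly^`())) != 0.
  rewrite bezout rmorphD /= [horner_mx X (q * _)]rmorphM /=.
  rewrite -example_char_poly Cayley_Hamilton mulr0 addr0 rmorphM !rmorph_nat.
  by rewrite -natrM -scaler_nat detZ det1 mulr1 expf_neq0 // pnatr_eq0.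
by rewrite rmorphM det_mulmx mulf_eq0 negb_or -example_char_poly => /andP[].
Qed.

End Example.

Section TensorCubic.
Variables (R : numFieldType) (F : 'I_4 -> 'I_4 -> 'I_4 -> R).
Hypothesis F_sym : forall i j k, F i j k = F j i k.
Hypothesis F_symr : forall i j k, F i j k = F i k j.

Definition tensor_cubic : {mpoly R[4]} :=
  \sum_i \sum_j \sum_k (6%:R^-1 * F i j k) *: ('X_i * 'X_j * 'X_k).

Lemma tensor_cubic_homog : tensor_cubic \is 3.-homog.
Proof.
have hX l : 'X_l \is [in R[4], 1.-homog] by rewrite dhomogX /= mdeg1.
do 3!(apply: rpred_sum => ? _); apply: rpredZ.
by rewrite -[3%N]/(1 + 1 + 1)%N !dhomogM.
Qed.

Lemma polar_coef_monomial (a b c i j k : 'I_4) :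
  polar_coef ('X_a * 'X_b * 'X_c : {mpoly R[4]}) i j k =
    (i == a)%:R * (j == b)%:R * (k == c)%:R + (i == a)%:R * (k == b)%:R * (j == c)%:R
    + (j == a)%:R * (i == b)%:R * (k == c)%:R + (k == a)%:R * (i == b)%:R * (j == c)%:R
    + (j == a)%:R * (k == b)%:R * (i == c)%:R + (k == a)%:R * (j == b)%:R * (i == c)%:R.
Proof.
have dX (l m : 'I_4) : mderiv l ('X_m : {mpoly R[4]}) = (l == m)%:R%:MP.
  rewrite mderivX mnm1E eq_sym; case: eqP => [->|_]; last by rewrite scale0r.
  by rewrite -{1}[U_(m)%MM]add0m addmK mpolyX0 scale1r.
rewrite /polar_coef !(mderivM, dX, mderivD, mderivC, mul0r, mulr0, add0r, addr0).
by rewrite -!(mpolyCM, mpolyCD) mcoeffC eqxx mulr1; ring.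
Qed.

(** Each monomial contributes all six permutations of the indices, equal by symmetry of [F]; the
    factor [6%:R^-1] compensates. *)
Lemma polar_coef_tensor_cubic i j k : polar_coef tensor_cubic i j k = F i j k.
Proof.
have polarD p q : polar_coef (p + q) i j k = polar_coef p i j k + polar_coef q i j k :> R.
  by rewrite /polar_coef !raddfD.
have polar0 : polar_coef (0 : {mpoly R[4]}) i j k = 0 by rewrite /polar_coef !raddf0.
have polarZ x p : polar_coef (x *: p) i j k = x * polar_coef p i j k :> R.
  by rewrite /polar_coef !mderivZ mcoeffZ.
have delta (x y z : 'I_4) : \sum_i \sum_j \sum_k
    F i j k * ((x == i)%:R * (y == j)%:R * (z == k)%:R) = F x y z.
  rewrite (bigD1 x) //= [X in _ + X]big1 ?addr0 => [|l /negPf ne]; last first.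
    rewrite big1 // => m _; rewrite big1 // => n _.
    by rewrite eq_sym ne !mul0r mulr0.
  rewrite (bigD1 y) //= [X in _ + X]big1 ?addr0 => [|l /negPf ne]; last first.
    by rewrite big1 // => m _; rewrite (eq_sym y) ne mulr0 mul0r mulr0.
  rewrite (bigD1 z) //= [X in _ + X]big1 ?addr0 => [|l /negPf ne].
    by rewrite !eqxx !mulr1.
  by rewrite (eq_sym z) ne !mulr0.
have sumE (I : finType) (G : I -> {mpoly R[4]}) :
    polar_coef (\sum_l G l) i j k = \sum_l polar_coef (G l) i j k :> R.
  exact: (big_morph (fun p => polar_coef p i j k) polarD polar0).
rewrite sumE; under eq_bigr => x _.
  rewrite sumE; under eq_bigr => y _.
    rewrite sumE; under eq_bigr => z _ do rewrite polarZ polar_coef_monomial -(mulrA 6%:R^-1).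
    rewrite -mulr_sumr; under eq_bigr => z _ do rewrite !mulrDr.
    rewrite !big_split /=; over.
  rewrite -mulr_sumr !big_split /=; over.
rewrite -mulr_sumr !big_split /= !delta.
rewrite -(F_symr i j k) (F_sym j i k) (F_sym k i j) -(F_symr i j k).
rewrite (F_symr j k i) (F_sym j i k) (F_sym k j i) (F_symr j k i) (F_sym j i k).
by field.
Qed.

End TensorCubic.

Lemma generic_sylvester_nonzero (R : realFieldType) :
  exists2 f : {mpoly R[4]}, f \is 3.-homog & sylvester_poly (cubic_polar f) != 0.
Proof.
pose T (i j k : 'I_4) : R := (example_tensor i j k)%:R.
have Ts i j k : T i j k = T j i k.
  by rewrite /T; elim/ord4P: i; elim/ord4P: j; elim/ord4P: k.
have Tr i j k : T i j k = T i k j.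
  by rewrite /T; elim/ord4P: i; elim/ord4P: j; elim/ord4P: k.
exists (tensor_cubic T); first exact: tensor_cubic_homog.
apply: example_sylvester_poly => i j k hi hj hk.
rewrite cubic_polarE polar_coef_tensor_cubic // /T.
have ordE l : (l < 4)%N -> val (ord4 l) = l by move: l => [|[|[|[|]]]].
by congr (example_tensor _ _ _)%:R; apply: ordE.
Qed.

(** * Conclusion *)

Section Algorithm.
Variables (R : fieldType) (K : numClosedFieldType) (iota : {rmorphism R -> K}).
Variables (re : {additive K -> R}) (v w : K).
Hypothesis ext : quadratic_extension iota re v w.
Variable f : {mpoly R[4]}.
Hypotheses (f_cubic : f \is 3.-homog) (f_generic : sylvester_poly (cubic_polar f) != 0).

Lemma ord4_val (i : 'I_4) : ord4 i = i.
Proof. by apply: val_inj; case: i => [[|[|[|[|]]]]]. Qed.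

Lemma polar_matrix_unit : polar_matrix f o0 \in unitmx.
Proof.
rewrite unitmxE unitfE (_ : polar_matrix f o0 = slice (cubic_polar f) 0).
  by apply: contraNneq f_generic => d0; rewrite /sylvester_poly /slice_det d0 !mul0r.
by apply/matrixP => i j; rewrite !mxE cubic_polarE !ord4_val.
Qed.

(** Genericity passes to the large field because [sylvester_poly] commutes with [iota]; the tensor
    decomposition found there gives one of [f], as third derivatives determine a cubic. *)
Lemma cubes_exist : exists a Y tau, map_mpoly iota f = cubes a /\ @pentad K a Y tau.
Proof.
pose F i j k := iota (cubic_polar f i j k).
have Fs i j k : F i j k = F j i k by rewrite /F !cubic_polarE polar_coefC.
have Fr i j k : F i j k = F i k j by rewrite /F !cubic_polarE polar_coefCr.
have [|ell [r [r_nz rel full FE]]] := cubes_of_tensor Fs Fr.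
  by rewrite sylvester_poly_map fmorph_eq0.
have [Y [tau Ya]] := pentad_exists r_nz rel full.
exists ell, Y, tau; split=> //; apply: cubic_polar_eq => [||i j k].
- exact: map_mpoly_homog.
- exact: cubes_homog.
by rewrite polar_coef_map polar_coef_cubes -FE /F cubic_polarE !ord4_val.
Qed.

Lemma sylvester_algorithm : exists a : 'I_5 -> 'rV[K]_4,
  (map_mpoly iota f = \sum_(i < 5) linear_form (a i) ^+ 3 /\
   forall b : 'I_5 -> 'rV[K]_4, map_mpoly iota f = \sum_(i < 5) linear_form (b i) ^+ 3 ->
     exists s : 'S_5, forall i, exists z : K, z ^+ 3 = 1 /\ b i = z *: a (s i)) /\
  (exists g : 'I_6 -> {mpoly R[4]}, quadric_generators (apolar_ideal f) g) /\
  forall g : 'I_6 -> {mpoly R[4]}, quadric_generators (apolar_ideal f) g ->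
    (exists l : 'I_5 -> 'I_6 -> {mpoly R[4]}, independent_linear_syzygies g l) /\
    forall l : 'I_5 -> 'I_6 -> {mpoly R[4]}, independent_linear_syzygies g l ->
      (forall s, linear_syzygy g s -> syz_span l s) /\
      (exists c : 'rV[R]_6, c != 0 /\ syz_relation l c) /\
      forall c : 'rV[R]_6, c != 0 -> syz_relation l c ->
        forall k : 'I_6, c 0 k != 0 ->
          forall z : 'rV[K]_4,
            (z != 0 /\ forall p, ideal_gen (pivot_quadrics g c k) p ->
               (map_mpoly iota p).@[fun i => z 0 i] = 0) <->
            exists i : 'I_5, same_point z (a i).
Proof.
have [a [Y [tau [fa Ya]]]] := cubes_exist.
have f_nz := pentad_cubic_neq0 ext fa Ya.
exists a; split; first split=> // b fb.
  exact: (pentad_unique Ya (etrans (esym fb) fa)).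
split=> [|g g_gen].
  exists (apolar_quadric f).
  exact: (apolar_ideal_generators f_cubic polar_matrix_unit ext fa Ya).
split=> [|l l_syz]; first exact: (independent_linear_syzygies_exist f_cubic g_gen f_nz).
split=> [s|]; first exact: (independent_linear_syzygies_span f_cubic g_gen f_nz l_syz).
split=> [|c _ c_rel k ck z]; first exact: (real_relation_exists ext fa Ya g_gen l_syz).
exact: (pivot_variety ext f_cubic fa Ya g_gen l_syz).
Qed.

End Algorithm.

Section ComplexNumbers.
Variable R : rcfType.

Definition complex_re (x : R[i]) : R := complex.Re x.

Lemma complex_re_is_zmod_morphism : zmod_morphism complex_re.
Proof. by move=> [a b] [c d]. Qed.

HB.instance Definition _ :=
  GRing.isZmodMorphism.Build R[i] R complex_re complex_re_is_zmod_morphism.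

Lemma complex_quadratic_extension :
  quadratic_extension (real_complex R) complex_re 'i%C (- 'i%C).
Proof.
split=> [y|[a b] y|[a b]] //.
- by rewrite /complex_re /= mulr0 subr0.
apply/eqP; rewrite eq_complex /complex_re /=.
by rewrite !(mul0r, mul1r, mulr0, mulN1r, oppr0, add0r, addr0, sub0r, subr0, opprK) !eqxx.
Qed.

End ComplexNumbers.

Theorem proposition3p3 (R : realType) :
  for_general_cubic (fun f : {mpoly R[4]} =>
    exists ell : 'I_5 -> 'rV[R[i]]_4,
      is_unique_cubes_decomposition f ell /\
      (exists g : 'I_6 -> {mpoly R[4]}, quadric_generators (apolar_ideal f) g) /\
      forall g : 'I_6 -> {mpoly R[4]}, quadric_generators (apolar_ideal f) g ->
        (exists l : 'I_5 -> 'I_6 -> {mpoly R[4]},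
            independent_linear_syzygies g l) /\
        forall l : 'I_5 -> 'I_6 -> {mpoly R[4]},
          independent_linear_syzygies g l ->
          (forall s, linear_syzygy g s -> syz_span l s) /\
          (exists c : 'rV[R]_6, c != 0 /\ syz_relation l c) /\
          forall c : 'rV[R]_6, c != 0 -> syz_relation l c ->
            forall k : 'I_6, c 0 k != 0 ->
              forall z : 'rV[R[i]]_4,
                proj_variety (ideal_gen (pivot_quadrics g c k)) z <->
                exists i : 'I_5, same_point z (ell i)).
Proof.
exists (fun P => P = sylvester_poly (@generic_polar R)); split=> [|f [f_cubic [_ [-> f_generic]]]].
  have [f f_cubic f_generic] := generic_sylvester_nonzero R.
  exists f; split=> //; exists (sylvester_poly (@generic_polar R)); split=> //.
  by rewrite sylvester_poly_generic; apply/eqP.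
have f_nz : sylvester_poly (cubic_polar f) != 0.
  by rewrite -sylvester_poly_generic; apply/eqP.
exact: (sylvester_algorithm (complex_quadratic_extension R) f_cubic f_nz).
Qed.
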